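(* Let $0 < \gamma < \beta$. Let $\psi_0 \in E(\tanh 2\beta)$ and let $(\psi_t)_{t\in\mathbb{R}}$ be the solution of the Schrödinger equation $$\frac{1}{i}\frac{\partial \psi}{\partial t} = H\psi, \qquad H = -\frac{\partial^2}{\partial x^2} + x^2,$$ with initial value $\psi_0$. Then for all $t \in \mathbb{R}$ $$\psi_t \in E(\tanh\gamma),$$ with bounded norm; that is, there is a constant $M$ independent of $t$ such that $|\psi_t(x)| \le M e^{-(\tanh\gamma)x^2/2}$ and $|\widehat{\psi_t}(\xi)| \le M e^{-(\tanh\gamma)\xi^2/2}$ for all $t, x, \xi \in \mathbb{R}$.
   Context: Functions are complex-valued. The Fourier transform of $f \in L^1(\mathbb{R})$ is $\hat f(\xi) = \frac{1}{\sqrt{2\pi}}\int_{\mathbb{R}} f(x) e^{-i\xi x}\,dx$. For $a > 0$, $E(a)$ is the set of all $f \in L^1(\mathbb{R})$ for which there is $C \in \mathbb{R}$ with $|f(x)| \le C e^{-ax^2/2}$ and $|\hat f(\xi)| \le C e^{-a\xi^2/2}$ for all $x, \xi \in \mathbb{R}$ (the bound on $f$ understood almost everywhere); the best (smallest) such constant $C$ is a norm on $E(a)$, and ''bounded norm'' refers to this norm. The inner product on $L^2(\mathbb{R})$ is $\langle f, g\rangle = \int_{\mathbb{R}} f(x)\overline{g(x)}\,\frac{dx}{\sqrt{2\pi}}$, and for $n \ge 0$ the normalized Hermite functions are $\varphi_n(x) = 2^{1/4}(2^n n!)^{-1/2} H_n(x) e^{-x^2/2}$ with $H_n(x) = (-1)^n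 e^{x^2}\frac{d^n}{dx^n}e^{-x^2}$; they satisfy $H\varphi_n = (2n+1)\varphi_n$. The solution of the Schrödinger equation is understood in the $L^2$ sense, $\psi_t = e^{itH}\psi_0 = \sum_{n=0}^\infty e^{(2n+1)it}\langle\psi_0,\varphi_n\rangle\varphi_n$. *)

(* Defs.v *)
From HB Require Import structures.
From mathcomp Require Import all_boot all_order all_algebra.
From mathcomp Require Export complex.
From mathcomp Require Import all_classical all_reals all_analysis.

Set Implicit Arguments.
Unset Strict Implicit.
Unset Printing Implicit Defensive.

Import Order.TTheory GRing.Theory Num.Theory.
Import numFieldNormedType.Exports.

Local Open Scope classical_set_scope.
Local Open Scope complex_scope.
Local Open Scope ring_scope.

Section Definitions.
Variable R : realType.
Implicit Types (f g : R -> R[i]) (a c t x xi : R) (n N : nat).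

Local Notation mu := (@lebesgue_measure R).

Definition tanh x : R := (expR x - expR (- x)) / (expR x + expR (- x)).

(* The real-valued modulus: the generic norm on [R[i]] takes its values in
   [R[i]]. *)
Definition cabs (z : R[i]) : R := Normc.normc z.

Definition cexpi x : R[i] := cos x +i* sin x.

(* Elements of L^1 and L^2 are represented by Borel functions; complex-valued
   functions are measured and integrated through their real and imaginary
   parts. *)
Definition cmeasurable f : Prop :=
  measurable_fun setT (fun x => complex.Re (f x)) /\
  measurable_fun setT (fun x => complex.Im (f x)).

Definition cintegrable f : Prop :=
  mu.-integrable setT (fun x => (complex.Re (f x))%:E) /\
  mu.-integrable setT (fun x => (complex.Im (f x))%:E).

Definition cintegral f : R[i] :=
  (\int[mu]_x complex.Re (f x)) +i* (\int[mu]_x complex.Im (f x)).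

Definition fourier f xi : R[i] :=
  ((Num.sqrt (2 * pi))^-1)%:C * cintegral (fun x => f x * cexpi (- (xi * x))).

Definition E_bound a c f : Prop :=
  {ae mu, forall x, cabs (f x) <= c * expR (- (a * x ^+ 2) / 2)} /\
  forall xi, cabs (fourier f xi) <= c * expR (- (a * xi ^+ 2) / 2).

Definition E a : set (R -> R[i]) :=
  [set f | cintegrable f /\ exists c, E_bound a c f].

Definition hermite n x : R :=
  (-1) ^+ n * expR (x ^+ 2) * derive1n n (fun y : R => expR (- y ^+ 2)) x.

Definition hermite_fun n x : R :=
  2 `^ (4^-1) * (2 ^+ n * (n`!)%:R) `^ (- 2^-1) * hermite n x
  * expR (- x ^+ 2 / 2).

Definition inner f g : R[i] :=
  cintegral (fun x => f x * ((g x)^*)%C * ((Num.sqrt (2 * pi))^-1)%:C).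

(* The norm with respect to [dx]; it differs from the norm induced by [inner]
   by a constant factor, which affects neither finiteness nor convergence. *)
Definition L2norm f : \bar R := ('N[mu]_(2%:E)[(fun x => (cabs (f x))%:E)])%E.

Definition L2 : set (R -> R[i]) :=
  [set f | cmeasurable f /\ (L2norm f < +oo)%E].

Definition propagator_partial_sum (psi0 : R -> R[i]) t N x : R[i] :=
  \sum_(0 <= n < N)
    cexpi ((2 * n + 1)%:R * t) * inner psi0 (fun y => (hermite_fun n y)%:C)
    * (hermite_fun n x)%:C.

(* [psi t] is a representative of the L^2-class of [e^{itH} psi0], where
   [H = - d^2/dx^2 + x^2] is the self-adjoint operator on L^2 that is diagonal
   in the orthonormal basis [hermite_fun n], with eigenvalues [2 n + 1]. *)
Definition schrodinger_solution (psi0 : R -> R[i]) (psi : R -> R -> R[i])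
  : Prop :=
  forall t, L2 (psi t) /\
    (fun N => L2norm (fun x => psi t x - propagator_partial_sum psi0 t N x))
      @ \oo --> 0%E.

End Definitions.

(* Main.v *)
(* Writing [F t] for the integral of
   [psi0 x * exp (- x^2 / 2) * exp (2 x t - t^2)], the Taylor coefficients of
   the entire function [F] are the Hermite coefficients of [psi0] up to
   normalization. With [k = exp (- 2 beta)], the Gaussian bound on [psi0] gives
   [|F (u + i v)| <= C exp (k^2 u^2 + v^2)] and, by Fubini and the Fourier
   transform of Gaussians, the bound on the Fourier transform of [psi0] gives
   [|F (u + i v)| <= C exp (u^2 + k^2 v^2)]. On the ray [v = k u] the first
   exponent equals [2 k u v], on the ray [u = k v] the second one does, so the
   Phragmen-Lindelof principle in the sector between these rays, whose angle is
   less than [pi / 2], yields [|F t| <= C exp (k |t|^2)]. Cauchy's estimates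
   for [F] and for the generating function of the Hermite polynomials then show
   that the [n]-th term of the Hermite expansion of [psi_t] is at most
   [C q^n exp (- tanh gamma * x^2 / 2)] with [q < 1], uniformly in [t]. The same
   holds for its Fourier transform because Hermite functions are eigenfunctions
   of the Fourier transform. *)

Require Import Defs.
From mathcomp Require Import all_boot all_order all_algebra.
From mathcomp Require Import all_classical all_reals all_analysis.
From mathcomp Require Import measurable_realfun ring lra.

Set Implicit Arguments.
Unset Strict Implicit.
Unset Printing Implicit Defensive.

Import Order.TTheory GRing.Theory Num.Theory.
Import numFieldNormedType.Exports.

Local Open Scope classical_set_scope.
Local Open Scope complex_scope.
Local Open Scope ring_scope.

(** Analyticity enters only as a complex second-order Taylor expansion with cubic remainder at every
    point ([jet2]). Such expansions are stable under products and composition, survive integration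
    against a Gaussian, and already exclude interior maxima of |g|^2 + eps |z|^2, so no contour
    integral occurs. Cauchy's estimates come instead from averages over roots of unity, applied to
    truncated sums that approach the function with an error of order 2^-N on a circle. The value of
    k is forced by 1 / (1 + tanh (2 beta)) = (1 + k^2) / 2, which gives the two bounds on F their
    mirror-image exponents; tanh gamma enters through 1 - tanh gamma = 2 / (exp (2 gamma) + 1), when
    a square is completed in the generating function. The product of the two coefficient estimates
    loses a factor n + 1, and the strict inequality gamma < beta pays for it. The solution is given
    only as an L^2 limit. The tails of the expansion are dominated by small multiples of a fixed
    Gaussian, which gives the bound on psi_t almost everywhere and, through the L^1 norm, the bound
    on its Fourier transform at every point. *)

Local Notation Re := complex.Re.
Local Notation Im := complex.Im.

(** * Complex numbers and paths *)

Section ComplexNumbers.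
Variable R : realType.
Implicit Types (z w : R[i]) (x y : R).

Lemma cabs_ge0 z : 0 <= cabs z.
Proof. by case: z => a b; exact: sqrtr_ge0. Qed.

Lemma cabs_sqr z : cabs z ^+ 2 = Re z ^+ 2 + Im z ^+ 2.
Proof. by case: z => a b; rewrite /cabs /= sqr_sqrtr// addr_ge0// sqr_ge0. Qed.

Lemma cabsM z w : cabs (z * w) = cabs z * cabs w.
Proof. exact: Normc.normcM. Qed.

Lemma cabsD z w : cabs (z + w) <= cabs z + cabs w.
Proof. exact: le_normcD. Qed.

Lemma cabsN z : cabs (- z) = cabs z.
Proof. exact: normcN. Qed.

Lemma cabsB z w : cabs (z - w) <= cabs z + cabs w.
Proof. by rewrite -(cabsN w); exact: cabsD. Qed.

Lemma cabsBC z w : cabs (z - w) = cabs (w - z).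
Proof. by rewrite -cabsN opprB. Qed.

Lemma cabs_real x : cabs x%:C = `|x|.
Proof. by rewrite /cabs /= expr0n addr0 sqrtr_sqr. Qed.

Lemma cabs0 : cabs (0 : R[i]) = 0.
Proof. by rewrite cabs_real normr0. Qed.

Lemma cabs1 : cabs (1 : R[i]) = 1.
Proof. by rewrite cabs_real normr1. Qed.

Lemma cabs_nat n : cabs (n%:R : R[i]) = n%:R.
Proof.
have -> : (n%:R : R[i]) = (n%:R)%:C by rewrite rmorph_nat.
by rewrite cabs_real ger0_norm.
Qed.

Lemma cabs0_eq0 z : cabs z = 0 -> z = 0.
Proof. exact: Normc.eq0_normc. Qed.

Lemma cabsX z n : cabs (z ^+ n) = cabs z ^+ n.
Proof. by elim: n => [|n IH]; rewrite ?expr0 ?cabs1// !exprS cabsM IH. Qed.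

Lemma cabsV z : cabs z^-1 = (cabs z)^-1.
Proof. exact: Normc.normcV. Qed.

Lemma cabs_i : cabs ('i%C : R[i]) = 1.
Proof. by rewrite /cabs /= expr0n expr1n add0r sqrtr1. Qed.

Lemma cabs_sum (I : Type) (r : seq I) (P : pred I) (F : I -> R[i]) :
  cabs (\sum_(i <- r | P i) F i) <= \sum_(i <- r | P i) cabs (F i).
Proof.
elim/big_ind2: _ => [|a b c d ab cd|//]; first by rewrite cabs0.
exact: le_trans (cabsD _ _) (lerD ab cd).
Qed.

Lemma normr_Re_le z : `|Re z| <= cabs z.
Proof.
rewrite -(ler_pXn2r (n := 2)) ?nnegrE ?cabs_ge0//.
by rewrite cabs_sqr real_normK ?num_real// lerDl sqr_ge0.
Qed.

Lemma normr_Im_le z : `|Im z| <= cabs z.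
Proof.
rewrite -(ler_pXn2r (n := 2)) ?nnegrE ?cabs_ge0//.
by rewrite cabs_sqr real_normK ?num_real// lerDr sqr_ge0.
Qed.

Lemma cabs_le_ReIm z : cabs z <= `|Re z| + `|Im z|.
Proof.
rewrite -(ler_pXn2r (n := 2)) ?nnegrE ?cabs_ge0 ?addr_ge0//.
rewrite cabs_sqr sqrrD !real_normK ?num_real// lerD2r lerDl.
by rewrite mulrn_wge0// mulr_ge0.
Qed.

Lemma ReM z w : Re (z * w) = Re z * Re w - Im z * Im w.
Proof. by case: z; case: w. Qed.

Lemma ImM z w : Im (z * w) = Re z * Im w + Im z * Re w.
Proof. by case: z => a b; case: w. Qed.

Lemma ReD z w : Re (z + w) = Re z + Re w.
Proof. by case: z; case: w. Qed.

Lemma ImD z w : Im (z + w) = Im z + Im w.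
Proof. by case: z => a b; case: w. Qed.

Lemma ReN z : Re (- z) = - Re z.
Proof. by case: z. Qed.

Lemma ImN z : Im (- z) = - Im z.
Proof. by case: z. Qed.

Lemma complex_eq z w : Re z = Re w -> Im z = Im w -> z = w.
Proof. by case: z => a b; case: w => c d /= -> ->. Qed.

Lemma sqr_iC : 'i%C * 'i%C = -1 :> R[i].
Proof. by apply: complex_eq; rewrite ?ReM ?ImM /=; ring. Qed.

Definition cexp z : R[i] := (expR (Re z))%:C * cexpi (Im z).

Lemma cabs_cexpi x : cabs (cexpi x) = 1.
Proof. by rewrite /cabs /= cos2Dsin2 sqrtr1. Qed.

Lemma cabs_cexp z : cabs (cexp z) = expR (Re z).
Proof. by rewrite cabsM cabs_cexpi mulr1 cabs_real ger0_norm// expR_ge0. Qed.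

Lemma cexpD z w : cexp (z + w) = cexp z * cexp w.
Proof.
case: z => a b; case: w => c d; apply: complex_eq;
  rewrite /cexp !(ReM, ImM) /= expRD ?cosD ?sinD; ring.
Qed.

Lemma cexp_real x : cexp x%:C = (expR x)%:C.
Proof. by apply: complex_eq; rewrite /cexp !(ReM, ImM) /= cos0 sin0; ring. Qed.

Lemma cexp0 : cexp 0 = 1.
Proof. by rewrite (cexp_real 0) expR0. Qed.

Lemma cexpi_cexp x : cexpi x = cexp (x%:C * 'i%C).
Proof.
rewrite /cexp.
have -> : Re (x%:C * 'i%C) = 0 by rewrite ReM /=; ring.
have -> : Im (x%:C * 'i%C) = x by rewrite ImM /=; ring.
by rewrite expR0 mul1r.
Qed.

Lemma cexpN z : cexp (- z) = (cexp z)^-1.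
Proof.
apply: (mulIf (x := cexp z)); last rewrite mulVf.
- by apply/eqP => /(congr1 (@cabs R)); rewrite cabs_cexp cabs0 => /eqP; rewrite expR_eq0.
- by rewrite -cexpD addNr cexp0.
- by apply/eqP => /(congr1 (@cabs R)); rewrite cabs_cexp cabs0 => /eqP; rewrite expR_eq0.
Qed.

Lemma cexpMn z n : cexp (z *+ n) = cexp z ^+ n.
Proof.
by elim: n => [|n IH]; rewrite ?mulr0n ?cexp0// mulrS exprS cexpD IH.
Qed.

Lemma Re_le_cabs z : Re z <= cabs z.
Proof. exact: le_trans (ler_norm _) (normr_Re_le z). Qed.

End ComplexNumbers.

(** * Derivatives of complex-valued functions of a real variable *)

Section PathDerivative.
Variable R : realType.
Implicit Types (p q : R -> R[i]) (a b : R[i]) (s : R).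

(** Complex functions are differentiated only along a real parameter, so real calculus applied to
    both components suffices. *)
Definition path_derive p s a :=
  is_derive s 1 (fun y => Re (p y)) (Re a) /\
  is_derive s 1 (fun y => Im (p y)) (Im a).

Lemma path_derive_cst a s : path_derive (cst a) s 0.
Proof. by split; exact: is_derive_cst. Qed.

Lemma path_derive_id s : path_derive (fun y => y%:C) s 1.
Proof. by split; [exact: is_derive_id | exact: is_derive_cst]. Qed.

Lemma path_deriveD p q s a b : path_derive p s a -> path_derive q s b ->
  path_derive (fun y => p y + q y) s (a + b).
Proof.
move=> [pr pi] [qr qi]; split.
- have -> : (fun y => Re (p y + q y)) = (fun y => Re (p y)) + (fun y => Re (q y)).
    by apply/funext => y; rewrite ReD.
  rewrite ReD.
  exact: is_deriveD.
- have -> : (fun y => Im (p y + q y)) = (fun y => Im (p y)) + (fun y => Im (q y)).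
    by apply/funext => y; rewrite ImD.
  rewrite ImD.
  exact: is_deriveD.
Qed.

Lemma path_deriveM p q s a b : path_derive p s a -> path_derive q s b ->
  path_derive (fun y => p y * q y) s (a * q s + p s * b).
Proof.
move=> [pr pi] [qr qi]; split.
- have -> : (fun y => Re (p y * q y)) =
    (fun y => Re (p y)) * (fun y => Re (q y))
    - (fun y => Im (p y)) * (fun y => Im (q y)).
    by apply/funext => y; rewrite ReM.
  apply: is_derive_eq.
  rewrite -![_ *: _]/(_ * _).
  by move: (p s) (q s) a b {pr pi qr qi} => [? ?] [? ?] [? ?] [? ?] /=; ring.
- have -> : (fun y => Im (p y * q y)) =
    (fun y => Re (p y)) * (fun y => Im (q y))
    + (fun y => Im (p y)) * (fun y => Re (q y)).
    by apply/funext => y; rewrite ImM.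
  apply: is_derive_eq.
  rewrite -![_ *: _]/(_ * _).
  by move: (p s) (q s) a b {pr pi qr qi} => [? ?] [? ?] [? ?] [? ?] /=; ring.
Qed.

Lemma path_derive_eq p s a b : path_derive p s a -> a = b -> path_derive p s b.
Proof. by move=> + <-. Qed.

Lemma path_derive_sum (n : nat) (p : nat -> R -> R[i]) (a : nat -> R[i]) s :
  (forall m, path_derive (p m) s (a m)) ->
  path_derive (fun y => \sum_(0 <= m < n) p m y) s (\sum_(0 <= m < n) a m).
Proof.
move=> pa; elim: n => [|n IH].
  rewrite big_geq// (_ : (fun y => _) = cst 0); first exact: path_derive_cst.
  by apply/funext => y; rewrite big_geq.
rewrite big_nat_recr//=.
rewrite (_ : (fun y => _) = (fun y => \sum_(0 <= m < n) p m y + p n y)).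
  exact: path_deriveD.
by apply/funext => y; rewrite big_nat_recr.
Qed.

Lemma path_deriveX p s a n : path_derive p s a ->
  path_derive (fun y => p y ^+ n) s (n%:R * a * p s ^+ n.-1).
Proof.
move=> pa; elim: n => [|n IH].
  apply: path_derive_eq (_ : path_derive (cst 1) s 0) _.
    exact: path_derive_cst.
  by rewrite !mul0r.
rewrite (_ : (fun y => _) = (fun y => p y * p y ^+ n)); last first.
  by apply/funext => y; rewrite exprS.
apply: path_derive_eq (path_deriveM pa IH) _.
case: n {IH} => [|n]; first by rewrite /= expr0; ring.
by rewrite /= exprS -[n.+2%:R]natr1 -[n.+1%:R]natr1; ring.
Qed.

Lemma path_derive_cexp p s a : path_derive p s a ->
  path_derive (fun y => cexp (p y)) s (a * cexp (p s)).
Proof.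
move=> [pr pi]; split.
- have -> : (fun y => Re (cexp (p y))) =
    (expR \o (fun y => Re (p y))) * (cos \o (fun y => Im (p y))).
    by apply/funext => y; rewrite /cexp ReM /= mul0r subr0.
  apply: is_derive_eq.
  rewrite -![_ *: _]/(_ * _) /= /cexp !(ReM, ImM) /=; ring.
- have -> : (fun y => Im (cexp (p y))) =
    (expR \o (fun y => Re (p y))) * (sin \o (fun y => Im (p y))).
    by apply/funext => y; rewrite /cexp ImM /= mul0r addr0.
  apply: is_derive_eq.
  rewrite -![_ *: _]/(_ * _) /= /cexp !(ReM, ImM) /=; ring.
Qed.

(* The mean value theorem is applied to the real and imaginary parts
   separately, whence the factor 2. *)
Lemma path_mean_value p (p' : R -> R[i]) (M : R) :
  (forall s, 0 <= s <= 1 -> path_derive p s (p' s)) ->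
  (forall s, 0 <= s <= 1 -> cabs (p' s) <= M) ->
  cabs (p 1 - p 0) <= 2 * M.
Proof.
move=> dp p'M.
have mvt (f df : R -> R) : (forall s, 0 <= s <= 1 -> is_derive s 1 f (df s)) ->
    (forall s, 0 <= s <= 1 -> `|df s| <= M) -> `|f 1 - f 0| <= M.
  move=> fd dfM.
  have [||c + ->] := @MVT R f df 0 1 ltr01.
  - by move=> x; rewrite in_itv/= => /andP[x0 x1]; apply: fd; rewrite !ltW.
  - apply: derivable_within_continuous => x; rewrite in_itv/= => x01.
    by have [] := fd x x01.
  - by rewrite in_itv/= => /andP[x0 x1]; rewrite subr0 mulr1 dfM// !ltW.
rewrite mulr2n mulrDl mul1r; apply: (le_trans (cabs_le_ReIm _)).
rewrite ReD ReN ImD ImN.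
apply: lerD.
- apply: (mvt (fun y => Re (p y)) (fun y => Re (p' y))) => s s01.
    by have [] := dp s s01.
  by rewrite (le_trans (normr_Re_le _))// p'M.
- apply: (mvt (fun y => Im (p y)) (fun y => Im (p' y))) => s s01.
    by have [] := dp s s01.
  by rewrite (le_trans (normr_Im_le _))// p'M.
Qed.

(** The derivative along [s%:C * u] of a Taylor remainder of [cexp] is [u] times the remainder of
    one order less. Three uses of the mean value inequality reach order 3, each at the price of a
    factor 2, whence 8. *)
Lemma cexp_taylor3 (w : R[i]) :
  cabs (cexp w - 1 - w - 2^-1 * w ^+ 2) <= 8 * (cabs w ^+ 3 * expR (cabs w)).
Proof.
have A0 := cabs_ge0 w.
set E := expR (cabs w).
have E0 : 0 <= E by exact: expR_ge0.
have lin s : path_derive (fun y => y%:C * w) s w.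
  apply: path_derive_eq (path_deriveM (path_derive_id s) (path_derive_cst w s)) _.
  by rewrite mulr0 addr0 mul1r.
have dE s := path_derive_cexp (lin s).
have cs (s : R) : 0 <= s <= 1 -> cabs (s%:C * w) <= cabs w.
  move=> /andP[s0 s1]; rewrite cabsM cabs_real ger0_norm//.
  by rewrite ler_piMl.
have step1 (u : R[i]) : cabs u <= cabs w -> cabs (cexp u - 1) <= 2 * (cabs u * E).
  move=> uw.
  have linu s : path_derive (fun y => y%:C * u) s u.
    apply: path_derive_eq (path_deriveM (path_derive_id s) (path_derive_cst u s)) _.
    by rewrite mulr0 addr0 mul1r.
  have := path_mean_value (p := fun y => cexp (y%:C * u))
     (p' := fun s => u * cexp (s%:C * u)) (M := cabs u * E).
  rewrite mul1r mul0r cexp0; apply.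
    by move=> s _; exact: path_derive_cexp (linu s).
  move=> s /andP[s0 s1]; rewrite cabsM ler_wpM2l ?cabs_ge0// cabs_cexp ler_expR.
  apply: le_trans (Re_le_cabs _) _; rewrite cabsM cabs_real ger0_norm//.
  by apply: le_trans uw; rewrite ler_piMl ?cabs_ge0.
have step2 (u : R[i]) : cabs u <= cabs w ->
    cabs (cexp u - 1 - u) <= 4 * (cabs u ^+ 2 * E).
  move=> uw.
  have linu s : path_derive (fun y => y%:C * u) s u.
    apply: path_derive_eq (path_deriveM (path_derive_id s) (path_derive_cst u s)) _.
    by rewrite mulr0 addr0 mul1r.
  have := path_mean_value (p := fun y => cexp (y%:C * u) + (-1) * (y%:C * u))
     (p' := fun s => u * (cexp (s%:C * u) - 1)) (M := 2 * (cabs u ^+ 2 * E)).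
  rewrite mul1r mul0r cexp0.
  have -> : cexp u + -1 * u - (1 + -1 * 0) = cexp u - 1 - u by ring.
  rewrite (_ : 2 * (2 * (cabs u ^+ 2 * E)) = 4 * (cabs u ^+ 2 * E)); last ring.
  apply.
    move=> s _.
    apply: path_derive_eq (path_deriveD (path_derive_cexp (linu s))
      (path_deriveM (path_derive_cst (-1) s) (linu s))) _.
    by rewrite /cst; ring.
  move=> s /andP[s0 s1]; rewrite cabsM.
  have su : cabs (s%:C * u) <= cabs u.
    by rewrite cabsM cabs_real ger0_norm// ler_piMl ?cabs_ge0.
  apply: le_trans (ler_wpM2l (cabs_ge0 u) (step1 _ (le_trans su uw))) _.
  have -> : 2 * (cabs u ^+ 2 * E) = cabs u * (2 * (cabs u * E)) by ring.
  by rewrite !ler_wpM2l ?cabs_ge0// ler_wpM2r.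
have := path_mean_value
   (p := fun y => cexp (y%:C * w) + (-1) * (y%:C * w) + (- 2^-1) * (y%:C * w) ^+ 2)
   (p' := fun s => w * (cexp (s%:C * w) - 1 - (s%:C * w)))
   (M := 4 * (cabs w ^+ 3 * E)).
rewrite mul1r mul0r cexp0.
rewrite (_ : 2 * (4 * (cabs w ^+ 3 * E)) = 8 * (cabs w ^+ 3 * E)); last ring.
have -> : cexp w + -1 * w + (- 2^-1) * w ^+ 2 - (1 + -1 * 0 + (- 2^-1) * 0 ^+ 2)
   = cexp w - 1 - w - 2^-1 * w ^+ 2 by ring.
apply.
  move=> s _.
  apply: path_derive_eq (path_deriveD (path_deriveD (path_derive_cexp (lin s))
    (path_deriveM (path_derive_cst (-1) s) (lin s)))
    (path_deriveM (path_derive_cst (- 2^-1) s) (path_deriveX 2 (lin s)))) _.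
  by rewrite /cst (_ : 2.-1 = 1%N)// expr1; field.
move=> s s01; rewrite cabsM.
apply: le_trans (ler_wpM2l (cabs_ge0 w) (step2 _ (cs s s01))) _.
have -> : 4 * (cabs w ^+ 3 * E) = cabs w * (4 * (cabs w ^+ 2 * E)) by ring.
rewrite !ler_wpM2l ?cabs_ge0// ler_wpM2r// lerXn2r ?nnegrE ?cabs_ge0//.
exact: cs.
Qed.

End PathDerivative.

(** * The maximum principle *)

Section Jets.
Variable R : realType.
Implicit Types (g e r : R[i] -> R[i]) (z h b c : R[i]).

Definition bounded_near0 r :=
  exists d K : R, 0 < d /\ forall h, cabs h <= d -> cabs (r h) <= K.

Lemma bounded_near0_cst c : bounded_near0 (fun=> c).
Proof. by exists 1, (cabs c); split. Qed.

Lemma bounded_near0_id : bounded_near0 id.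
Proof. by exists 1, 1; split. Qed.

Lemma bounded_near0D r1 r2 : bounded_near0 r1 -> bounded_near0 r2 ->
  bounded_near0 (fun h => r1 h + r2 h).
Proof.
move=> [d1 [K1 [d10 H1]]] [d2 [K2 [d20 H2]]].
exists (Num.min d1 d2), (K1 + K2); split; first by rewrite lt_min d10.
move=> h; rewrite le_min => /andP[h1 h2].
exact: le_trans (cabsD _ _) (lerD (H1 _ h1) (H2 _ h2)).
Qed.

Lemma bounded_near0M r1 r2 : bounded_near0 r1 -> bounded_near0 r2 ->
  bounded_near0 (fun h => r1 h * r2 h).
Proof.
move=> [d1 [K1 [d10 H1]]] [d2 [K2 [d20 H2]]].
exists (Num.min d1 d2), (K1 * K2); split; first by rewrite lt_min d10.
move=> h; rewrite le_min => /andP[h1 h2].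
by rewrite cabsM ler_pM ?cabs_ge0// ?H1 ?H2.
Qed.

Lemma bounded_near0_comp r k : bounded_near0 r -> bounded_near0 k ->
  bounded_near0 (fun h => r (h * k h)).
Proof.
move=> [d1 [K1 [d10 H1]]] [d2 [K2 [d20 H2]]].
have K20 : 0 <= K2 by apply: le_trans (cabs_ge0 _) (H2 0 _); rewrite cabs0 ltW.
have K2p : 0 < K2 + 1 by rewrite ltr_wpDl.
exists (Num.min d2 (d1 / (K2 + 1))), K1; split.
  by rewrite lt_min d20 divr_gt0.
move=> h; rewrite le_min => /andP[h1 h2]; apply: H1; rewrite cabsM.
move: h2; rewrite ler_pdivlMr// => h2; apply: le_trans h2.
by rewrite ler_wpM2l ?cabs_ge0// (le_trans (H2 _ h1))// lerDl.
Qed.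

(* A complex second-order Taylor expansion at [z]; this is all the analyticity
   that the maximum principle below requires. *)
Definition jet2 g z := exists b c r, bounded_near0 r /\
  forall h, g (z + h) = g z + b * h + c * h ^+ 2 + r h * h ^+ 3.

Lemma jet2_bound g z b c (d K : R) : 0 < d ->
  (forall h, cabs h <= d ->
     cabs (g (z + h) - g z - b * h - c * h ^+ 2) <= K * cabs h ^+ 3) ->
  jet2 g z.
Proof.
move=> d0 H.
(* At [h = 0] the quotient is 0 by the convention for division, and the expansion holds there
   trivially. *)
exists b, c, (fun h => (g (z + h) - g z - b * h - c * h ^+ 2) / h ^+ 3).
split; last first.
  move=> h; have [->|h0] := eqVneq h 0.
    by rewrite addr0 !mulr0 !expr0n !mulr0 !addr0.
  rewrite divfK ?expf_neq0//; ring.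
exists d, `|K|; split=> // h hd; rewrite cabsM cabsV cabsX.
have [h0|h0] := eqVneq (cabs h) 0.
  by rewrite h0 expr0n invr0 mulr0.
have hp : 0 < cabs h by rewrite lt_neqAle eq_sym h0 cabs_ge0.
rewrite ler_pdivrMr ?exprn_gt0//; apply: le_trans (H h hd) _.
by rewrite ler_wpM2r ?exprn_ge0 ?cabs_ge0// ler_norm.
Qed.

Lemma jet2_cst c z : jet2 (fun=> c) z.
Proof.
exists 0, 0, (fun=> 0); split; first exact: bounded_near0_cst.
by move=> h; ring.
Qed.

Lemma jet2_id z : jet2 id z.
Proof.
exists 1, 0, (fun=> 0); split; first exact: bounded_near0_cst.
by move=> h; ring.
Qed.

Lemma jet2D g1 g2 z : jet2 g1 z -> jet2 g2 z -> jet2 (fun w => g1 w + g2 w) z.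
Proof.
move=> [b1 [c1 [r1 [B1 E1]]]] [b2 [c2 [r2 [B2 E2]]]].
exists (b1 + b2), (c1 + c2), (fun h => r1 h + r2 h).
split; first exact: bounded_near0D.
by move=> h; rewrite E1 E2; ring.
Qed.

Lemma jet2M g1 g2 z : jet2 g1 z -> jet2 g2 z -> jet2 (fun w => g1 w * g2 w) z.
Proof.
move=> [b1 [c1 [r1 [B1 E1]]]] [b2 [c2 [r2 [B2 E2]]]].
exists (b1 * g2 z + g1 z * b2), (g1 z * c2 + b1 * b2 + c1 * g2 z),
  (fun h => (b1 * c2 + c1 * b2 + c1 * c2 * h)
    + ((g1 z + b1 * h + c1 * h * h) * r2 h + (g2 z + b2 * h + c2 * h * h) * r1 h
    + h * h * h * r1 h * r2 h)); split; last first.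
  by move=> h; rewrite E1 E2; ring.
by repeat (apply: bounded_near0D || apply: bounded_near0M || exact: B1 ||
  exact: B2 || exact: bounded_near0_id || exact: bounded_near0_cst).
Qed.

(** The increment of [e] is [h * k h] with [k] bounded near 0; the expansion of [g] is used at that
    increment, and everything of order at least 3 goes into the remainder. *)
Lemma jet2_comp g e z : jet2 g (e z) -> jet2 e z -> jet2 (fun w => g (e w)) z.
Proof.
move=> [b1 [c1 [r1 [B1 E1]]]] [b2 [c2 [r2 [B2 E2]]]].
pose k h := b2 + c2 * h + r2 h * h * h.
have Bk : bounded_near0 k.
  by repeat (apply: bounded_near0D || apply: bounded_near0M || exact: B1 ||
    exact: B2 || exact: bounded_near0_id || exact: bounded_near0_cst).
have Br := bounded_near0_comp B1 Bk.
pose k1 h := c2 + r2 h * h.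
exists (b1 * b2), (b1 * c2 + c1 * b2 * b2),
  (fun h => b1 * r2 h + c1 * ((1 + 1) * b2 * (c2 + r2 h * h)
      + h * (c2 + r2 h * h) * (c2 + r2 h * h))
    + r1 (h * k h) * k h * k h * k h); split; last first.
  move=> h; have -> : e (z + h) = e z + h * k h by rewrite E2 /k; ring.
  by rewrite E1 /k; ring.
by repeat (apply: bounded_near0D || apply: bounded_near0M || exact: B1 ||
  exact: B2 || exact: Bk || exact: Br ||
  exact: bounded_near0_id || exact: bounded_near0_cst).
Qed.

Lemma jet2_cexp z : jet2 (@cexp R) z.
Proof.
apply: (@jet2_bound _ _ (cexp z) (cexp z * 2^-1) 1
  (cabs (cexp z) * (8 * expR 1))) => // h h1.
have -> : cexp (z + h) - cexp z - cexp z * h - cexp z * 2^-1 * h ^+ 2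
   = cexp z * (cexp h - 1 - h - 2^-1 * h ^+ 2) by rewrite cexpD; ring.
rewrite cabsM -!mulrA ler_wpM2l ?cabs_ge0//.
apply: le_trans (cexp_taylor3 h) _.
rewrite ler_wpM2l// [leRHS]mulrC ler_wpM2l ?exprn_ge0 ?cabs_ge0//.
by rewrite ler_expR.
Qed.

Lemma jet2_lipschitz g z : jet2 g z -> exists d K : R,
  [/\ 0 < d, 0 <= K &
      forall h, cabs h <= d -> cabs (g (z + h) - g z) <= K * cabs h].
Proof.
move=> [b [c [r [B E]]]].
have [d [K [d0 H]]] : bounded_near0 (fun h => b + c * h + r h * h * h).
  by repeat (apply: bounded_near0D || apply: bounded_near0M || exact: B ||
    exact: bounded_near0_id || exact: bounded_near0_cst).
have K0 : 0 <= K by apply: le_trans (cabs_ge0 _) (H 0 _); rewrite cabs0 ltW.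
exists d, K; split=> // h hd.
have -> : g (z + h) - g z = (b + c * h + r h * h * h) * h by rewrite E; ring.
by rewrite cabsM ler_wpM2r ?cabs_ge0// H.
Qed.

(** The directions 1, i, -1, -i sum to 0 and so do their squares; the linear and quadratic terms
    therefore cancel, which leaves a discrete mean value property up to third order. *)
Lemma jet2_mean_value g z : jet2 g z -> exists d K : R, [/\ 0 < d, 0 <= K &
  forall x : R, 0 <= x <= d ->
    cabs (g (z + x%:C) + g (z + x%:C * 'i%C) + g (z - x%:C)
      + g (z - x%:C * 'i%C) - (g z + g z + g z + g z)) <= K * x ^+ 3].
Proof.
move=> [b [c [r [[d [K [d0 H]]] E]]]].
have K0 : 0 <= K by apply: le_trans (cabs_ge0 _) (H 0 _); rewrite cabs0 ltW.
exists d, (4 * K); split=> //; first exact: mulr_ge0.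
move=> x /andP[x0 xd]; rewrite !E.
have i2 : (x%:C * 'i%C) ^+ 2 = - x%:C ^+ 2 :> R[i].
  by rewrite exprMn [X in _ * X]expr2 sqr_iC mulrN1.
have i2' : (- (x%:C * 'i%C)) ^+ 2 = - x%:C ^+ 2 :> R[i] by rewrite sqrrN.
rewrite !i2 !i2'.
set u1 := r _ * _; set u2 := r _ * _; set u3 := r _ * _; set u4 := r _ * _.
rewrite [X in cabs X](_ : _ = u1 + u2 + u3 + u4); last ring.
have bd h : cabs h = x -> cabs (r h * h ^+ 3) <= K * x ^+ 3.
  move=> hx; rewrite cabsM cabsX hx ler_wpM2r ?exprn_ge0//.
  by apply: H; rewrite hx.
have cx : cabs (x%:C : R[i]) = x by rewrite cabs_real ger0_norm.
have cxi : cabs (x%:C * 'i%C : R[i]) = x by rewrite cabsM cx cabs_i mulr1.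
have B1 : cabs u1 <= K * x ^+ 3 by exact: bd.
have B2 : cabs u2 <= K * x ^+ 3 by exact: bd.
have B3 : cabs u3 <= K * x ^+ 3 by apply: bd; rewrite cabsN.
have B4 : cabs u4 <= K * x ^+ 3 by apply: bd; rewrite cabsN.
apply: le_trans (cabsD _ _) _.
have := cabsD (u1 + u2) u3; have := cabsD u1 u2; lra.
Qed.

End Jets.

(** * Maxima over rectangles *)

Section MaximumPrinciple.
Variable R : realType.
Implicit Types (g : R[i] -> R[i]) (z : R[i]).

Lemma pointwise_lipschitz_continuous (f : R * R -> R) :
  (forall x, exists d K : R, 0 < d /\ forall y,
     `|y.1 - x.1| <= d -> `|y.2 - x.2| <= d ->
     `|f y - f x| <= K * (`|y.1 - x.1| + `|y.2 - x.2|)) ->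
  continuous f.
Proof.
move=> H x; apply/cvgrPdist_lt => /= eps eps0.
have [d [K [d0 fx]]] := H x.
pose dd := Num.min d (eps / (2 * (`|K| + 1))).
have Kp : 0 < 2 * (`|K| + 1) by rewrite mulr_gt0// ltr_wpDl.
have dd0 : 0 < dd by rewrite lt_min d0 divr_gt0.
have : nbhs x (ball x dd) by exact: nbhsx_ballx.
apply: filterS => y -[/= y1 y2].
have {}y1 : `|y.1 - x.1| < dd by rewrite distrC.
have {}y2 : `|y.2 - x.2| < dd by rewrite distrC.
rewrite distrC; apply: le_lt_trans (fx y _ _) _.
- by rewrite (le_trans (ltW y1))// ge_min lexx.
- by rewrite (le_trans (ltW y2))// ge_min lexx.
have : dd <= eps / (2 * (`|K| + 1)) by rewrite ge_min lexx orbT.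
rewrite ler_pdivlMr// => ddle.
have a1 : 0 <= `|y.1 - x.1| + `|y.2 - x.2| by exact: addr_ge0.
have : K * (`|y.1 - x.1| + `|y.2 - x.2|) <=
  (`|K| + 1) * (`|y.1 - x.1| + `|y.2 - x.2|).
  rewrite ler_wpM2r//; apply: le_trans (ler_norm K) _; lra.
have : (`|K| + 1) * (`|y.1 - x.1| + `|y.2 - x.2|) < (`|K| + 1) * (2 * dd).
  rewrite ltr_pM2l; last by rewrite ltr_wpDl.
  lra.
lra.
Qed.

(** Supplies the continuity from which a maximum over a compact rectangle is obtained. *)
Lemma cabs_sqr_continuous g : (forall z, jet2 g z) ->
  continuous (fun x : R * R => cabs (g (x.1 +i* x.2)) ^+ 2).
Proof.
move=> gj; apply: pointwise_lipschitz_continuous => -[s t] /=.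
have [d [K [d0 K0 H]]] := jet2_lipschitz (gj (s +i* t)).
exists (d / 2), (K * (2 * cabs (g (s +i* t)) + K * d)); split.
  by rewrite divr_gt0.
move=> [s' t'] /= hs ht.
pose h : R[i] := (s' - s) +i* (t' - t).
have hn : cabs h <= `|s' - s| + `|t' - t| by exact: cabs_le_ReIm.
have hd : cabs h <= d by apply: le_trans hn _; lra.
have -> : s' +i* t' = (s +i* t) + h by apply: complex_eq => /=; ring.
have h1 := H h hd.
set a := g (_ + h) in h1 *; set b := g (s +i* t) in h1 *.
have ab : `|cabs a - cabs b| <= cabs (a - b).
  rewrite ler_norml; apply/andP; split.
    by have := cabsD a (b - a); rewrite addrCA subrr addr0 cabsBC; lra.
  by have := cabsD (a - b) b; rewrite subrK; lra.
have -> : cabs a ^+ 2 - cabs b ^+ 2 = (cabs a - cabs b) * (cabs a + cabs b).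
  ring.
rewrite normrM mulrAC.
have a0 := cabs_ge0 a; have b0 := cabs_ge0 b; have h0 := cabs_ge0 h.
rewrite (ger0_norm (addr_ge0 a0 b0)).
have kd : K * cabs h <= K * d by exact: ler_wpM2l.
apply: ler_pM => //; first exact: addr_ge0.
  apply: le_trans ab _; apply: le_trans h1 _; exact: ler_wpM2l.
have := le_trans (ler_norm _) ab; lra.
Qed.

(** The term eps |z|^2 makes the function strictly subharmonic. Summed over the four points z + x, z
    + ix, z - x, z - ix it gains 4 eps x^2, while by the mean value property the sum of |g|^2 falls
    below 4 |g z|^2 by at most a multiple of x^3. *)
Lemma no_interior_max g z (eps d : R) : jet2 g z -> 0 < eps -> 0 < d ->
  (forall h, `|Re h| <= d -> `|Im h| <= d ->
    cabs (g (z + h)) ^+ 2 + eps * cabs (z + h) ^+ 2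
      <= cabs (g z) ^+ 2 + eps * cabs z ^+ 2) -> False.
Proof.
move=> /jet2_mean_value[d' [K [d'0 K0 H]]] eps0 d0 mx.
pose A := cabs (g z).
have A0 : 0 <= A by exact: cabs_ge0.
(* With x (K A + 1) <= eps the cubic loss, at most 4 K A x^3, stays strictly below the gain 4 eps
   x^2. *)
pose x := Num.min (Num.min d d') (eps / (K * A + 1)).
have KA : 0 < K * A + 1 by rewrite ltr_wpDl// mulr_ge0.
have x0 : 0 < x by rewrite !lt_min d0 d'0 divr_gt0.
have xd : x <= d by rewrite /x !ge_min lexx.
have xd' : x <= d' by rewrite /x !ge_min lexx orbT.
have : x <= eps / (K * A + 1) by rewrite /x ge_min lexx orbT.
rewrite ler_pdivlMr// => xe.
have := H x; rewrite xd' (ltW x0) => /(_ isT).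
have xn : `|x| <= d by rewrite ger0_norm// ltW.
have m1 := mx x%:C; have m2 := mx (x%:C * 'i%C).
have m3 := mx (- x%:C); have m4 := mx (- (x%:C * 'i%C)).
move: m1; rewrite /= normr0 (ltW d0) => /(_ xn isT) m1.
move: m2; rewrite /= !(mul0r, mulr0, mulr1, subr0, addr0, normr0) (ltW d0) => /(_ isT xn) m2.
move: m3; rewrite /= !normrN normr0 (ltW d0) => /(_ xn isT) m3.
move: m4; rewrite /= !(mul0r, mulr0, mulr1, subr0, addr0, oppr0, normrN, normr0) (ltW d0) => /(_ isT xn) m4.
move: m1 m2 m3 m4.
set a1 := g (z + x%:C); set a2 := g (z + _ * _).
set a3 := g (z - x%:C); set a4 := g (z - _ * _) => m1 m2 m3 m4.
set E := (_ - (g z + g z + g z + g z)) => hE.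
have EA : `|Re E * Re (g z) + Im E * Im (g z)| <= K * x ^+ 3 * A * 2.
  apply: le_trans (ler_normD _ _) _.
  rewrite !normrM.
  have := ler_pM (normr_ge0 _) (normr_ge0 _) (le_trans (normr_Re_le E) hE)
     (normr_Re_le (g z)).
  have := ler_pM (normr_ge0 _) (normr_ge0 _) (le_trans (normr_Im_le E) hE)
     (normr_Im_le (g z)).
  rewrite -/A; lra.
have lb := ler_norml (Re E * Re (g z) + Im E * Im (g z)) (K * x ^+ 3 * A * 2).
move: EA; rewrite lb => /andP[EA _] {lb}.
have ReE : Re E = Re a1 + Re a2 + Re a3 + Re a4 - 4 * Re (g z).
  by rewrite /E !(ReD, ReN); ring.
have ImE : Im E = Im a1 + Im a2 + Im a3 + Im a4 - 4 * Im (g z).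
  by rewrite /E !(ImD, ImN); ring.
(* The square lies above its tangents, so control of the sum of the four values gives a lower bound
   for the sum of their squared moduli. *)
have sq (u v : R) : u ^+ 2 >= v ^+ 2 + 2 * v * (u - v).
  rewrite -subr_ge0 (_ : _ - _ = (u - v) ^+ 2) ?sqr_ge0//; ring.
have x3 : K * x ^+ 3 * A * 2 <= 2 * (x ^+ 2 * eps) - 2 * x ^+ 3.
  have : x ^+ 2 * (x * (K * A + 1)) <= x ^+ 2 * eps.
    by rewrite ler_wpM2l// exprn_ge0// ltW.
  have -> : x ^+ 2 * (x * (K * A + 1)) = K * x ^+ 3 * A + x ^+ 3 by ring.
  lra.
have x30 : 0 < x ^+ 3 by rewrite exprn_gt0.
move: m1 m2 m3 m4; rewrite !cabs_sqr.
rewrite !(ReD, ImD, ReN, ImN, ReM, ImM) /=.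
rewrite !(mul0r, mulr0, mulr1, subr0, addr0, oppr0).
move=> m1 m2 m3 m4.
have s1 := sq (Re a1) (Re (g z)); have t1 := sq (Im a1) (Im (g z)).
have s2 := sq (Re a2) (Re (g z)); have t2 := sq (Im a2) (Im (g z)).
have s3 := sq (Re a3) (Re (g z)); have t3 := sq (Im a3) (Im (g z)).
have s4 := sq (Re a4) (Re (g z)); have t4 := sq (Im a4) (Im (g z)).
rewrite ReE ImE in EA.
have x20 : x ^+ 2 * eps = eps * x ^+ 2 by rewrite mulrC.
have e1 (u v : R) : eps * ((u + x) ^+ 2 + v ^+ 2) + eps * ((u - x) ^+ 2 + v ^+ 2)
   = 2 * (eps * (u ^+ 2 + v ^+ 2)) + 2 * (eps * x ^+ 2) by ring.
have e2 := e1 (Re z) (Im z); have e3 := e1 (Im z) (Re z).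
rewrite ![Im z ^+ 2 + _]addrC in e3.
rewrite ![(_ ^+ 2) + Re z ^+ 2]addrC in e3.
lra.
Qed.

(** A maximiser of |g|^2 + eps |z|^2 over the rectangle exists by compactness and must lie on the
    boundary; [eps] then tends to 0, [M] being a bound for |z|^2 on the rectangle. *)
Lemma maximum_principle g (s0 s1 t0 t1 B : R) : (forall z, jet2 g z) ->
  (forall s t, s0 <= s <= s1 -> t0 <= t <= t1 ->
     s = s0 \/ s = s1 \/ t = t0 \/ t = t1 -> cabs (g (s +i* t)) <= B) ->
  forall s t, s0 <= s <= s1 -> t0 <= t <= t1 -> cabs (g (s +i* t)) <= B.
Proof.
move=> gj bd s t sI tI.
have [s00 t00] : s0 <= s1 /\ t0 <= t1.
  by case/andP: sI => [/le_trans a /a]; case/andP: tI => [/le_trans b /b].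
have B0 : 0 <= B.
  by apply: le_trans (cabs_ge0 _) (bd s0 t0 _ _ _); rewrite ?lexx//; left.
pose M := (`|s0| + `|s1|) ^+ 2 + (`|t0| + `|t1|) ^+ 2.
have M0 : 0 <= M by rewrite addr_ge0 ?sqr_ge0.
have Mb u v : s0 <= u <= s1 -> t0 <= v <= t1 -> cabs (u +i* v) ^+ 2 <= M.
  have aux (a b w : R) : a <= w <= b -> w ^+ 2 <= (`|a| + `|b|) ^+ 2.
    move=> /andP[aw wb]; rewrite -[w ^+ 2]real_normK ?num_real//.
    rewrite lerXn2r ?nnegrE ?addr_ge0//.
    by rewrite ler_norml; have := ler_norm (- a); have := ler_norm b;
      have := normr_ge0 a; have := normr_ge0 b; rewrite normrN; lra.
  by move=> uI vI; rewrite cabs_sqr lerD ?aux.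
suff H (eps : R) : 0 < eps -> cabs (g (s +i* t)) ^+ 2 <= B ^+ 2 + eps * M.
  rewrite -(ler_pXn2r (n := 2)) ?nnegrE ?cabs_ge0//.
  apply/ler_addgt0Pr => e e0.
  apply: le_trans (H (e / (M + 1)) _) _; first by rewrite divr_gt0// ltr_wpDl.
  rewrite lerD2l mulrAC ler_pdivrMr ?ltr_wpDl// ler_pM2l//; lra.
move=> eps0.
pose f (x : R * R) := cabs (g (x.1 +i* x.2)) ^+ 2 + eps * cabs (x.1 +i* x.2) ^+ 2.
have cf : continuous f.
  move=> x; apply: cvgD; first exact: cabs_sqr_continuous.
  apply: cvgM; first exact: cvg_cst.
  apply: (@cabs_sqr_continuous id) => z; exact: jet2_id.
have := @compact_EVT_max _ _ f (`[s0, s1] `*` `[t0, t1]).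
case.
- by exists (s0, t0); split; rewrite /= in_itv/= lexx.
- by apply: compact_setX; exact: segment_compact.
- exact: continuous_subspaceT.
move=> [u v]; rewrite inE /= !in_itv/= => -[uI vI] mx.
have fst : f (s, t) <= f (u, v) by apply: mx; rewrite inE; split; rewrite /= in_itv.
have fB : f (u, v) <= B ^+ 2 + eps * M.
  have [bdy|] := pselect (u = s0 \/ u = s1 \/ v = t0 \/ v = t1).
    rewrite lerD//; last by rewrite ler_wpM2l ?Mb// ltW.
    by rewrite lerXn2r ?nnegrE ?cabs_ge0// bd.
  move=> /not_orP[/eqP us0 /not_orP[/eqP us1 /not_orP[/eqP vt0 /eqP vt1]]].
  exfalso.
  have u0 : s0 < u by rewrite lt_neqAle eq_sym us0; case/andP: uI.
  have u1 : u < s1 by rewrite lt_neqAle us1; case/andP: uI.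
  have v0 : t0 < v by rewrite lt_neqAle eq_sym vt0; case/andP: vI.
  have v1 : v < t1 by rewrite lt_neqAle vt1; case/andP: vI.
  pose d := Num.min (Num.min (u - s0) (s1 - u)) (Num.min (v - t0) (t1 - v)).
  have d0 : 0 < d by rewrite !lt_min !subr_gt0 u0 u1 v0 v1.
  apply: (no_interior_max (gj (u +i* v)) eps0 d0) => -[a b] /= ad bd'.
  have := mx (u + a, v + b); rewrite inE /f /=; apply.
  move: ad bd'; rewrite /d !le_min !ler_norml => /andP[/andP[+ +] _] /andP[_ /andP[+ +]].
  by split; rewrite /= in_itv/=; lra.
apply: le_trans fB; apply: le_trans fst.
by rewrite lerDl mulr_ge0 ?sqr_ge0// ltW.
Qed.

End MaximumPrinciple.

(** * The Phragmen-Lindelof principle *)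

Section PhragmenLindelof.
Variable R : realType.
Implicit Types (F G : R[i] -> R[i]) (z : R[i]).

(* In the coordinate [log z] the sector becomes a strip of width less than
   [pi / 2]; the damping factor [exp (- eps * (z e^{- i pi / 4}) ^ p)] with
   [2 < p] decays there faster than the order-2 growth of [G]. *)
Lemma phragmen_lindelof_sector G (C K t0 : R) : (forall z, jet2 G z) ->
  0 <= C -> 0 <= K -> 0 < t0 < pi / 4 ->
  (forall z, cabs (G z) <= C * expR (K * cabs z ^+ 2)) ->
  (forall s, 0 <= s -> cabs (G (cexp (s +i* t0))) <= C) ->
  (forall s, 0 <= s -> cabs (G (cexp (s +i* (pi / 2 - t0)))) <= C) ->
  forall s t, 0 <= s -> t0 <= t <= pi / 2 - t0 ->
    cabs (G (cexp (s +i* t))) <= C * expR K.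
Proof.
move=> Gj C0 K0 /andP[t00 t0pi] growth ray1 ray2 s t s0 tI.
have pi0 : 0 < pi :> R by exact: pi_gt0.
pose a : R := pi / 4 - t0.
have a0 : 0 < a by rewrite subr_gt0.
(* As a < pi/4, this exponent exceeds 2, while p a = a + pi/4 < pi/2 keeps the cosine in the damping
   factor at least [d > 0] on the whole strip. *)
pose p := 1 + pi / (4 * a).
have p2 : 2 < p.
  suff : 1 < pi / (4 * a) by rewrite /p; lra.
  by rewrite ltr_pdivlMr ?mulr_gt0// /a; lra.
have pa : p * a = a + pi / 4.
  by rewrite /p; field; rewrite gt_eqF.
have papi : 0 <= p * a < pi / 2 by rewrite pa /a; lra.
pose d := cos (p * a).
have d0 : 0 < d by apply: cos_gt0_pihalf; move: papi; lra.
have dcos t' : t0 <= t' <= pi / 2 - t0 -> d <= cos (p * (t' - pi / 4)).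
  move=> t'I; have : `|t' - pi / 4| <= a by rewrite ler_norml /a; lra.
  have -> : cos (p * (t' - pi / 4)) = cos (p * `|t' - pi / 4|).
    have [_|_] := ger0P (t' - pi / 4); first by [].
    by rewrite mulrN cosN.
  have := normr_ge0 (t' - pi / 4); set y := `|_| => y0 ya.
  have py0 : 0 <= p * y by rewrite mulr_ge0//; lra.
  have pya : p * y <= p * a by rewrite ler_pM2l//; lra.
  by rewrite /d leNgt ltr_cos ?in_itv/= -?leNgt//; lra.
have cn s' t' : cabs (cexp (s' +i* t') : R[i]) = expR s' by rewrite cabs_cexp.
suff H (eps : R) : 0 < eps ->
    cabs (G (cexp (s +i* t))) <= C * expR K * expR (eps * expR (p * s)).
  apply/ler_addgt0Pr => e e0.
  pose B := C * expR K.
  have B0 : 0 <= B by rewrite mulr_ge0// expR_ge0.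
  (* Chosen so that undoing the damping at [s] costs exactly the factor 1 + e / (B + 1). *)
  pose eps := ln (1 + e / (B + 1)) / expR (p * s).
  have q0 : 0 < e / (B + 1) by rewrite divr_gt0// ltr_wpDl.
  have eps0 : 0 < eps by rewrite divr_gt0 ?expR_gt0// ln_gt0// ltrDl.
  apply: le_trans (H eps eps0) _; rewrite /eps divfK ?gt_eqF ?expR_gt0//.
  rewrite lnK ?posrE ?addr_gt0// -/B mulrDr mulr1 lerD2l mulrA.
  rewrite ler_pdivrMr ?ltr_wpDl// mulrC ler_pM2l//; lra.
move=> eps0.
pose damp z : R[i] :=
  cexp ((- eps)%:C * cexp (p%:C * (z + (0 +i* (- (pi / 4)))))).
have dampE s' t' : cabs (damp (s' +i* t')) =
    expR (- (eps * (expR (p * s') * cos (p * (t' - pi / 4))))).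
  rewrite cabs_cexp; congr expR.
  rewrite /cexp !(ReM, ImM, ReD, ImD) /=.
  by rewrite !(mul0r, addr0, subr0) mulNr.
have dampj z : jet2 damp z.
  apply: (@jet2_comp _ (@cexp R)); first exact: jet2_cexp.
  apply: jet2M; first exact: jet2_cst.
  apply: (@jet2_comp _ (@cexp R)); first exact: jet2_cexp.
  apply: jet2M; first exact: jet2_cst.
  by apply: jet2D; [exact: jet2_id | exact: jet2_cst].
pose g z := G (cexp z) * damp z.
have gj z : jet2 g z.
  apply: jet2M => //; apply: jet2_comp; [exact: Gj | exact: jet2_cexp].
(* From [S] on, the damping exponent eps d exp (p s) dominates the growth exponent K exp (2 s). The
   summand 1 in [K + 1] keeps the argument of the logarithm positive. *)
pose S := Num.max s (`|ln ((K + 1) / (eps * d))| / (p - 2)).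
have sS : s <= S by rewrite le_max lexx.
have S0 : 0 <= S by exact: le_trans s0 sS.
have ed0 : 0 < eps * d by exact: mulr_gt0.
have SE : K * expR (2 * S) <= eps * d * expR (p * S).
  have : ln ((K + 1) / (eps * d)) <= (p - 2) * S.
    apply: le_trans (ler_norm _) _; rewrite [leRHS]mulrC -ler_pdivrMr ?subr_gt0//.
    by rewrite le_max lexx orbT.
  rewrite -ler_expR lnK ?posrE ?divr_gt0 ?ltr_wpDl//.
  rewrite ler_pdivrMr// => le1.
  have -> : p * S = (p - 2) * S + 2 * S by ring.
  rewrite expRD mulrA ler_pM2r ?expR_gt0//; lra.
have K1 : C <= C * expR K by rewrite ler_peMr// -expR0 ler_expR.
have damp1 s' t' : t0 <= t' <= pi / 2 - t0 -> cabs (damp (s' +i* t')) <= 1.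
  move=> /dcos dt; rewrite dampE -[leRHS]expR0 ler_expR oppr_le0.
  apply: mulr_ge0 (ltW eps0) _; apply: mulr_ge0 (expR_ge0 _) _.
  exact: le_trans (ltW d0) dt.
have bd s' t' : 0 <= s' <= S -> t0 <= t' <= pi / 2 - t0 ->
    s' = 0 \/ s' = S \/ t' = t0 \/ t' = pi / 2 - t0 ->
    cabs (g (s' +i* t')) <= C * expR K.
  move=> s'I t'I; have D1 := damp1 s' t' t'I.
  have trv (u v : R) : 0 <= u -> u <= C * expR K -> v <= 1 -> u * v <= C * expR K.
    by move=> u0 uC v1; apply: le_trans uC; rewrite ler_piMr.
  have s'0 : 0 <= s' by case/andP: s'I.
  rewrite /g cabsM => -[s'E|[s'E|[t'E|t'E]]].
  (* On the left edge |z| = 1; the growth bound there is the origin of the factor [expR K]. *)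
  - apply: trv; rewrite ?cabs_ge0//.
    by apply: le_trans (growth _) _; rewrite cn s'E expR0 expr1n mulr1.
  - rewrite s'E dampE; apply: le_trans (le_trans _ K1).
      apply: ler_wpM2r; [exact: expR_ge0 | exact: growth].
    rewrite cn -mulrA ler_piMr// -expRD -[leRHS]expR0 ler_expR -expRM_natl.
    rewrite subr_le0; apply: le_trans SE _.
    rewrite -mulrA ler_pM2l// [leLHS]mulrC ler_pM2l ?expR_gt0//; exact: dcos.
  - apply: trv; rewrite ?cabs_ge0// t'E; exact: le_trans (ray1 _ s'0) K1.
  - apply: trv; rewrite ?cabs_ge0// t'E; exact: le_trans (ray2 _ s'0) K1.
have := maximum_principle gj bd; move=> /(_ s t).
rewrite s0 sS => /(_ isT tI); rewrite /g cabsM => gB.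
have : cabs (damp (s +i* t)) >= expR (- (eps * expR (p * s))).
  rewrite dampE ler_expR lerN2 ler_pM2l// ler_piMr ?expR_ge0//.
rewrite expRN -(ler_pM2l (expR_gt0 (eps * expR (p * s)))) mulfV; last first.
  by rewrite gt_eqF// expR_gt0.
set D := cabs (damp _) in gB *; set E := expR (eps * _) => ED.
apply: le_trans (ler_wpM2r (expR_ge0 _) gB).
rewrite -mulrA -[X in X <= _]mulr1 ler_wpM2l ?cabs_ge0// mulrC; exact: ED.
Qed.

Lemma cabs_sqrE (u v : R) : cabs (u +i* v) ^+ 2 = u ^+ 2 + v ^+ 2.
Proof. by rewrite cabs_sqr. Qed.

(** Below the lower ray and above the upper one, the better of the two hypotheses already implies
    the claim; in the unit disc both exponents are at most 1. Only the part of the sector outside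
    the disc needs Phragmen-Lindelof, and there 2 u v <= u^2 + v^2 turns the exponent 2 k u v into k
    |z|^2. The constant [expR 2] comes from the growth exponent 2 of the auxiliary function [G]. *)
Lemma quadrant_bound F (C k : R) : (forall z, jet2 F z) -> 0 <= C -> 0 < k < 1 ->
  (forall u v, cabs (F (u +i* v)) <= C * expR (k ^+ 2 * u ^+ 2 + v ^+ 2)) ->
  (forall u v, cabs (F (u +i* v)) <= C * expR (u ^+ 2 + k ^+ 2 * v ^+ 2)) ->
  forall u v, 0 <= u -> 0 <= v ->
    cabs (F (u +i* v)) <= C * expR 2 * expR (k * cabs (u +i* v) ^+ 2).
Proof.
move=> Fj C0 /andP[k0 k1] H1 H2.
have k2 : k ^+ 2 <= k by rewrite expr2 ler_piMl// ltW.
have aux u v : v <= k * u -> 0 <= u -> 0 <= v ->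
    k ^+ 2 * u ^+ 2 + v ^+ 2 <= k * (u ^+ 2 + v ^+ 2).
  move=> vku u0 v0.
  have v2 : v ^+ 2 <= k ^+ 2 * u ^+ 2.
    by rewrite -exprMn lerXn2r ?nnegrE// mulr_ge0// ltW.
  have a1 : (1 - k) * v ^+ 2 <= (1 - k) * (k ^+ 2 * u ^+ 2).
    by rewrite ler_wpM2l//; lra.
  have a2 : (k * (1 - k)) * (k * u ^+ 2) <= (1 - k) * (k * u ^+ 2).
    rewrite ler_wpM2r ?mulr_ge0 ?sqr_ge0 ?(ltW k0)//.
    rewrite ler_piMl//; lra.
  lra.
have e2 : C <= C * expR 2 by rewrite ler_peMr// -expR0 ler_expR.
move=> u v u0 v0; rewrite cabs_sqrE.
have [vku|kuv] := leP v (k * u).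
  apply: le_trans (H1 _ _) _; apply: ler_pM; rewrite ?expR_ge0// ler_expR.
  exact: aux.
have [ukv|kvu] := leP u (k * v).
  apply: le_trans (H2 _ _) _; apply: ler_pM; rewrite ?expR_ge0// ler_expR.
  by rewrite [u ^+ 2 + v ^+ 2]addrC [u ^+ 2 + _]addrC; exact: aux.
have kn0 : 0 <= k by exact: ltW.
have up : 0 < u by apply: le_lt_trans kvu; rewrite mulr_ge0.
have vp : 0 < v by apply: le_lt_trans kuv; rewrite mulr_ge0.
have lek2 : k ^+ 2 <= 1 by rewrite (le_trans k2)// ltW.
have gF z : cabs (F z) <= C * expR (cabs z ^+ 2).
  case: z => x y; apply: le_trans (H1 _ _) _.
  by rewrite ler_wpM2l// ler_expR cabs_sqrE lerD2r ler_piMl// sqr_ge0.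
have [small|large] := leP (u ^+ 2 + v ^+ 2) 1.
  apply: le_trans (gF _) _; rewrite -mulrA ler_wpM2l// -expRD ler_expR.
  rewrite cabs_sqrE; have : 0 <= k * (u ^+ 2 + v ^+ 2).
    by rewrite mulr_ge0// addr_ge0// sqr_ge0.
  lra.
(* The multiplier has modulus exp (- 2 k u v), which cancels exactly the exponent of the bound for
   [F] on each of the two rays. *)
pose G z := F z * cexp (k%:C * 'i%C * (z * z)).
have Gj z : jet2 G z.
  apply: jet2M => //; apply: (@jet2_comp _ (@cexp R)); first exact: jet2_cexp.
  apply: jet2M; first exact: jet2_cst.
  by apply: jet2M; exact: jet2_id.
have GE x y : cabs (G (x +i* y)) = cabs (F (x +i* y)) * expR (- (k * (2 * (x * y)))).
  rewrite /G cabsM cabs_cexp; congr (_ * expR _).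
  by rewrite !(ReM, ImM) /=; ring.
have growth z : cabs (G z) <= C * expR (2 * cabs z ^+ 2).
  case: z => x y; rewrite GE.
  have -> : 2 * cabs (x +i* y) ^+ 2 = cabs (x +i* y) ^+ 2 + cabs (x +i* y) ^+ 2.
    by ring.
  rewrite [in leRHS]expRD [leRHS]mulrA; apply: ler_pM; rewrite ?cabs_ge0 ?expR_ge0//.
  rewrite ler_expR cabs_sqrE.
  have : k * (x + y) ^+ 2 >= 0 by rewrite mulr_ge0 ?sqr_ge0.
  have : 0 <= (1 - k) * (x ^+ 2 + y ^+ 2).
    apply: mulr_ge0; [lra | exact: addr_ge0 (sqr_ge0 _) (sqr_ge0 _)].
  lra.
pose t0 := atan k.
have t0pi : 0 < t0 < pi / 4.
  by rewrite /t0 -atan1 -[X in X < _ < _]atan0 !lt_atan.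
have pi0 : 0 < pi :> R by exact: pi_gt0.
have ct0 : 0 < cos t0 by apply: cos_gt0_pihalf; lra.
have st0 : sin t0 = k * cos t0.
  have : tan t0 = k by exact: atanK.
  by rewrite /tan => <-; rewrite divfK// gt_eqF.
have ce s t : cexp (s +i* t) = (expR s * cos t) +i* (expR s * sin t) :> R[i].
  by apply: complex_eq; rewrite /cexp ?ReM ?ImM /=; ring.
have ray1 s : 0 <= s -> cabs (G (cexp (s +i* t0))) <= C.
  move=> _; rewrite ce GE st0.
  set x := expR s * cos t0; have -> : expR s * (k * cos t0) = k * x by rewrite /x; ring.
  apply: le_trans (ler_wpM2r (expR_ge0 _) (H1 _ _)) _.
  rewrite -[leLHS]mulrA -expRD (_ : _ - _ = 0) ?expR0 ?mulr1//; ring.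
have cc : cos (pi / 2 - t0) = sin t0 by rewrite -cosN opprB cosBpihalf.
have ss : sin (pi / 2 - t0) = cos t0 by rewrite addrC sinDpihalf cosN.
have ray2 s : 0 <= s -> cabs (G (cexp (s +i* (pi / 2 - t0)))) <= C.
  move=> _; rewrite ce GE.
  rewrite cc ss st0.
  set x := expR s * cos t0; have -> : expR s * (k * cos t0) = k * x by rewrite /x; ring.
  apply: le_trans (ler_wpM2r (expR_ge0 _) (H2 _ _)) _.
  rewrite -[leLHS]mulrA -expRD (_ : _ - _ = 0) ?expR0 ?mulr1//; ring.
have := phragmen_lindelof_sector Gj C0 _ t0pi growth ray1 ray2.
move=> /(_ (ler0n _ 2)).
pose r := Num.sqrt (u ^+ 2 + v ^+ 2).
have rp : 0 < u ^+ 2 + v ^+ 2 by exact: lt_trans large.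
have r2 : r ^+ 2 = u ^+ 2 + v ^+ 2 by rewrite sqr_sqrtr// ltW.
have r0 : 0 < r by rewrite sqrtr_gt0.
pose t := atan (v / u).
have ut : u = r * cos t.
  rewrite /t cos_atan.
  have -> : 1 + (v / u) ^+ 2 = (r / u) ^+ 2.
    by rewrite !exprMn r2; field; rewrite gt_eqF.
  rewrite sqrtr_sqr ger0_norm; last by rewrite divr_ge0// ltW.
  by field; rewrite !gt_eqF.
have vt : v = r * sin t.
  have : tan t = v / u by exact: atanK.
  have ctn : cos t != 0.
    by apply/eqP => c0; move: ut; rewrite c0 mulr0 => u00; move: up; rewrite u00 ltxx.
  rewrite /tan => /(congr1 (fun y => y * cos t)); rewrite divfK// => ->.
  rewrite [in v / u]ut; field; rewrite ctn gt_eqF//.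
move=> /(_ (ln r) t).
have lr0 : 0 <= ln r.
  rewrite ln_ge0// -(ler_pXn2r (n := 2)) ?nnegrE ?(ltW r0)//.
  by rewrite expr1n r2 ltW.
have tI : t0 <= t <= pi / 2 - t0.
  apply/andP; split.
    by apply: le_atan; rewrite ler_pdivlMr// ltW.
  have -> : pi / 2 - t0 = atan (k^-1).
    rewrite -[LHS]tanK; last by rewrite in_itv/=; lra.
    congr atan; rewrite /tan cc ss st0.
    by field; rewrite !gt_eqF.
  apply: le_atan; rewrite ler_pdivrMr// mulrC ler_pdivlMr// mulrC ltW//.
move=> /(_ lr0 tI); rewrite ce lnK ?posrE// -ut -vt GE => GB.
have := ler_wpM2r (expR_ge0 (k * (2 * (u * v)))) GB.
rewrite -[leLHS]mulrA -expRD addNr expR0 mulr1 => h; apply: le_trans h _.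
rewrite ler_wpM2l ?mulr_ge0 ?expR_ge0// ler_expR ler_pM2l//.
have := sqr_ge0 (u - v); lra.
Qed.

(** Multiplication of the argument by i or -i exchanges the two hypotheses and multiplication by -1
    preserves each, so every quadrant can be rotated onto the first. *)
Lemma entire_bound F (C k : R) : (forall z, jet2 F z) -> 0 <= C -> 0 < k < 1 ->
  (forall u v, cabs (F (u +i* v)) <= C * expR (k ^+ 2 * u ^+ 2 + v ^+ 2)) ->
  (forall u v, cabs (F (u +i* v)) <= C * expR (u ^+ 2 + k ^+ 2 * v ^+ 2)) ->
  forall z, cabs (F z) <= C * expR 2 * expR (k * cabs z ^+ 2).
Proof.
move=> Fj C0 k01 H1 H2 [u v].
have rot c : forall z, jet2 (fun w => F (c * w)) z.
  move=> z; apply: (@jet2_comp _ F (fun w => c * w)); first exact: Fj.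
  by apply: jet2M; [exact: jet2_cst | exact: jet2_id].
have r1 x y : 'i%C * (x +i* y) = (- y) +i* x :> R[i].
  by apply: complex_eq; rewrite ?ReM ?ImM /=; ring.
have r2 x y : -1 * (x +i* y) = (- x) +i* (- y) :> R[i].
  by rewrite mulN1r.
have r3 x y : - 'i%C * (x +i* y) = y +i* (- x) :> R[i].
  by apply: complex_eq; rewrite ?ReM ?ImM /=; ring.
have [u0|u0] := leP 0 u; have [v0|v0] := leP 0 v.
- exact: quadrant_bound.
- have := @quadrant_bound _ C k (rot (- 'i%C)) C0 k01 _ _ (- v) u.
  rewrite !r3 opprK !cabs_sqrE sqrrN [v ^+ 2 + _]addrC; apply => //; last lra.
    by move=> x y; rewrite r3; have := H2 y (- x); rewrite sqrrN [y ^+ 2 + _]addrC.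
  by move=> x y; rewrite r3; have := H1 y (- x); rewrite sqrrN addrC.
- have := @quadrant_bound _ C k (rot 'i%C) C0 k01 _ _ v (- u).
  rewrite !r1 opprK !cabs_sqrE sqrrN [v ^+ 2 + _]addrC; apply => //; last lra.
    by move=> x y; rewrite r1; have := H2 (- y) x; rewrite sqrrN addrC.
  by move=> x y; rewrite r1; have := H1 (- y) x; rewrite sqrrN addrC.
- have := @quadrant_bound _ C k (rot (-1)) C0 k01 _ _ (- u) (- v).
  rewrite !r2 !opprK !cabs_sqrE !sqrrN; apply => //; [| |lra|lra].
    by move=> x y; rewrite r2; have := H1 (- x) (- y); rewrite !sqrrN.
  by move=> x y; rewrite r2; have := H2 (- x) (- y); rewrite !sqrrN.
Qed.

End PhragmenLindelof.

(** * Cauchy estimates and Hermite polynomials *)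

Section RealComplex.
Variable R : realType.
Implicit Types x y : R.

Lemma rcM x y : (x * y)%:C = x%:C * y%:C :> R[i].
Proof. by rewrite rmorphM. Qed.

Lemma rcB x y : (x - y)%:C = x%:C - y%:C :> R[i].
Proof. by rewrite rmorphB. Qed.

Lemma rcN x : (- x)%:C = - x%:C :> R[i].
Proof. by rewrite rmorphN. Qed.

Lemma rcV x : x^-1%:C = (x%:C)^-1 :> R[i].
Proof. by rewrite fmorphV. Qed.

Lemma rc_nat n : (n%:R : R)%:C = n%:R :> R[i].
Proof. by rewrite rmorph_nat. Qed.

End RealComplex.

(** * Cauchy's estimates by discrete averaging *)

Section CauchyEstimate.
Variable R : realType.
Implicit Types (a : nat -> R[i]) (t w : R[i]).

(** The root is exp (2 pi i / n). For 0 < m < n its m-th power has real part 1 - 2 sin^2 (pi m / n),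
    which is less than 1. *)
Lemma unity_root_exists n : (0 < n)%N -> exists w : R[i],
  [/\ cabs w = 1, w ^+ n = 1 & forall m, (0 < m < n)%N -> w ^+ m != 1].
Proof.
move=> n0; have pi0 : 0 < pi :> R by exact: pi_gt0.
have nR : 0 < n%:R :> R by rewrite ltr0n.
pose x : R := 2 * pi / n%:R.
have wE m : cexp (x%:C * 'i%C) ^+ m = cexpi (m%:R * x).
  rewrite -cexpMn cexpi_cexp; congr cexp.
  have -> : (m%:R * x)%:C = m%:R * x%:C :> R[i] by rewrite rmorphM rmorph_nat.
  by rewrite -mulrA mulr_natl.
exists (cexp (x%:C * 'i%C)); split.
- by rewrite -cexpi_cexp cabs_cexpi.
- rewrite wE; have -> : n%:R * x = pi *+ 2.
    by rewrite /x; field; rewrite gt_eqF.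
  by apply: complex_eq; rewrite /= ?cos2pi ?sin2pi.
- move=> m /andP[m0 mn]; rewrite wE; apply/eqP => /(congr1 (@complex.Re R)) /=.
  have mR : 0 < m%:R :> R by rewrite ltr0n.
  have -> : m%:R * x = (m%:R / n%:R * pi) *+ 2.
    by rewrite /x; field; rewrite gt_eqF.
  set y := m%:R / n%:R * pi.
  have y0 : 0 < sin y.
    apply: sin_gt0_pi; rewrite mulr_gt0 ?divr_gt0//=.
    by rewrite gtr_pMl// ltr_pdivrMr// mul1r ltr_nat.
  have := cos2Dsin2 y; rewrite cos_mulr2n.
  have : 0 < sin y ^+ 2 by rewrite exprn_gt0.
  lra.
Qed.

(* Averaging over the [M]-th roots of unity isolates the coefficient [a n]. *)
Lemma cauchy_polynomial a (r B : R) (M n : nat) : 0 < r -> (n < M)%N ->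
  (forall t, cabs t = r -> cabs (\sum_(0 <= m < M) a m * t ^+ m) <= B) ->
  cabs (a n) * r ^+ n <= B.
Proof.
move=> r0 nM H.
have M0 : (0 < M)%N by exact: leq_ltn_trans nM.
have [w [w1 wM wm]] := unity_root_exists M0.
(* Since [w ^+ M = 1], the weight stands for the power -k n of [w]. *)
pose S := \sum_(k < M) w ^+ (k * (M - n)) *
   (\sum_(0 <= m < M) a m * (r%:C * w ^+ k) ^+ m).
have SE : S = M%:R * (a n * r%:C ^+ n).
  rewrite /S.
  under eq_bigr do rewrite big_distrr/=.
  rewrite exchange_big/=.
  rewrite (eq_big_nat _ _ (F2 := fun m => (a m * r%:C ^+ m) * (if m == n then M%:R else 0))); last first.
    move=> m /andP[_ mM].
    transitivity ((a m * r%:C ^+ m) * \sum_(i < M) (w ^+ (M - n + m)) ^+ i).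
      rewrite big_distrr/=; apply: eq_bigr => i _.
      rewrite exprMn -!exprM (mulnC (_ + _)%N) mulnDr exprD; ring.
    congr (_ * _); have [->|mn] := eqVneq m n.
      rewrite subnK ?(ltnW nM)// wM.
      by under eq_bigr do rewrite expr1n; rewrite sumr_const card_ord.
    set v := w ^+ _.
    have vM : v ^+ M = 1 by rewrite /v -exprM mulnC exprM wM expr1n.
    have v1 : v != 1.
      rewrite /v; have [lt_mn|] := ltnP m n.
        apply: wm; apply/andP; split.
          by rewrite addn_gt0 subn_gt0 nM.
        by rewrite -[X in (_ < X)%N](subnK (ltnW nM)) ltn_add2l.
      move=> le_nm; rewrite addnBAC ?(ltnW nM)// -addnBA// exprD wM mul1r.
      apply: wm; rewrite subn_gt0 ltn_neqAle eq_sym mn le_nm/=.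
      by rewrite (leq_ltn_trans _ mM)// leq_subr.
    have := subrX1 v M; rewrite vM subrr => /esym/eqP.
    by rewrite mulf_eq0 subr_eq0 (negbTE v1) => /eqP.
  rewrite (bigD1_seq n) ?iota_uniq//=; last by rewrite mem_index_iota.
  rewrite eqxx big1 ?addr0 1?mulrC//.
  by move=> m /negbTE ->; rewrite mulr0.
have cr : cabs (r%:C : R[i]) = r by rewrite cabs_real gtr0_norm.
have : cabs S <= M%:R * B.
  apply: le_trans (cabs_sum _ _ _) _.
  have -> : M%:R * B = \sum_(k < M) B by rewrite sumr_const card_ord mulr_natl.
  apply: ler_sum => k _; rewrite cabsM cabsX w1 expr1n mul1r; apply: H.
  by rewrite cabsM cr cabsX w1 expr1n mulr1.
rewrite SE cabsM cabs_nat cabsM cabsX cr ler_pM2l//.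
by rewrite ltr0n.
Qed.

(** On the circle of radius [r] the truncated sums obey the bound [B] up to an error that tends to
    0, so the polynomial estimate, applied to ever longer sums containing [a n], passes to the
    limit. *)
Lemma cauchy_estimate a (F : R[i] -> R[i]) (r B A : R) n : 0 < r ->
  (forall N t, cabs t = r ->
     cabs (\sum_(0 <= m < N.+2) a m * t ^+ m - F t) <= A / 2 ^+ N) ->
  (forall t, cabs t = r -> cabs (F t) <= B) ->
  cabs (a n) * r ^+ n <= B.
Proof.
move=> r0 HA HB; apply/ler_addgt0Pr => e e0.
have A0 : 0 <= A.
  have := HA 0%N r%:C; rewrite cabs_real gtr0_norm// expr0 divr1 => /(_ erefl).
  by apply: le_trans; exact: cabs_ge0.
have [N nN AN] : exists2 N, (n <= N)%N & A / 2 ^+ N <= e.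
  have [N0 hN0] : exists N0 : nat, A / e <= N0%:R.
    exists (Num.bound (A / e)); apply/ltW.
    by have := archi_boundP (divr_ge0 A0 (ltW e0)).
  exists (maxn n N0); first exact: leq_maxl.
  rewrite ler_pdivrMr ?exprn_gt0// mulrC -ler_pdivrMr//.
  apply: le_trans hN0 _; rewrite -natrX ler_nat.
  by rewrite (leq_trans (leq_maxr n N0))// ltnW// ltn_expl.
apply: (cauchy_polynomial (M := N.+2)) => //; first by rewrite ltnS leqW.
move=> t tr; have := cabsD (\sum_(0 <= m < N.+2) a m * t ^+ m - F t) (F t).
rewrite subrK => /le_trans; apply; rewrite addrC lerD ?HB//.
exact: le_trans (HA N t tr) AN.
Qed.

End CauchyEstimate.

(** * Hermite polynomials and their generating function *)

Section HermitePolynomials.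
Variable R : realType.
Implicit Types (x : R) (n m N : nat).

Fixpoint hermite_poly n : {poly R} :=
  if n is m.+1 then 'X *+ 2 * hermite_poly m - (hermite_poly m)^`() else 1.

(** Differentiating p exp (- y^2) gives (p' - 2 y p) exp (- y^2), which up to sign is the recursion
    of [hermite_poly]. *)
Lemma hermite_polyE n x : hermite n x = (hermite_poly n).[x].
Proof.
have D : derive1n n (fun y : R => expR (- y ^+ 2)) =
    fun y => (-1) ^+ n * (hermite_poly n).[y] * expR (- y ^+ 2).
  elim: n => [|n IH]; first by apply/funext => y; rewrite derive1n0 hornerC !mul1r.
  rewrite derive1nS IH; apply/funext => y; rewrite derive1E.
  have dp : is_derive y 1 (horner (hermite_poly n)) ((hermite_poly n)^`()).[y].
    apply: DeriveDef; first exact: derivable_horner.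
    by rewrite derivE derive1E.
  have -> : (fun y => (-1) ^+ n * (hermite_poly n).[y] * expR (- y ^+ 2)) =
     (fun y => (-1) ^+ n * (hermite_poly n).[y]) * (expR \o (fun y => - y ^+ 2)).
    by [].
  have dq : is_derive y 1 (fun y : R => (-1) ^+ n * (hermite_poly n).[y])
     ((-1) ^+ n * ((hermite_poly n)^`()).[y]).
    have : is_derive y 1 (cst ((-1) ^+ n) * horner (hermite_poly n))
        ((-1) ^+ n * ((hermite_poly n)^`()).[y]); last by [].
    apply: is_derive_eq; rewrite -![_ *: _]/(_ * _) /= /cst; ring.
  have de : is_derive y 1 (fun y : R => - y ^+ 2) (- (2 * y)).
    apply: is_derive_eq; rewrite -![_ *: _]/(_ * _) /=; ring.
  have dg : is_derive y 1 (expR \o (fun y => - y ^+ 2)) (- (2 * y) * expR (- y ^+ 2)).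
    apply: is_derive_eq; rewrite /=; ring.
  have dfg := is_deriveM dq dg.
  rewrite derive_val -![_ *: _]/(_ * _) /=.
  rewrite hornerD hornerN hornerM hornerMn hornerX [(-1) ^+ n.+1]exprS; ring.
rewrite /hermite D.
have -> : (-1) ^+ n * expR (x ^+ 2) * ((-1) ^+ n * (hermite_poly n).[x]
   * expR (- x ^+ 2)) = ((-1) ^+ n) ^+ 2 * (hermite_poly n).[x]
      * (expR (x ^+ 2) * expR (- x ^+ 2)) by ring.
by rewrite expRxMexpNx_1 sqrr_sign mul1r mulr1.
Qed.

(** Removes the derivative from the recursion of [hermite_poly] and thereby yields the three-term
    recurrence. *)
Lemma deriv_hermite_poly n :
  (hermite_poly n.+1)^`() = hermite_poly n *+ (2 * n.+1).
Proof.
elim: n => [|n IH].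
  rewrite /= derivC subr0 mulr1 derivMn derivX muln1; by [].
have -> : hermite_poly n.+2 = 'X *+ 2 * hermite_poly n.+1 - (hermite_poly n.+1)^`().
  by [].
rewrite derivB derivM derivMn derivX {1}IH IH derivMn.
have -> : hermite_poly n.+1 = 'X *+ 2 * hermite_poly n - (hermite_poly n)^`().
  by [].
ring.
Qed.

Lemma hermite_rec n x : hermite n.+2 x =
  2 * x * hermite n.+1 x - 2 * n.+1%:R * hermite n x.
Proof.
rewrite !hermite_polyE.
have -> : hermite_poly n.+2 = 'X *+ 2 * hermite_poly n.+1 - (hermite_poly n.+1)^`().
  by [].
rewrite deriv_hermite_poly hornerD hornerN hornerM !hornerMn hornerX.
ring.
Qed.

Lemma hermite0 x : hermite 0 x = 1.
Proof. by rewrite hermite_polyE hornerC. Qed.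

Lemma hermite1 x : hermite 1 x = 2 * x.
Proof.
rewrite hermite_polyE /= derivC subr0 mulr1 hornerMn hornerX.
by rewrite mulr_natl.
Qed.

Lemma measurable_hermite n : measurable_fun setT (@hermite R n).
Proof.
have -> : @hermite R n = horner (hermite_poly n).
  by apply/funext => x; rewrite hermite_polyE.
apply: continuous_measurable_fun; exact: continuous_horner.
Qed.

(* Taylor coefficients at [t = 0] of the generating function
   [exp (2 x t - t ^ 2)]. *)
Definition hermite_coef n x : R := hermite n x / n`!%:R.

Local Notation b := hermite_coef.

Lemma hermite_coef0 x : b 0 x = 1.
Proof. by rewrite /b hermite0 fact0 divr1. Qed.

Lemma hermite_coef1 x : b 1 x = 2 * x.
Proof. by rewrite /b hermite1 factS fact0 muln1 divr1. Qed.

Lemma hermite_coef_rec n x :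
  n.+2%:R * b n.+2 x = 2 * x * b n.+1 x - 2 * b n x.
Proof.
have fn0 m : m`!%:R != 0 :> R by rewrite pnatr_eq0 -lt0n fact_gt0.
have n1 m : m.+1%:R != 0 :> R by rewrite pnatr_eq0.
rewrite /b hermite_rec !factS !natrM.
move: (fn0 n) (n1 n) (n1 n.+1).
move: (n`!%:R : R) (n.+1%:R : R) (n.+2%:R : R) => f a c f0 a0 c0.
by field; rewrite f0 a0 c0.
Qed.

(** The moduli satisfy, as inequalities, the recurrence of the Taylor coefficients of exp (2 |x| s +
    s^2). Hence their partial sums [S] satisfy S' <= (2 |x| + 2 s) S, and S exp (- 2 |x| s - s^2)
    decreases from its value 1 at 0. *)
Lemma hermite_coef_bound n x (r : R) : 0 <= r ->
  `|b n x| * r ^+ n <= expR (2 * `|x| * r + r ^+ 2).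
Proof.
move=> r0.
pose c m : R := `|b m x|; pose y : R := `|x|.
have c0 m : 0 <= c m by exact: normr_ge0.
have y0 : 0 <= y by exact: normr_ge0.
have crec m : m.+2%:R * c m.+2 <= 2 * y * c m.+1 + 2 * c m.
  rewrite /c; have := hermite_coef_rec m x.
  move: (b m.+2 x) (b m.+1 x) (b m x) => b2 b1 b0 bE.
  have -> : m.+2%:R * `|b2| = `|2 * x * b1 - 2 * b0|.
    by rewrite -bE normrM ger0_norm.
  by apply: le_trans (ler_normB _ _) _; rewrite !normrM (ger0_norm (_ : 0 <= 2)).
pose S N (s : R) : R := \sum_(0 <= m < N) c m * s ^+ m.
pose S' N (s : R) : R := \sum_(0 <= m < N) c m * (m%:R * s ^+ m.-1).
have S0 N s : 0 <= s -> 0 <= S N s.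
  by move=> s0; apply: sumr_ge0 => m _; rewrite mulr_ge0// exprn_ge0.
have SS N s : S N.+1 s = S N s + c N * s ^+ N by rewrite /S big_nat_recr.
have S'S N s : S' N.+1 s = S' N s + c N * (N%:R * s ^+ N.-1).
  by rewrite /S' big_nat_recr.
have S'le N s : 0 <= s -> S' N.+2 s <= 2 * y * S N.+1 s + 2 * s * S N s.
  move=> s0; elim: N => [|N IH].
    rewrite !S'S !SS /S /S' !big_geq// /c hermite_coef0 hermite_coef1.
    rewrite normrM normr1 (ger0_norm (_ : 0 <= 2))// -/y /= !expr0; lra.
  rewrite !SS in IH; rewrite S'S !SS /=.
  have := ler_wpM2r (exprn_ge0 N.+1 s0) (crec N).
  have -> : c N.+2 * (N.+2%:R * s ^+ N.+1) = N.+2%:R * c N.+2 * s ^+ N.+1 by ring.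
  rewrite (_ : (2 * y * c N.+1 + 2 * c N) * s ^+ N.+1 =
     2 * y * (c N.+1 * s ^+ N.+1) + 2 * s * (c N * s ^+ N)); last first.
    by rewrite exprS; ring.
  rewrite ?exprS in IH *; lra.
have Sd N (s : R) : is_derive s 1 (S N) (S' N s).
  elim: N => [|N IH].
    have -> : S 0%N = cst 0 by apply/funext => z; rewrite /S big_geq.
    by rewrite /S' big_geq//; exact: is_derive_cst.
  have -> : S N.+1 = S N + (fun z => c N * z ^+ N).
    by apply/funext => z; rewrite SS.
  rewrite S'S; apply: is_deriveD.
  have pw : is_derive s 1 (fun z : R => z ^+ N) (N%:R * s ^+ N.-1).
    apply: DeriveDef; first exact: exprn_derivable.
    by rewrite exp_derive; exact: mulr1.
  exact: (is_deriveZ (c N) pw).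
pose g s := - (2 * y * s + s ^+ 2).
have gd (s : R) : is_derive s 1 g (- (2 * y + 2 * s)).
  apply: is_derive_eq; rewrite -![_ *: _]/(_ * _) /=; ring.
pose N := n.+2.
have hd (s : R) : is_derive s 1 (S N * (expR \o g))
    ((S' N s - (2 * y + 2 * s) * S N s) * expR (g s)).
  have := gd s => gds; have := Sd N s => Sds.
  apply: is_derive_eq; rewrite -![_ *: _]/(_ * _) /=; ring.
have dec : S N r * expR (g r) <= S N 0 * expR (g 0).
  apply: (@ler0_derive1_nincr R (S N * (expR \o g)) 0 r _ _ _ 0 r) => //.
  - move=> s; rewrite in_itv/= => /andP[s0 _].
    rewrite derive1E; have hds := hd s; rewrite derive_val.
    rewrite mulr_le0_ge0 ?expR_ge0// subr_le0.
    apply: le_trans (S'le n s (ltW s0)) _; rewrite [leRHS]mulrDl.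
    have m1 : S n.+1 s <= S N s.
      by rewrite /N (SS n.+1) lerDl mulr_ge0// exprn_ge0// ltW.
    have m2 : S n s <= S N s.
      by apply: le_trans m1; rewrite (SS n) lerDl mulr_ge0// exprn_ge0// ltW.
    by apply: lerD; apply: ler_wpM2l => //; rewrite mulr_ge0// ltW.
  - by apply: derivable_within_continuous => s _; have [] := hd s.
have S00 : S N 0 = 1.
  rewrite /S big_nat_recl// big1 ?addr0; last by move=> i _; rewrite expr0n mulr0.
  by rewrite expr0 mulr1 /c hermite_coef0 normr1.
move: dec; rewrite S00 /g mulr0 expr0n addr0 oppr0 expR0 mulr1 expRN.
rewrite ler_pdivrMr ?expR_gt0// mul1r; apply: le_trans.
rewrite /N 2!SS -/(c n) (le_trans _ (_ : S n r + c n * r ^+ n <= _))//.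
  by rewrite lerDr S0.
by rewrite lerDl mulr_ge0// exprn_ge0.
Qed.

Definition hermite_gen x (t : R[i]) : R[i] := cexp ((2 * x)%:C * t - t ^+ 2).

Lemma hermite_gen_bound x t :
  cabs (hermite_gen x t) <= expR (2 * `|x| * cabs t + cabs t ^+ 2).
Proof.
rewrite cabs_cexp ler_expR; apply: le_trans (Re_le_cabs _) _.
apply: le_trans (cabsB _ _) _.
by rewrite cabsX cabsM cabs_real normrM ger0_norm.
Qed.

(* The truncated series [T] satisfies [T' = (2 x - 2 t) T + err] with [err]
   of order [t ^+ N.+1], so that [T / hermite_gen] has a small derivative. *)
Lemma hermite_gen_approx (r : R) : 0 <= r -> exists A B : R, 0 <= B /\
  forall N x (t : R[i]), cabs t <= r ->
  cabs (\sum_(0 <= m < N.+2) (b m x)%:C * t ^+ m - hermite_gen x t)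
    <= expR (A + B * `|x|) / 2 ^+ N.
Proof.
(* Bounding the coefficients at radius 2 q gains the factor 2^-m at radius [q]; the summand 1 keeps
   [q] positive when [r = 0]. *)
move=> r0; pose q := r + 1.
have q0 : 0 < q by rewrite ltr_wpDl.
have q1 : 1 <= q by rewrite lerDr.
have rq : r <= q by rewrite lerDl.
(* The terms in [q], with the 1, bound the error [err]; 2 r absorbs a linear factor; the rest is
   twice the exponent 2 |x| r + r^2, once for dividing by the generating function and once for
   multiplying by it again. *)
exists (4 * q ^+ 2 + 3 * q + 2 * r ^+ 2 + 2 * r), (4 * q + 1 + 4 * r).
split; first by rewrite !addr_ge0// mulr_ge0// ltW.
move=> N x t tr.
pose T M (u : R[i]) := \sum_(0 <= m < M) (b m x)%:C * u ^+ m.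
pose T' M (u : R[i]) := \sum_(0 <= m < M) (b m x)%:C * (m%:R * u ^+ m.-1).
have TS M u : T M.+1 u = T M u + (b M x)%:C * u ^+ M by rewrite /T big_nat_recr.
have T'S M u : T' M.+1 u = T' M u + (b M x)%:C * (M%:R * u ^+ M.-1).
  by rewrite /T' big_nat_recr.
have T'E M u : T' M.+2 u = (2 * x)%:C * T M.+1 u - 2 * u * T M u.
  elim: M => [|M IH].
    rewrite !T'S !TS /T /T' !big_geq// hermite_coef0 hermite_coef1.
    by rewrite /= !expr0; ring.
  rewrite T'S IH !TS [M.+2.-1]/=; have := hermite_coef_rec M x.
  move: (b M.+2 x) (b M.+1 x) (b M x) => b2 b1 b0 bE.
  have -> : b2%:C * (M.+2%:R * u ^+ M.+1) = (M.+2%:R * b2)%:C * u ^+ M.+1.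
    by rewrite rcM rc_nat; ring.
  by rewrite bE rcB !rcM !rc_nat exprS; ring.
pose err (u : R[i]) : R[i] := u ^+ N.+1 *
   (2 * (b N x)%:C - (2 * x)%:C * (b N.+1 x)%:C + 2 * u * (b N.+1 x)%:C).
have errE u : T' N.+2 u = ((2 * x)%:C - 2 * u) * T N.+2 u + err u.
  by rewrite T'E !TS /err exprS; ring.
pose E0 := expR (4 * `|x| * q + 4 * q ^+ 2).
have bE m : `|b m x| * q ^+ m <= E0 / 2 ^+ m.
  rewrite ler_pdivlMr ?exprn_gt0// -mulrA -exprMn.
  apply: le_trans (hermite_coef_bound m x _) _; first by rewrite mulr_ge0// ltW.
  by rewrite ler_expR exprMn; lra.
have E00 : 0 <= E0 by exact: expR_ge0.
have nb (b0 b1 : R) (u : R[i]) :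
    cabs (2 * b0%:C - (2 * x)%:C * b1%:C + 2 * u * b1%:C) <=
    2 * `|b0| + 2 * `|x| * `|b1| + 2 * cabs u * `|b1|.
  apply: le_trans (cabsD _ _) _; apply: lerD.
    apply: le_trans (cabsB _ _) _.
    by rewrite !cabsM !cabs_real cabs_nat normrM (ger0_norm (_ : 0 <= 2)).
  by rewrite !cabsM !cabs_real cabs_nat.
have errB u : cabs u <= r -> cabs (err u) <=
    expR ((4 * q + 1) * `|x| + 4 * q ^+ 2 + 3 * q) / 2 ^+ N.
  move=> ur; have uq := le_trans ur rq; have u0 := cabs_ge0 u.
  have uN m : cabs u ^+ m <= q ^+ m by rewrite lerXn2r ?nnegrE// ltW.
  have b1 : cabs u ^+ N.+1 * `|b N x| <= q * (E0 / 2 ^+ N).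
    apply: le_trans (ler_wpM2l (ltW q0) (bE N)).
    rewrite mulrCA -exprS mulrC; exact: ler_wpM2l.
  have b2 : cabs u ^+ N.+1 * `|b N.+1 x| <= 2^-1 * (E0 / 2 ^+ N).
    have -> : 2^-1 * (E0 / 2 ^+ N) = E0 / 2 ^+ N.+1.
      by rewrite exprS; field; rewrite expf_neq0.
    by apply: le_trans (bE N.+1); rewrite mulrC; exact: ler_wpM2l.
  rewrite /err cabsM cabsX.
  apply: le_trans (_ : _ <= cabs u ^+ N.+1 * (2 * `|b N x|
     + 2 * `|x| * `|b N.+1 x| + 2 * cabs u * `|b N.+1 x|)) _.
    by apply: ler_wpM2l; [exact: exprn_ge0 | exact: nb].
  set Z := E0 / 2 ^+ N in b1 b2.
  have Z0 : 0 <= Z by rewrite divr_ge0// exprn_ge0.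
  set U := cabs u ^+ N.+1 in b1 b2 *.
  apply: le_trans (_ : (`|x| + 3 * q) * Z <= _).
    have x1 := ler_wpM2l (normr_ge0 x) b2.
    have x2 := ler_wpM2l u0 b2.
    have x3 : cabs u * (2^-1 * Z) <= q * (2^-1 * Z).
      by rewrite ler_wpM2r// mulr_ge0// invr_ge0.
    lra.
  rewrite /Z mulrA ler_pM2r ?invr_gt0 ?exprn_gt0//.
  have -> : (4 * q + 1) * `|x| + 4 * q ^+ 2 + 3 * q =
    (`|x| + 3 * q) + (4 * `|x| * q + 4 * q ^+ 2) by ring.
  rewrite expRD ler_wpM2r//.
  by apply: le_trans (expR_ge1Dx _); rewrite lerDr.
have tE (s : R) : 0 <= s <= 1 -> cabs (s%:C * t) <= r.
  move=> /andP[s0 s1]; apply: le_trans tr.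
  by rewrite cabsM cabs_real ger0_norm// ler_piMl ?cabs_ge0.
have linE s : path_derive (fun y => y%:C * t) s t.
  apply: path_derive_eq (path_deriveM (path_derive_id s) (path_derive_cst t s)) _.
  by rewrite mulr0 addr0 mul1r.
pose P (u : R[i]) : R[i] := -1 * ((2 * x)%:C * u) + u ^+ 2.
have PE u : cexp (P u) = cexp (- ((2 * x)%:C * u - u ^+ 2)).
  by congr cexp; rewrite /P; ring.
have dP s : path_derive (fun y => P (y%:C * t)) s
   (t * (- ((2 * x)%:C - 2 * (s%:C * t)))).
  apply: path_derive_eq (path_deriveD (path_deriveM (path_derive_cst (-1) s)
    (path_deriveM (path_derive_cst (2 * x)%:C s) (linE s)))
    (path_deriveX 2 (linE s))) _.
  by rewrite /cst (_ : 2.-1 = 1%N)// expr1; ring.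
have dT s : path_derive (fun y => T N.+2 (y%:C * t)) s (t * T' N.+2 (s%:C * t)).
  apply: path_derive_eq (@path_derive_sum _ N.+2
    (fun m y => (b m x)%:C * (y%:C * t) ^+ m)
    (fun m => t * ((b m x)%:C * (m%:R * (s%:C * t) ^+ m.-1))) s _) _.
    move=> m; apply: path_derive_eq (path_deriveM (path_derive_cst (b m x)%:C s)
      (path_deriveX m (linE s))) _.
    by rewrite /cst; ring.
  by rewrite /T' big_distrr.
have := path_mean_value
  (p := fun y => T N.+2 (y%:C * t) * cexp (P (y%:C * t)))
  (p' := fun s => t * err (s%:C * t) * cexp (P (s%:C * t)))
  (M := r * (expR ((4 * q + 1) * `|x| + 4 * q ^+ 2 + 3 * q) / 2 ^+ N)
     * expR (2 * `|x| * r + r ^+ 2)).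
rewrite mul1r mul0r.
have -> : T N.+2 0 = 1.
  rewrite /T big_nat_recl// big1 ?addr0; last by move=> i _; rewrite expr0n mulr0.
  by rewrite expr0 mulr1 hermite_coef0.
have -> : cexp (P 0) = 1 by rewrite /P !mulr0 expr0n addr0 cexp0.
rewrite mulr1 => main.
have {}main : cabs (T N.+2 t * cexp (P t) - 1) <= 2 *
  (r * (expR ((4 * q + 1) * `|x| + 4 * q ^+ 2 + 3 * q) / 2 ^+ N)
     * expR (2 * `|x| * r + r ^+ 2)).
  apply: main => s s01.
    apply: path_derive_eq (path_deriveM (dT s) (path_derive_cexp (dP s))) _.
    by rewrite errE; ring.
  rewrite (cabsM (t * _)) (cabsM t); apply: ler_pM.
  - by rewrite mulr_ge0 ?cabs_ge0.
  - exact: cabs_ge0.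
  - by apply: ler_pM; rewrite ?cabs_ge0// errB// tE.
  - rewrite cabs_cexp ler_expR; apply: le_trans (Re_le_cabs _) _.
    apply: le_trans (cabsD _ _) _; rewrite cabsX !cabsM cabsN cabs1 mul1r.
    rewrite cabs_real normrM (ger0_norm (_ : 0 <= 2))//.
    have := tE s s01; rewrite -cabsM => st; apply: lerD.
      by rewrite ler_wpM2l// mulr_ge0.
    by rewrite lerXn2r ?nnegrE ?cabs_ge0.
have -> : \sum_(0 <= m < N.+2) (b m x)%:C * t ^+ m - hermite_gen x t
   = (T N.+2 t * cexp (P t) - 1) * hermite_gen x t.
  rewrite mulrBl mul1r -mulrA PE cexpN mulVf ?mulr1//.
  apply/eqP => /(congr1 (@cabs R)); rewrite cabs_cexp cabs0 => /eqP.
  by rewrite expR_eq0.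
rewrite cabsM.
apply: le_trans (ler_pM (cabs_ge0 _) (cabs_ge0 _) main (hermite_gen_bound x t)) _.
have gE : expR (2 * `|x| * cabs t + cabs t ^+ 2) <= expR (2 * `|x| * r + r ^+ 2).
  rewrite ler_expR; apply: lerD; first by rewrite ler_wpM2l// mulr_ge0.
  by rewrite lerXn2r ?nnegrE ?cabs_ge0.
set X1 := expR ((4 * q + 1) * _ + _ + _).
have X2 : 2 * r <= expR (2 * r).
  by apply: le_trans (expR_ge1Dx _); rewrite lerDr.
apply: le_trans (_ : expR (2 * r) * X1 * expR (2 * `|x| * r + r ^+ 2) *
   expR (2 * `|x| * r + r ^+ 2) / 2 ^+ N <= _); last first.
  rewrite ler_pM2r ?invr_gt0 ?exprn_gt0// /X1 -!expRD ler_expR; lra.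
set X3 := expR (2 * `|x| * r + r ^+ 2) in gE *.
have X10 : 0 <= X1 by exact: expR_ge0.
have X30 : 0 <= X3 by exact: expR_ge0.
have N0 : 0 <= (2 ^+ N)^-1 :> R by rewrite invr_ge0 exprn_ge0.
have -> : expR (2 * r) * X1 * X3 * X3 / 2 ^+ N =
  (expR (2 * r) * (X1 / 2 ^+ N * X3)) * X3 by ring.
apply: ler_pM; rewrite ?expR_ge0//; first by rewrite !mulr_ge0.
by rewrite !mulrA !ler_wpM2r.
Qed.

End HermitePolynomials.

(** * Complex integration *)

Section ComplexIntegration.
Variable R : realType.
Implicit Types (f g : R -> R[i]) (h : R -> R) (c : R[i]).
Local Notation mu := (@lebesgue_measure R).

Lemma ae_mono (P Q : R -> Prop) : (forall x, P x -> Q x) ->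
  {ae mu, forall x, P x} -> {ae mu, forall x, Q x}.
Proof. exact: (@filterS _ _ (ae_filter_ringOfSetsType mu)). Qed.

Lemma ae_all (P : R -> Prop) : (forall x, P x) -> {ae mu, forall x, P x}.
Proof.
move=> H; apply: (@filterS _ _ (ae_filter_ringOfSetsType mu) setT) => //.
exact: (@filterT _ _ (ae_filter_ringOfSetsType mu)).
Qed.

Lemma measurable_cos : measurable_fun setT (@cos R).
Proof.
apply: continuous_measurable_fun; exact: continuous_cos.
Qed.

Lemma measurable_sin : measurable_fun setT (@sin R).
Proof.
apply: continuous_measurable_fun; exact: continuous_sin.
Qed.

Section ComplexMeasurable.
Context d (T : measurableType d).
Implicit Types (k l : T -> R[i]).

(** [cmeasurable] over an arbitrary measurable space; Fubini's theorem requires it on the plane. *)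
Definition complex_measurable k :=
  measurable_fun setT (fun x => Re (k x)) /\
  measurable_fun setT (fun x => Im (k x)).

Lemma complex_measurableM k l : complex_measurable k -> complex_measurable l ->
  complex_measurable (fun x => k x * l x).
Proof.
move=> [fr fi] [gr gi]; split.
- rewrite (_ : (fun x => _) = (fun x => Re (k x) * Re (l x) - Im (k x) * Im (l x))).
    by apply: measurable_funB; exact: measurable_funM.
  by apply/funext => x; rewrite ReM.
- rewrite (_ : (fun x => _) = (fun x => Re (k x) * Im (l x) + Im (k x) * Re (l x))).
    by apply: measurable_funD; exact: measurable_funM.
  by apply/funext => x; rewrite ImM.
Qed.

Lemma complex_measurableD k l : complex_measurable k -> complex_measurable l ->
  complex_measurable (fun x => k x + l x).
Proof.
move=> [fr fi] [gr gi]; split.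
- rewrite (_ : (fun x => _) = (fun x => Re (k x) + Re (l x))).
    exact: measurable_funD.
  by apply/funext => x; rewrite ReD.
- rewrite (_ : (fun x => _) = (fun x => Im (k x) + Im (l x))).
    exact: measurable_funD.
  by apply/funext => x; rewrite ImD.
Qed.

Lemma complex_measurable_cst c : complex_measurable (fun=> c).
Proof. by split; exact: measurable_cst. Qed.

Lemma complex_measurable_real (h : T -> R) : measurable_fun setT h ->
  complex_measurable (fun x => (h x)%:C).
Proof. by split=> //=; exact: measurable_cst. Qed.

Lemma complex_measurable_cexp k : complex_measurable k ->
  complex_measurable (fun x => cexp (k x)).
Proof.
move=> [fr fi]; apply: complex_measurableM.
  by apply: complex_measurable_real; exact: measurableT_comp.
split=> /=; first by apply: measurableT_comp => //; exact: measurable_cos.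
by apply: measurableT_comp => //; exact: measurable_sin.
Qed.

End ComplexMeasurable.

Lemma cmeasurableM f g : cmeasurable f -> cmeasurable g ->
  cmeasurable (fun x => f x * g x).
Proof. exact: complex_measurableM. Qed.

Lemma cmeasurableD f g : cmeasurable f -> cmeasurable g ->
  cmeasurable (fun x => f x + g x).
Proof. exact: complex_measurableD. Qed.

Lemma cmeasurable_cst c : cmeasurable (fun=> c).
Proof. exact: complex_measurable_cst. Qed.

Lemma cmeasurable_real h : measurable_fun setT h ->
  cmeasurable (fun x => (h x)%:C).
Proof. exact: complex_measurable_real. Qed.

Lemma cmeasurable_cexp f : cmeasurable f -> cmeasurable (fun x => cexp (f x)).
Proof. exact: complex_measurable_cexp. Qed.

Lemma cmeasurable_sum (n : nat) (F : nat -> R -> R[i]) :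
  (forall m, cmeasurable (F m)) ->
  cmeasurable (fun x => \sum_(0 <= m < n) F m x).
Proof.
move=> mF; elim: n => [|n IH].
  rewrite (_ : (fun x => _) = (fun=> 0)); first exact: cmeasurable_cst.
  by apply/funext => x; rewrite big_geq.
rewrite (_ : (fun x => _) = (fun x => \sum_(0 <= m < n) F m x + F n x)).
  exact: cmeasurableD.
by apply/funext => x; rewrite big_nat_recr.
Qed.

Lemma measurable_cabs f : cmeasurable f -> measurable_fun setT (fun x => cabs (f x)).
Proof.
move=> [fr fi].
rewrite (_ : (fun x => _) = (fun x => Num.sqrt (Re (f x) ^+ 2 + Im (f x) ^+ 2))).
  apply: measurableT_comp; last by apply: measurable_funD; exact: measurable_funX.
  by apply: continuous_measurable_fun; exact: sqrt_continuous.
by apply/funext => x; case: (f x).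
Qed.

Lemma cintegrable_measurable f : cintegrable f -> cmeasurable f.
Proof.
by move=> [/measurable_int/measurable_EFinP ? /measurable_int/measurable_EFinP].
Qed.

Lemma integrable_ae_dominated h (g : R -> R) : measurable_fun setT h ->
  (forall x, 0 <= g x) -> mu.-integrable setT (EFin \o g) ->
  {ae mu, forall x, `|h x| <= g x} ->
  mu.-integrable setT (EFin \o h) /\ `|\int[mu]_x h x| <= \int[mu]_x g x.
Proof.
move=> mh g0 ig hg.
have le1 : (\int[mu]_x `|(h x)%:E| <= \int[mu]_x (g x)%:E)%E.
  apply: ae_ge0_le_integral => //.
  - by apply: measurableT_comp => //; exact/measurable_EFinP.
  - by move=> x _; rewrite lee_fin.
  - exact: measurable_int ig.
  - by move: hg; apply: ae_mono => x hx _; rewrite lee_fin.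
have ih : mu.-integrable setT (EFin \o h).
  apply/integrableP; split; first exact/measurable_EFinP.
  apply: le_lt_trans le1 _.
  have /integrableP[_] := ig.
  under eq_integral do rewrite /= ger0_norm//.
  by [].
split=> //; apply: le_trans (le_normr_Rintegral _ ih) _ => //.
apply: fine_le => //.
- have := ih; move=> /integrableP[_ fi].
  by rewrite ge0_fin_numE ?integral_ge0//.
- exact: integrable_fin_num.
Qed.

(** Real and imaginary parts are estimated separately, whence the factor 2. *)
Lemma cintegral_dominated f (g : R -> R) : cmeasurable f ->
  (forall x, 0 <= g x) -> mu.-integrable setT (EFin \o g) ->
  {ae mu, forall x, cabs (f x) <= g x} ->
  cintegrable f /\ cabs (cintegral f) <= 2 * \int[mu]_x g x.
Proof.
move=> [mr mi] g0 ig fg.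
have [ir br] : mu.-integrable setT (EFin \o (fun x => Re (f x))) /\
    `|\int[mu]_x Re (f x)| <= \int[mu]_x g x.
  apply: integrable_ae_dominated => //; move: fg; apply: ae_mono => x.
  by apply: le_trans; exact: normr_Re_le.
have [ii bi] : mu.-integrable setT (EFin \o (fun x => Im (f x))) /\
    `|\int[mu]_x Im (f x)| <= \int[mu]_x g x.
  apply: integrable_ae_dominated => //; move: fg; apply: ae_mono => x.
  by apply: le_trans; exact: normr_Im_le.
split; first by split.
by apply: le_trans (cabs_le_ReIm _) _; rewrite mulr2n mulrDl mul1r lerD.
Qed.

Lemma cintegralD f g : cintegrable f -> cintegrable g ->
  cintegral (fun x => f x + g x) = cintegral f + cintegral g.
Proof.
move=> [fr fi] [gr gi]; apply: complex_eq; rewrite ?ReD ?ImD /=.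
- rewrite -RintegralD//; apply: eq_Rintegral => x _; by rewrite ReD.
- rewrite -RintegralD//; apply: eq_Rintegral => x _; by rewrite ImD.
Qed.

Lemma cintegrableD f g : cintegrable f -> cintegrable g ->
  cintegrable (fun x => f x + g x).
Proof.
move=> [fr fi] [gr gi]; split.
- rewrite (_ : (fun x => _) = (fun x => (Re (f x))%:E + (Re (g x))%:E)%E).
    exact: integrableD.
  by apply/funext => x; rewrite ReD.
- rewrite (_ : (fun x => _) = (fun x => (Im (f x))%:E + (Im (g x))%:E)%E).
    exact: integrableD.
  by apply/funext => x; rewrite ImD.
Qed.

Lemma cintegrableZ c f : cintegrable f -> cintegrable (fun x => c * f x).
Proof.
move=> [fr fi]; split.
- rewrite (_ : (fun x => _) =
    (fun x => (Re c)%:E * (Re (f x))%:E - (Im c)%:E * (Im (f x))%:E)%E).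
    by apply: integrableB => //; exact: integrableZl.
  by apply/funext => x; rewrite ReM.
- rewrite (_ : (fun x => _) =
    (fun x => (Re c)%:E * (Im (f x))%:E + (Im c)%:E * (Re (f x))%:E)%E).
    by apply: integrableD => //; exact: integrableZl.
  by apply/funext => x; rewrite ImM.
Qed.

Lemma cintegralZ c f : cintegrable f ->
  cintegral (fun x => c * f x) = c * cintegral f.
Proof.
have iZ (k : R) (h : R -> R) : mu.-integrable setT (EFin \o h) ->
    mu.-integrable setT (EFin \o (fun x => k * h x)).
  by move=> ih; exact: (integrableZl measurableT k ih).
move=> [fr fi]; apply: complex_eq; rewrite ?ReM ?ImM /=.
- rewrite -!RintegralZl// -RintegralB//; [|exact: iZ|exact: iZ].
  by apply: eq_Rintegral => x _; rewrite ReM.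
- rewrite -!RintegralZl// -RintegralD//; [|exact: iZ|exact: iZ].
  by apply: eq_Rintegral => x _; rewrite ImM.
Qed.

Lemma cintegral0 : cintegral (fun=> 0 : R[i]) = 0.
Proof.
by apply: complex_eq => /=; rewrite /Rintegral integral0.
Qed.

Lemma cintegrable0 : cintegrable (fun=> 0 : R[i]).
Proof. by split; exact: integrable0. Qed.

Lemma cintegral_sum (n : nat) (F : nat -> R -> R[i]) :
  (forall m, cintegrable (F m)) ->
  cintegrable (fun x => \sum_(0 <= m < n) F m x) /\
  cintegral (fun x => \sum_(0 <= m < n) F m x) =
    \sum_(0 <= m < n) cintegral (F m).
Proof.
move=> iF; elim: n => [|n [IH1 IH2]].
  rewrite (_ : (fun x => _) = (fun=> 0)).
    by split; [exact: cintegrable0 | rewrite big_geq// cintegral0].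
  by apply/funext => x; rewrite big_geq.
rewrite (_ : (fun x => _) = (fun x => \sum_(0 <= m < n) F m x + F n x)).
  split; first exact: cintegrableD.
  by rewrite cintegralD// IH2 big_nat_recr.
by apply/funext => x; rewrite big_nat_recr.
Qed.

(** A rescaled normal density of mean [m] and deviation 1 / sqrt (2 d), whose mass is 1. What
    matters is that [G] does not depend on the centre [m]. *)
Lemma gaussian_integral (d : R) : 0 < d -> exists G : R, 0 < G /\ forall m : R,
  mu.-integrable setT (EFin \o (fun x : R => expR (- (d * (x - m) ^+ 2)))) /\
  \int[mu]_x expR (- (d * (x - m) ^+ 2)) = G.
Proof.
move=> d0; pose s := (Num.sqrt (2 * d))^-1.
have s0 : s != 0 by rewrite invr_neq0// gt_eqF// sqrtr_gt0 mulr_gt0.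
have s2 : s ^+ 2 = (2 * d)^-1 by rewrite exprVn sqr_sqrtr// mulr_ge0// ltW.
have pk := normal_peak_gt0 s0.
exists (normal_peak s)^-1; split; first by rewrite invr_gt0.
move=> m.
have E x : expR (- (d * (x - m) ^+ 2)) = (normal_peak s)^-1 * normal_pdf m s x.
  rewrite normal_pdfE// mulrA mulVf ?gt_eqF// mul1r /normal_fun s2.
  by congr expR; field; rewrite gt_eqF.
have -> : (fun x => expR (- (d * (x - m) ^+ 2))) =
   (fun x => (normal_peak s)^-1 * normal_pdf m s x) by apply/funext.
have ip := integrable_normal_pdf m s.
split; first exact: (integrableZl _ _ ip).
rewrite RintegralZl//.
by rewrite /Rintegral integral_normal_pdf /= mulr1.
Qed.

End ComplexIntegration.

(** * The Gaussian transform *)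

Section GaussianTransform.
Variable R : realType.
Implicit Types (f p : R -> R[i]) (x : R) (w t : R[i]).
Local Notation mu := (@lebesgue_measure R).

Definition gweight x : R[i] := (expR (- x ^+ 2 / 2))%:C.

Lemma cmeasurable_gweight : cmeasurable gweight.
Proof.
apply: cmeasurable_real; apply: measurableT_comp => //.
apply: measurable_funM => //; apply: measurableT_comp => //.
Qed.

Lemma cmeasurable_expline w : cmeasurable (fun x => cexp (w * x%:C)).
Proof.
apply: cmeasurable_cexp; apply: cmeasurableM; first exact: cmeasurable_cst.
by apply: cmeasurable_real.
Qed.

Lemma cabs_gweight x : cabs (gweight x) = expR (- x ^+ 2 / 2).
Proof. by rewrite cabs_real ger0_norm// expR_ge0. Qed.

Lemma cabs_expline w x : cabs (cexp (w * x%:C)) <= expR (cabs w * `|x|).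
Proof.
rewrite cabs_cexp ler_expR; apply: le_trans (Re_le_cabs _) _.
by rewrite cabsM cabs_real.
Qed.

(** By B |x| <= x^2 / 4 + B^2, half of the Gaussian weight absorbs the exponential growth of [p] and
    the other half is integrated; so one constant [G] serves all [f] and [p]. *)
Lemma weighted_integral : exists G : R, 0 < G /\
  forall f p (C K B : R), cmeasurable f -> 0 <= C ->
    {ae mu, forall x, cabs (f x) <= C} ->
    cmeasurable p -> 0 <= K -> 0 <= B ->
    (forall x, cabs (p x) <= K * expR (B * `|x|)) ->
  cintegrable (fun x => f x * gweight x * p x) /\
  cabs (cintegral (fun x => f x * gweight x * p x)) <= G * (C * K * expR (B ^+ 2)).
Proof.
have [G [G0 H]] := @gaussian_integral R 4^-1 ltac:(by rewrite invr_gt0).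
have [iG eG] := H 0.
exists (2 * G); split; first exact: mulr_gt0.
move=> f p C K B mf C0 fC mp K0 B0 pK.
pose D := C * K * expR (B ^+ 2).
have D0 : 0 <= D by rewrite !mulr_ge0// expR_ge0.
have := @cintegral_dominated R (fun x => f x * gweight x * p x)
   (fun x => D * expR (- (4^-1 * (x - 0) ^+ 2))).
case.
- apply: cmeasurableM => //; apply: cmeasurableM => //.
  exact: cmeasurable_gweight.
- by move=> x; rewrite mulr_ge0// expR_ge0.
- exact: (integrableZl measurableT D iG).
- move: fC; apply: ae_mono => x fx; rewrite !cabsM cabs_gweight.
  apply: le_trans (_ : C * expR (- x ^+ 2 / 2) * (K * expR (B * `|x|)) <= _).
    apply: ler_pM; rewrite ?cabs_ge0 ?mulr_ge0 ?cabs_ge0 ?expR_ge0//.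
    by rewrite ler_wpM2r// expR_ge0.
  rewrite (_ : C * _ * _ = C * K * (expR (- x ^+ 2 / 2) * expR (B * `|x|))); last ring.
  rewrite /D -[leRHS]mulrA ler_wpM2l ?mulr_ge0// -!expRD ler_expR subr0.
  have : 0 <= (`|x| / 2 - B) ^+ 2 by exact: sqr_ge0.
  have : `|x| ^+ 2 = x ^+ 2 by rewrite real_normK ?num_real.
  lra.
move=> ii bb; split=> //; apply: le_trans bb _.
rewrite RintegralZl// eG /D le_eqVlt; apply/orP; left; apply/eqP; ring.
Qed.

Definition gtransform f w : R[i] :=
  cintegral (fun x => f x * gweight x * cexp (w * x%:C)).

Lemma gtransform_integrable f (C : R) w : cmeasurable f -> 0 <= C ->
  {ae mu, forall x, cabs (f x) <= C} ->
  cintegrable (fun x => f x * gweight x * cexp (w * x%:C)).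
Proof.
move=> mf C0 fC; have [G [_ H]] := weighted_integral.
have [] // := H f (fun x => cexp (w * x%:C)) C 1 (cabs w) mf C0 fC.
- exact: cmeasurable_expline.
- exact: cabs_ge0.
- by move=> x; rewrite mul1r cabs_expline.
Qed.

(** The expansion of [cexp (h * x%:C)] is integrated term by term: the coefficients are moments of
    [f] against the weight, and the cubic remainder grows at most exponentially in |x| when |h| <=
    1. *)
Lemma gtransform_jet2 f (C : R) w : cmeasurable f -> 0 <= C ->
  {ae mu, forall x, cabs (f x) <= C} -> jet2 (gtransform f) w.
Proof.
move=> mf C0 fC; have [G [G0 H]] := weighted_integral.
have W p (K B : R) := H f p C K B mf C0 fC.
have mx n : cmeasurable (fun x : R => x%:C ^+ n : R[i]).
  rewrite (_ : (fun x => _) = (fun x => (x ^+ n)%:C)).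
    by apply: cmeasurable_real; exact: measurable_funX.
  by apply/funext => x; rewrite rmorphXn.
have me := cmeasurable_expline w.
have xe n x : cabs (x%:C ^+ n : R[i]) <= n`!%:R * expR `|x|.
  rewrite cabsX cabs_real; case: n => [|n].
    by rewrite expr0 fact0 mul1r -expR0 ler_expR.
  rewrite mulrC -ler_pdivrMr ?ltr0n ?fact_gt0//.
  by apply: le_trans (expR_ge1Dxn n (normr_ge0 x)); rewrite lerDr.
pose P n x := x%:C ^+ n * cexp (w * x%:C).
have PW n : cintegrable (fun x => f x * gweight x * P n x).
  have [] // := W (P n) n`!%:R (cabs w + 1).
  - exact: cmeasurableM.
  - by rewrite addr_ge0 ?cabs_ge0.
  - move=> x; rewrite cabsM mulrDl mul1r expRD [leRHS]mulrA [leRHS]mulrAC.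
    by apply: ler_pM; rewrite ?cabs_ge0// cabs_expline.
pose I n := cintegral (fun x => f x * gweight x * P n x).
apply: (@jet2_bound _ _ _ (I 1%N) (2^-1 * I 2%N) 1
  (G * (C * 48 * expR ((cabs w + 2) ^+ 2)))) => // h h1.
pose Q x := cexp (w * x%:C) * (cexp (h * x%:C) - 1 - h * x%:C
   - 2^-1 * (h * x%:C) ^+ 2).
have mhx : cmeasurable (fun x => h * x%:C).
  by apply: cmeasurableM; [exact: cmeasurable_cst | exact: cmeasurable_real].
(* 48 is the constant 8 of [cexp_taylor3] times 3!, from |x|^3 <= 3! exp |x|. This bound and exp
   (|h| |x|) each add 1 to the rate [cabs w]. *)
have [] := W Q (48 * cabs h ^+ 3) (cabs w + 2).
- apply: cmeasurableM => //.
  rewrite (_ : (fun x => _) = (fun x => cexp (h * x%:C) + -1 + -1 * (h * x%:C)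
    + (- 2^-1) * ((h * x%:C) * (h * x%:C)))); last first.
    by apply/funext => x; ring.
  apply: cmeasurableD; last first.
    by apply: cmeasurableM; [exact: cmeasurable_cst | exact: cmeasurableM].
  apply: cmeasurableD; last first.
    by apply: cmeasurableM; [exact: cmeasurable_cst | exact: mhx].
  apply: cmeasurableD; [exact: cmeasurable_cexp | exact: cmeasurable_cst].
- by rewrite mulr_ge0// exprn_ge0// cabs_ge0.
- by rewrite addr_ge0 ?cabs_ge0.
- move=> x; rewrite cabsM.
  have := cexp_taylor3 (h * x%:C); rewrite [in X in _ <= X]cabsM cabs_real => T3.
  apply: le_trans (ler_pM (cabs_ge0 _) (cabs_ge0 _) (cabs_expline w x) T3) _.
  have hx : cabs h * `|x| <= `|x| by rewrite ler_piMl.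
  have x3 := xe 3%N x; rewrite cabsX cabs_real in x3.
  rewrite exprMn.
  have -> : expR (cabs w * `|x|) * (8 * (cabs h ^+ 3 * `|x| ^+ 3 *
      expR (cabs h * `|x|))) = 8 * cabs h ^+ 3 *
      (`|x| ^+ 3 * expR (cabs h * `|x|) * expR (cabs w * `|x|)) by ring.
  have -> : 48 * cabs h ^+ 3 * expR ((cabs w + 2) * `|x|) =
    8 * cabs h ^+ 3 * (3`!%:R * expR `|x| * expR `|x| * expR (cabs w * `|x|)).
    by rewrite (_ : (cabs w + 2) * `|x| = `|x| + `|x| + cabs w * `|x|) ?expRD;
      [rewrite (_ : 3`!%:R = 6 :> R)//; ring | ring].
  rewrite ler_wpM2l ?mulr_ge0 ?exprn_ge0 ?cabs_ge0//.
  rewrite ler_wpM2r ?expR_ge0//.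
  by apply: ler_pM; rewrite ?exprn_ge0 ?expR_ge0// ler_expR.
move=> iQ bQ.
have -> : gtransform f (w + h) - gtransform f w - I 1%N * h
   - 2^-1 * I 2%N * h ^+ 2 = cintegral (fun x => f x * gweight x * Q x).
  have -> : gtransform f (w + h) = cintegral (fun x => f x * gweight x * P 0%N x
     + (h * (f x * gweight x * P 1%N x) + (2^-1 * h ^+ 2 * (f x * gweight x * P 2%N x)
       + f x * gweight x * Q x))).
    congr cintegral; apply/funext => x.
    by rewrite mulrDl cexpD /P /Q expr0 expr1; ring.
  rewrite cintegralD//; last first.
    by repeat (apply: cintegrableD || apply: cintegrableZ || exact: PW || exact: iQ).
  rewrite cintegralD//; last first.
    by repeat (apply: cintegrableD || apply: cintegrableZ || exact: PW || exact: iQ).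
    exact: cintegrableZ.
  rewrite cintegralD//; last exact: cintegrableZ.
  rewrite !cintegralZ// -!/(I _).
  have -> : I 0%N = gtransform f w.
    by congr cintegral; apply/funext => x; rewrite /P expr0 mul1r.
  ring.
apply: le_trans bQ _; rewrite le_eqVlt; apply/orP; left; apply/eqP; ring.
Qed.

(** Completing the square in - (1 + a) x^2 / 2 + x Re w leaves a Gaussian of fixed mass and the
    exponent on the right. *)
Lemma gtransform_bound f (a C : R) : cmeasurable f -> 0 <= C -> 0 <= a ->
  {ae mu, forall x, cabs (f x) <= C * expR (- (a * x ^+ 2) / 2)} ->
  exists2 K : R, 0 <= K &
    forall w, cabs (gtransform f w) <= K * expR (Re w ^+ 2 / (2 * (1 + a))).
Proof.
move=> mf C0 a0 fC.
have a1 : 0 < 1 + a by rewrite ltr_wpDr.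
have [G [G0 H]] := @gaussian_integral R ((1 + a) / 2) ltac:(by rewrite divr_gt0).
exists (2 * (C * G)); first by rewrite !mulr_ge0// ltW.
move=> w; have [iG eG] := H (Re w / (1 + a)).
pose D := C * expR (Re w ^+ 2 / (2 * (1 + a))).
have D0 : 0 <= D by rewrite mulr_ge0 ?expR_ge0.
have := @cintegral_dominated R (fun x => f x * gweight x * cexp (w * x%:C))
   (fun x => D * expR (- ((1 + a) / 2 * (x - Re w / (1 + a)) ^+ 2))).
case.
- apply: cmeasurableM; last exact: cmeasurable_expline.
  by apply: cmeasurableM => //; exact: cmeasurable_gweight.
- by move=> x; rewrite mulr_ge0// expR_ge0.
- exact: (integrableZl measurableT D iG).
- move: fC; apply: ae_mono => x fx.
  rewrite cabsM (cabsM (f x)) cabs_gweight cabs_cexp.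
  apply: le_trans (_ : C * expR (- (a * x ^+ 2) / 2) * expR (- x ^+ 2 / 2) *
     expR (Re (w * x%:C)) <= _).
    by rewrite ler_wpM2r ?expR_ge0// ler_wpM2r ?expR_ge0.
  rewrite /D -!mulrA ler_wpM2l// -!expRD ler_expR ReM /= mulr0 subr0.
  rewrite le_eqVlt; apply/orP; left; apply/eqP; field.
  by rewrite gt_eqF.
move=> _ bb; apply: le_trans bb _.
rewrite RintegralZl// eG /D le_eqVlt; apply/orP; left; apply/eqP; ring.
Qed.

(** The function F of the overview, with exp (- t^2) taken out of the integral; up to a constant and
    a scaling of [t] it is the Bargmann transform of [f]. *)
Definition gen_transform f t : R[i] := cexp (- t ^+ 2) * gtransform f (2 * t).

Lemma gen_transform_jet2 f (C : R) t : cmeasurable f -> 0 <= C ->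
  {ae mu, forall x, cabs (f x) <= C} -> jet2 (gen_transform f) t.
Proof.
move=> mf C0 fC; apply: jet2M.
  rewrite (_ : (fun t => _) = (fun t => cexp (-1 * (t * t)))); last first.
    by apply/funext => u; rewrite mulN1r.
  apply: (@jet2_comp _ (@cexp R)); first exact: jet2_cexp.
  apply: jet2M; first exact: jet2_cst.
  by apply: jet2M; exact: jet2_id.
apply: (@jet2_comp _ (gtransform f) (fun u => 2 * u)).
  exact: gtransform_jet2 fC.
by apply: jet2M; [exact: jet2_cst | exact: jet2_id].
Qed.

(** The Taylor coefficients of [gen_transform f] at 0. *)
Definition gen_coef f n : R[i] :=
  cintegral (fun x => f x * gweight x * (hermite_coef n x)%:C).

Lemma cmeasurable_hermite_coef n : cmeasurable (fun x => (@hermite_coef R n x)%:C).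
Proof.
apply: cmeasurable_real; apply: measurable_funM => //.
exact: measurable_hermite.
Qed.

Lemma gen_coef_integrable f (C : R) n : cmeasurable f -> 0 <= C ->
  {ae mu, forall x, cabs (f x) <= C} ->
  cintegrable (fun x => f x * gweight x * (hermite_coef n x)%:C).
Proof.
move=> mf C0 fC; have [G [_ H]] := weighted_integral.
have [] // := H f (fun x => (hermite_coef n x)%:C) C (expR 1) 2 mf C0 fC.
- exact: cmeasurable_hermite_coef.
- move=> x; rewrite cabs_real.
  have := hermite_coef_bound n x (ler01); rewrite !expr1n !mulr1.
  by rewrite addrC expRD.
Qed.

(** The truncation error of the generating function grows only exponentially in |x|, so it can be
    integrated against [f] and the weight, and its factor 2^-N is kept. *)
Lemma gen_transform_approx f (C r : R) : cmeasurable f -> 0 <= C ->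
  {ae mu, forall x, cabs (f x) <= C} -> 0 <= r ->
  exists A : R, forall N t, cabs t = r ->
  cabs (\sum_(0 <= m < N.+2) gen_coef f m * t ^+ m - gen_transform f t)
    <= A / 2 ^+ N.
Proof.
move=> mf C0 fC r0; have [G [G0 H]] := weighted_integral.
have [A [B [B0 ap]]] := @hermite_gen_approx R r r0.
exists (G * (C * expR A * expR (B ^+ 2))) => N t tr.
have mg : cmeasurable (fun x => hermite_gen x t).
  apply: cmeasurable_cexp; apply: cmeasurableD; last exact: cmeasurable_cst.
  apply: cmeasurableM; last exact: cmeasurable_cst.
  by apply: cmeasurable_real; exact: measurable_funM.
pose p x : R[i] := \sum_(0 <= m < N.+2) (hermite_coef m x)%:C * t ^+ m
   + -1 * hermite_gen x t.
have [] := H f p C (expR A / 2 ^+ N) B mf C0 fC.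
- apply: cmeasurableD; last by apply: cmeasurableM => //; exact: cmeasurable_cst.
  apply: (@cmeasurable_sum _ _ (fun m x => (hermite_coef m x)%:C * t ^+ m)) => m.
  apply: cmeasurableM; last exact: cmeasurable_cst.
  exact: cmeasurable_hermite_coef.
- by rewrite divr_ge0 ?expR_ge0// exprn_ge0.
- exact: B0.
- move=> x; rewrite /p mulN1r; apply: le_trans (ap N x t _) _; first by rewrite tr.
  by rewrite expRD mulrAC.
move=> _ bb; rewrite [leRHS](_ : _ = G * (C * (expR A / 2 ^+ N) * expR (B ^+ 2))); last ring.
apply: le_trans bb; rewrite le_eqVlt; apply/orP; left; apply/eqP; congr cabs.
have genE : (fun x => f x * gweight x * hermite_gen x t) =
    (fun x => cexp (- t ^+ 2) * (f x * gweight x * cexp (2 * t * x%:C))).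
  apply/funext => x; rewrite /hermite_gen rcM rc_nat addrC cexpD.
  by rewrite (_ : 2 * x%:C * t = 2 * t * x%:C); ring.
have ig : cintegrable (fun x => f x * gweight x * hermite_gen x t).
  by rewrite genE; apply: cintegrableZ; exact: gtransform_integrable fC.
have [is1 is2] := @cintegral_sum R N.+2
   (fun m x => t ^+ m * (f x * gweight x * (hermite_coef m x)%:C))
   (fun m => cintegrableZ _ (gen_coef_integrable m mf C0 fC)).
have -> : cintegral (fun x => f x * gweight x * p x) =
  cintegral (fun x => \sum_(0 <= m < N.+2) t ^+ m *
     (f x * gweight x * (hermite_coef m x)%:C)
     + -1 * (f x * gweight x * hermite_gen x t)).
  congr cintegral; apply/funext => x; rewrite /p mulrDr; congr (_ + _); last ring.
  by rewrite big_distrr/=; apply: eq_bigr => m _; ring.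
rewrite cintegralD//; last exact: cintegrableZ.
rewrite is2 cintegralZ// mulN1r genE cintegralZ; last exact: gtransform_integrable fC.
congr (_ - _); apply: eq_bigr => m _.
rewrite cintegralZ; last exact: gen_coef_integrable fC.
by rewrite [RHS]mulrC.
Qed.

End GaussianTransform.

(** * Fourier transforms and Gaussians *)

Section GaussianFourier.
Variable R : realType.
Implicit Types (f : R -> R[i]) (h g : R -> R) (w : R[i]) (x s : R).
Local Notation mu := (@lebesgue_measure R).

Lemma integral_shift_ge0 (G : R -> R) s : continuous G -> (forall x, 0 <= G x) ->
  (\int[mu]_x (G x)%:E = \int[mu]_x (G (x + s))%:E)%E.
Proof.
move=> cG G0.
have F' : (fun x : R => x + s)^`()%classic = cst 1.
  apply/funext => x; rewrite derive1E.
  have d : is_derive x 1 (fun x : R => x + s) 1.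
    by apply: is_derive_eq; rewrite addr0.
  by rewrite derive_val.
rewrite (@increasing_ge0_integration_by_substitutionT R (fun x => x + s) G) ?F'//.
- by apply: eq_integral => x _ /=; rewrite mulr1.
- by move=> x y xy; rewrite ltrD2r.
- by move=> x; exact: cvg_cst.
- exact: is_cvg_cst.
- exact: is_cvg_cst.
- exact: cvg_addrr_Ny.
- exact: cvg_addrr.
Qed.

(** Adding the dominating function [g] makes the integrand nonnegative; the shift is then applied to
    [h + g] and to [g], and the latter subtracted. *)
Lemma Rintegral_shift h g s : continuous h -> continuous g ->
  (forall x, `|h x| <= g x) -> mu.-integrable setT (EFin \o g) ->
  mu.-integrable setT (EFin \o (fun x => g (x + s))) ->
  \int[mu]_x h x = \int[mu]_x h (x + s).
Proof.
move=> ch cg hg ig igs.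
have g0 x : 0 <= g x by exact: le_trans (hg x).
have mh : measurable_fun setT h by exact: continuous_measurable_fun.
have mhs : measurable_fun setT (fun x => h (x + s)).
  by apply: measurableT_comp => //; exact: measurable_funD.
have [ih _] := integrable_ae_dominated mh g0 ig (ae_all hg).
have [ihs _] := integrable_ae_dominated mhs (fun x => g0 (x + s)) igs
  (ae_all (fun x => hg (x + s))).
have e1 : \int[mu]_x g x = \int[mu]_x g (x + s).
  by rewrite /Rintegral (@integral_shift_ge0 g s).
have e2 : \int[mu]_x (h x + g x) = \int[mu]_x (h (x + s) + g (x + s)).
  rewrite /Rintegral (@integral_shift_ge0 (fun x => h x + g x) s)//.
    by move=> x; apply: cvgD; [exact: ch | exact: cg].
  by move=> x; have := hg x; rewrite ler_norml; lra.
rewrite RintegralD// in e2; rewrite RintegralD// in e2.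
by apply: (addIr (\int[mu]_x g x)); rewrite e2 e1.
Qed.

Definition gkernel w x : R[i] := cexp (- 2^-1 * (x%:C - w) ^+ 2).

Lemma gkernel_shift w x s : gkernel w (x - s) = gkernel (w + s%:C) x.
Proof. by congr cexp; rewrite rcB; ring. Qed.

Lemma gkernelE w x :
  gkernel w x = cexp (- 2^-1 * w ^+ 2) * (gweight x * cexp (w * x%:C)).
Proof.
rewrite /gweight -cexp_real -!cexpD; congr cexp.
have -> : (- x ^+ 2 / 2)%:C = - 2^-1 * x%:C ^+ 2 :> R[i].
  by rewrite (_ : - x ^+ 2 / 2 = - (2^-1 * (x * x))); [
    rewrite rcN !rcM rcV rc_nat; ring | field].
by field.
Qed.

Lemma cabs_gkernel w x : cabs (gkernel w x) =
  expR (Im w ^+ 2 / 2) * expR (- (2^-1 * (x - Re w) ^+ 2)).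
Proof.
rewrite gkernelE cabsM (cabsM (gweight x)) !cabs_cexp cabs_gweight -!expRD; congr expR.
have -> : Re (- 2^-1 * w ^+ 2) = - 2^-1 * (Re w ^+ 2 - Im w ^+ 2).
  have -> : - 2^-1 = (- 2^-1)%:C :> R[i].
    by rewrite rcN rcV rc_nat.
  by rewrite expr2 ReM ReM ImM /=; ring.
by rewrite ReM /=; field.
Qed.

Lemma gkernel_continuous w : continuous (fun x => Re (gkernel w x)) /\
  continuous (fun x => Im (gkernel w x)).
Proof.
have D x : exists a, path_derive (gkernel w) x a.
  eexists; apply: path_derive_cexp; apply: path_deriveM (path_derive_cst _ x) _.
  apply: path_deriveX; exact: path_deriveD (path_derive_id x) (path_derive_cst (- w) x).
split=> x; have [a [dr di]] := D x.
- apply: differentiable_continuous; apply/derivable1_diffP; by case: dr.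
- apply: differentiable_continuous; apply/derivable1_diffP; by case: di.
Qed.

Lemma cintegral_gkernel_shift w s :
  cintegral (gkernel (w + s%:C)) = cintegral (gkernel w).
Proof.
have [cr ci] := gkernel_continuous w.
have [G [G0 H]] := @gaussian_integral R 2^-1 ltac:(by rewrite invr_gt0).
pose D := expR (Im w ^+ 2 / 2).
pose g x := D * expR (- (2^-1 * (x - Re w) ^+ 2)).
have ig : mu.-integrable setT (EFin \o g).
  exact: (integrableZl measurableT D (H (Re w)).1).
have igs : mu.-integrable setT (EFin \o (fun x => g (x + - s))).
  rewrite (_ : (fun x => g (x + - s)) =
     (fun x => D * expR (- (2^-1 * (x - (Re w + s)) ^+ 2)))).
    exact: (integrableZl measurableT D (H (Re w + s)).1).
  by apply/funext => x; rewrite /g; congr (_ * expR _); ring.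
have cg : continuous g.
  rewrite (_ : g = (fun x => D * Re (gkernel (Re w)%:C x))).
    by move=> x; apply: cvgM; [exact: cvg_cst | exact: (gkernel_continuous _).1].
  apply/funext => x; rewrite /g /gkernel; congr (_ * _).
  have -> : - 2^-1 * (x%:C - (Re w)%:C) ^+ 2 = (- (2^-1 * (x - Re w) ^+ 2))%:C :> R[i].
    by rewrite rcN rcM rcV rc_nat expr2 rcM rcB; ring.
  by rewrite cexp_real.
apply: complex_eq.
- change (\int[mu]_x Re (gkernel (w + s%:C) x) = \int[mu]_x Re (gkernel w x)).
  rewrite [RHS](@Rintegral_shift _ g (- s))//.
    by apply: eq_Rintegral => x _; rewrite -gkernel_shift.
  by move=> x; apply: le_trans (normr_Re_le _) _; rewrite cabs_gkernel.
- change (\int[mu]_x Im (gkernel (w + s%:C) x) = \int[mu]_x Im (gkernel w x)).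
  rewrite [RHS](@Rintegral_shift _ g (- s))//.
    by apply: eq_Rintegral => x _; rewrite -gkernel_shift.
  by move=> x; apply: le_trans (normr_Im_le _) _; rewrite cabs_gkernel.
Qed.

Lemma is_derive_quadratic h x (d K : R) : 0 < d ->
  (forall e, `|e| <= d -> `|h (x + e) - h x| <= K * e ^+ 2) ->
  is_derive x 1 h 0.
Proof.
move=> d0 H; apply/is_derive1_caratheodory.
(* At [y = x] this quotient is 0 by the convention for division, which is the derivative claimed. *)
exists (fun y => (h y - h x) / (y - x)); split.
- move=> y; have [->|yx] := eqVneq y x; first by rewrite !subrr mulr0.
  by rewrite divfK// subr_eq0.
- apply/cvgrPdist_le => /= e e0.
  pose K1 := `|K| + 1; have K10 : 0 < K1 by rewrite ltr_wpDl.
  pose dd := Num.min d (e / K1).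
  have dd0 : 0 < dd by rewrite lt_min d0 divr_gt0.
  have : nbhs x (ball x dd) by exact: nbhsx_ballx.
  apply: filterS => y; rewrite /ball /= => xy.
  rewrite subrr mul0r sub0r normrN normrM normfV.
  have [->|yx] := eqVneq y x; first by rewrite subrr normr0 mul0r ltW.
  have yx0 : 0 < `|y - x| by rewrite normr_gt0 subr_eq0.
  have yxd : `|y - x| <= dd by rewrite distrC ltW.
  rewrite ler_pdivrMr//.
  have := H (y - x); rewrite addrCA subrr addr0 => /(_ _).
  have -> : `|y - x| <= d by apply: le_trans yxd _; rewrite ge_min lexx.
  move=> /(_ isT) /le_trans; apply.
  rewrite -[(y - x) ^+ 2]real_normK ?num_real// expr2 mulrA ler_wpM2r//.
  apply: le_trans (_ : K1 * `|y - x| <= _).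
    rewrite ler_wpM2r// (le_trans (ler_norm _))// lerDl//.
  rewrite mulrC -ler_pdivlMr//; apply: le_trans yxd _.
  by rewrite ge_min lexx orbT.
- by rewrite !subrr mul0r.
Qed.

Lemma gkernel_gtransform w :
  cintegral (gkernel w) = cexp (- 2^-1 * w ^+ 2) * gtransform (fun=> 1) w.
Proof.
have one1 : {ae mu, forall x, cabs ((fun=> 1 : R[i]) x) <= 1}.
  by apply: ae_all => x; rewrite cabs1.
rewrite -cintegralZ.
  by congr cintegral; apply/funext => x; rewrite gkernelE mul1r.
by apply: (gtransform_integrable w _ ler01 one1); exact: cmeasurable_cst.
Qed.

(* [w |-> cintegral (gkernel w)] is analytic and invariant under real
   translations, so its complex derivative vanishes. *)
Lemma cintegral_gkernel w : cintegral (gkernel w) = cintegral (gkernel 0).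
Proof.
pose J w := cintegral (gkernel w).
have Jj z : jet2 J z.
  rewrite (_ : J = (fun w => cexp (- 2^-1 * (w * w)) * gtransform (fun=> 1) w)).
    apply: jet2M.
      apply: (@jet2_comp _ (@cexp R)); first exact: jet2_cexp.
      by apply: jet2M; [exact: jet2_cst | apply: jet2M; exact: jet2_id].
    apply: (@gtransform_jet2 _ _ 1); [exact: cmeasurable_cst | by [] |].
    by apply: ae_all => x; rewrite cabs1.
  by apply/funext => z'; rewrite /J gkernel_gtransform.
have inc z : exists d K : R, 0 < d /\ forall e, cabs e <= d ->
    cabs (J (z + e) - J z) <= K * cabs e ^+ 2.
  have [b [c [r [Br E]]]] := Jj z.
  have [d [K [d0 H]]] : bounded_near0 (fun e => c + r e * e).
    by repeat (apply: bounded_near0D || apply: bounded_near0M || exact: Br ||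
      exact: bounded_near0_id || exact: bounded_near0_cst).
  (* [J] does not change under real increments, so b x is of order x^2 for small real x. *)
  have b0 : b = 0.
    apply: cabs0_eq0; apply/eqP; rewrite eq_le cabs_ge0 andbT.
    apply/ler_addgt0Pr => e e0; rewrite add0r.
    have K0 : 0 <= K by apply: le_trans (cabs_ge0 _) (H 0 _); rewrite cabs0 ltW.
    pose x := Num.min d (e / (K + 1)).
    have x0 : 0 < x by rewrite lt_min d0 divr_gt0// ltr_wpDl.
    have cx : cabs (x%:C : R[i]) = x by rewrite cabs_real gtr0_norm.
    have := E x%:C; rewrite /J cintegral_gkernel_shift -/(J z) => EE.
    have : b * x%:C = - (c + r x%:C * x%:C) * x%:C * x%:C.
      apply: (addrI (J z)); rewrite [LHS](_ : _ =
        (J z + b * x%:C + c * x%:C ^+ 2 + r x%:C * x%:C ^+ 3)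
        - (c + r x%:C * x%:C) * x%:C * x%:C); last ring.
      by rewrite -EE; ring.
    move=> /(congr1 (@cabs R)); rewrite !cabsM cabsN cx => /(mulIf _) ->.
      apply: le_trans (_ : K * x <= _).
        by rewrite ler_wpM2r ?(ltW x0)// H// cx ge_min lexx.
      apply: le_trans (_ : (K + 1) * x <= _); first by rewrite ler_wpM2r ?(ltW x0)// lerDl.
      by rewrite mulrC -ler_pdivlMr ?ltr_wpDl// ge_min lexx orbT.
    by rewrite gt_eqF.
  exists d, K; split=> // e ed.
  have -> : J (z + e) - J z = (c + r e * e) * e ^+ 2 by rewrite E b0; ring.
  by rewrite cabsM cabsX ler_wpM2r ?exprn_ge0 ?cabs_ge0// H.
have -> : w = (0 +i* Im w) + (Re w)%:C by case: (w) => u v; apply: complex_eq; rewrite ?ReD ?ImD /=; ring.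
rewrite cintegral_gkernel_shift.
have dJ (y : R) : is_derive y 1 (fun y : R => Re (J (0 +i* y))) 0 /\
            is_derive y 1 (fun y : R => Im (J (0 +i* y))) 0.
  have [d [K [d0 H]]] := inc (0 +i* y).
  have H' e : `|e| <= d -> cabs (J (0 +i* (y + e)) - J (0 +i* y)) <= K * e ^+ 2.
    have ce : cabs (0 +i* e : R[i]) = `|e|.
      by rewrite /cabs /= expr0n add0r sqrtr_sqr.
    have -> : 0 +i* (y + e) = (0 +i* y) + (0 +i* e) :> R[i].
      by apply: complex_eq; rewrite ?ReD ?ImD /=; ring.
    by move=> ed; rewrite -[e ^+ 2]real_normK ?num_real// -ce; apply: H; rewrite ce.
  split; apply: (is_derive_quadratic d0) => e ed; apply: le_trans (H' e ed).
    by rewrite -ReN -ReD; exact: normr_Re_le.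
  by rewrite -ImN -ImD; exact: normr_Im_le.
rewrite -[in RHS](_ : 0 +i* 0 = 0 :> R[i])//.
apply: complex_eq.
  exact: (@is_derive_0_is_cst R (fun y => Re (J (0 +i* y))) (Im w) 0 (fun y => (dJ y).1)).
exact: (@is_derive_0_is_cst R (fun y => Im (J (0 +i* y))) (Im w) 0 (fun y => (dJ y).2)).
Qed.

(** The Gaussian integral is carried unevaluated, as a nonzero constant that can be divided out. *)
Definition gauss_const : R[i] := cintegral (gkernel 0).

Lemma gauss_const_neq0 : gauss_const != 0.
Proof.
have [G [G0 H]] := @gaussian_integral R 2^-1 ltac:(by rewrite invr_gt0).
apply/eqP => E.
have : \int[mu]_x expR (- (2^-1 * (x - 0) ^+ 2)) = 0.
  transitivity (Re gauss_const); last by rewrite E.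
  apply: eq_Rintegral => x _.
  rewrite gkernelE expr0n !mulr0 mul0r cexp0 mul1r mulr1 /=.
  by congr expR; field.
by rewrite (H 0).2 => G00; move: G0; rewrite G00 ltxx.
Qed.

Lemma gtransform1 w : gtransform (fun=> 1) w = gauss_const * cexp (2^-1 * w ^+ 2).
Proof.
rewrite /gauss_const -(cintegral_gkernel w) gkernel_gtransform mulrAC -cexpD.
by rewrite (_ : _ + _ = 0) ?cexp0 ?mul1r//; ring.
Qed.

(** Domination by a product of integrable functions makes both components of [k] integrable on the
    plane. The measurability of the inner integral serves to show that [fourier f] is measurable. *)
Lemma fubini_complex (k : R -> R -> R[i]) (g1 g2 : R -> R) :
  complex_measurable (fun z : R * R => k z.1 z.2) ->
  (forall x, 0 <= g1 x) -> (forall x, 0 <= g2 x) ->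
  mu.-integrable setT (EFin \o g1) -> mu.-integrable setT (EFin \o g2) ->
  (forall x y, cabs (k x y) <= g1 x * g2 y) ->
  cmeasurable (fun y => cintegral (fun x => k x y)) /\
  cintegral (fun x => cintegral (k x)) =
    cintegral (fun y => cintegral (fun x => k x y)).
Proof.
move=> [mr mi] g10 g20 i1 i2 kg.
have main (r : R * R -> R) : measurable_fun setT r ->
    (forall x y, `|r (x, y)| <= g1 x * g2 y) ->
    measurable_fun setT (fun y => \int[mu]_x r (x, y)) /\
    \int[mu]_x \int[mu]_y r (x, y) = \int[mu]_y \int[mu]_x r (x, y).
  move=> mr' rg.
  have m1 : measurable_fun setT g1 by apply/measurable_EFinP; exact: measurable_int i1.
  have m2 : measurable_fun setT g2 by apply/measurable_EFinP; exact: measurable_int i2.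
  have mg : measurable_fun setT (fun z : R * R => g1 z.1 * g2 z.2).
    by apply: measurable_funM; apply: measurableT_comp.
  have ig : (mu \x mu)%E.-integrable setT (EFin \o (fun z : R * R => g1 z.1 * g2 z.2)).
    apply/integrable12ltyP; first exact/measurable_EFinP.
    apply: (@le_lt_trans _ _ (\int[mu]_x (\int[mu]_y (g2 y)%:E * (g1 x)%:E))%E).
      rewrite le_eqVlt; apply/orP; left; apply/eqP; apply: eq_integral => x _.
      rewrite -ge0_integralZr//.
      - apply: eq_integral => y _ /=.
        by rewrite ger0_norm ?mulr_ge0// mulrC EFinM.
      - exact/measurable_EFinP.
      - by move=> y _; rewrite lee_fin.
      - by rewrite lee_fin.
    rewrite ge0_integralZl//; last 3 first.
    - exact/measurable_EFinP.
    - by move=> x _; rewrite lee_fin.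
    - by apply: integral_ge0 => y _; rewrite lee_fin.
    have f1 := integrable_fin_num measurableT i1.
    have f2 := integrable_fin_num measurableT i2.
    by rewrite ltey_eq fin_numM.
  have ir : (mu \x mu)%E.-integrable setT (EFin \o r).
    apply: le_integrable ig => //; first exact/measurable_EFinP.
    move=> [x y] _ /=; rewrite lee_fin.
    exact: le_trans (rg x y) (ler_norm _).
  have ix x : mu.-integrable setT (EFin \o (fun y => r (x, y))).
    have [] // := @integrable_ae_dominated R (fun y => r (x, y)) (fun y => g1 x * g2 y).
    - by apply: measurableT_comp => //; exact: measurable_pair1.
    - by move=> y; rewrite mulr_ge0.
    - exact: (integrableZl measurableT (g1 x) i2).
    - by apply: ae_all => y; exact: rg.
  have iy y : mu.-integrable setT (EFin \o (fun x => r (x, y))).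
    have [] // := @integrable_ae_dominated R (fun x => r (x, y)) (fun x => g2 y * g1 x).
    - by apply: measurableT_comp => //; exact: measurable_pair2.
    - by move=> x; rewrite mulr_ge0.
    - exact: (integrableZl measurableT (g2 y) i1).
    - by apply: ae_all => x; rewrite mulrC; exact: rg.
  split.
    apply/measurable_EFinP.
    rewrite (_ : EFin \o _ = fubini_G mu (EFin \o r)); last first.
      apply/funext => y /=; rewrite /fubini_G /Rintegral fineK//.
      exact: integrable_fin_num (iy y).
    exact: measurable_fubini_G ir.
  rewrite /Rintegral; congr fine.
  under eq_integral do rewrite fineK ?(integrable_fin_num measurableT (ix _))//.
  under [RHS]eq_integral do rewrite fineK ?(integrable_fin_num measurableT (iy _))//.
  exact: (Fubini ir).
have [mR eR] := main _ mr (fun x y => le_trans (normr_Re_le (k x y)) (kg x y)).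
have [mI eI] := main _ mi (fun x y => le_trans (normr_Im_le (k x y)) (kg x y)).
by split; [split | apply: complex_eq].
Qed.

(* [gauss_const * expR (- x ^+ 2 / 2)] is itself a Gaussian integral, so Fubini
   moves the Fourier transform from the Gaussian to [f]. *)
Lemma fourier_gtransform f (C : R) : cintegrable f -> 0 <= C ->
  {ae mu, forall x, cabs (f x) <= C} ->
  cmeasurable (fourier f) /\ forall w,
  gauss_const * gtransform f w = (Num.sqrt (2 * pi))%:C *
    (cexp (2^-1 * w ^+ 2) * gtransform (fourier f) ('i%C * w)).
Proof.
move=> fint C0 fC.
have mf := cintegrable_measurable fint.
have [G [G0 H]] := @gaussian_integral R 4^-1 ltac:(by rewrite invr_gt0).
(* Integrated over [x], this is a multiple of [fourier f y] times the weight and the exponential;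
   integrated over [y], with i w in place of [w], it is [f x] times a Gaussian in [x] with centre
   [w]. *)
pose k w x y := f x * (gweight y * cexp (w * y%:C) * cexpi (- (y * x))).
have s0 : Num.sqrt (2 * pi) != 0 :> R.
  by rewrite gt_eqF// sqrtr_gt0 mulr_gt0// pi_gt0.
have icabs : mu.-integrable setT (EFin \o (fun x => cabs (f x))).
  have [fr fi] := fint.
  apply: (@le_integrable _ _ _ mu setT measurableT _
    (fun x => `|(Re (f x))%:E| + `|(Im (f x))%:E|)%E).
  - by apply/measurable_EFinP; exact: measurable_cabs.
  - move=> x _ /=; rewrite lee_fin ger0_norm ?cabs_ge0//.
    by rewrite [leRHS]ger0_norm ?addr_ge0// cabs_le_ReIm.
  - by apply: integrableD => //; exact: integrable_abse.
have icx y : cintegrable (fun x => f x * cexpi (- (y * x))) /\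
    cabs (cintegral (fun x => f x * cexpi (- (y * x)))) <= 2 * \int[mu]_x cabs (f x).
  have [fr fi] := fint.
  apply: (@cintegral_dominated R (fun x => f x * cexpi (- (y * x)))
    (fun x => cabs (f x))).
  - apply: cmeasurableM => //.
    rewrite (_ : (fun x => _) = (fun x => cexp ((- (y * x))%:C * 'i%C))); last first.
      by apply/funext => x; rewrite cexpi_cexp.
    apply: cmeasurable_cexp; apply: cmeasurableM; last exact: cmeasurable_cst.
    by apply: cmeasurable_real; apply: measurableT_comp => //; exact: measurable_funM.
  - by move=> x; exact: cabs_ge0.
  - exact: icabs.
  - by apply: ae_all => x; rewrite cabsM cabs_cexpi mulr1.
have fub w := @fubini_complex (k w) (fun x => cabs (f x))
  (fun y => expR (cabs w ^+ 2) * expR (- (4^-1 * (y - 0) ^+ 2))).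
have fourE w y : cintegral (fun x => k w x y) =
    (Num.sqrt (2 * pi))%:C * (fourier f y * gweight y * cexp (w * y%:C)).
  rewrite /fourier.
  have -> : cintegral (fun x => k w x y) =
     (gweight y * cexp (w * y%:C)) * cintegral (fun x => f x * cexpi (- (y * x))).
    rewrite -cintegralZ; last exact: (icx y).1.
    by congr cintegral; apply/funext => x; rewrite /k; ring.
  set I := cintegral _.
  have -> : (Num.sqrt (2 * pi))%:C * ((Num.sqrt (2 * pi))^-1%:C * I * gweight y *
     cexp (w * y%:C)) = (Num.sqrt (2 * pi) * (Num.sqrt (2 * pi))^-1)%:C *
        (gweight y * cexp (w * y%:C) * I) by rewrite rcM; ring.
  by rewrite mulfV// mul1r.
have {}fub w : cmeasurable (fun y => cintegral (fun x => k w x y)) /\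
    cintegral (fun x => cintegral (k w x)) =
    cintegral (fun y => cintegral (fun x => k w x y)).
  apply: fub.
  - apply: complex_measurableM.
      have [mr mi] := mf; split; first exact: (measurableT_comp mr).
      exact: (measurableT_comp mi).
    apply: complex_measurableM.
      have [mr mi] : cmeasurable (fun y => gweight y * cexp (w * y%:C)).
        apply: cmeasurableM; first exact: cmeasurable_gweight.
        exact: cmeasurable_expline.
      split; first exact: (measurableT_comp mr).
      exact: (measurableT_comp mi).
    rewrite (_ : (fun x : R * R => _) = (fun z : R * R => cexp ((- (z.2 * z.1))%:C * 'i%C))); last first.
      by apply/funext => x; rewrite cexpi_cexp.
    apply: complex_measurable_cexp; apply: complex_measurableM; last exact: complex_measurable_cst.
    apply: complex_measurable_real; apply: measurableT_comp => //.
    by apply: measurable_funM.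
  - by move=> x; exact: cabs_ge0.
  - by move=> y; rewrite mulr_ge0 ?expR_ge0.
  - exact: icabs.
  - exact: (integrableZl measurableT _ (H 0).1).
  - move=> x y; rewrite /k cabsM ler_wpM2l ?cabs_ge0// (cabsM (_ * _)) cabs_cexpi mulr1.
    rewrite cabsM cabs_gweight; apply: le_trans (ler_wpM2l (expR_ge0 _) (cabs_expline _ _)) _.
    rewrite -!expRD ler_expR subr0.
    have : 0 <= (`|y| / 2 - cabs w) ^+ 2 by exact: sqr_ge0.
    have : `|y| ^+ 2 = y ^+ 2 by rewrite real_normK ?num_real.
    lra.
(* At [w = 0] the inner integral is [fourier f] times a positive weight, which is divided out. *)
have mF : cmeasurable (fourier f).
  have [m0 _] := fub 0.
  rewrite (_ : fourier f = (fun y => ((Num.sqrt (2 * pi))^-1)%:C *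
     ((expR (y ^+ 2 / 2))%:C * cintegral (fun x => k 0 x y)))).
    apply: cmeasurableM; first exact: cmeasurable_cst.
    apply: cmeasurableM => //; apply: cmeasurable_real.
    by apply: measurableT_comp => //; exact: measurable_funM.
  apply/funext => y; rewrite fourE mul0r cexp0 mulr1 /gweight.
  have -> : ((Num.sqrt (2 * pi))^-1)%:C * ((expR (y ^+ 2 / 2))%:C *
    ((Num.sqrt (2 * pi))%:C * (fourier f y * (expR (- y ^+ 2 / 2))%:C))) =
    ((Num.sqrt (2 * pi))^-1 * Num.sqrt (2 * pi))%:C *
    (expR (y ^+ 2 / 2) * expR (- y ^+ 2 / 2))%:C * fourier f y by rewrite !rcM; ring.
  by rewrite mulVf// mulNr expRxMexpNx_1 !mul1r.
split=> // w.
have one1 : {ae mu, forall x, cabs ((fun=> 1 : R[i]) x) <= 1}.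
  by apply: ae_all => x; rewrite cabs1.
have inner x : cintegral (k ('i%C * w) x) =
    gauss_const * (cexp (- 2^-1 * w ^+ 2) * (f x * gweight x * cexp (w * x%:C))).
  have -> : k ('i%C * w) x = (fun y =>
     f x * (1 * gweight y * cexp ('i%C * (w - x%:C) * y%:C))).
    apply/funext => y; rewrite /k mul1r; congr (_ * _).
    rewrite cexpi_cexp -[LHS]mulrA -cexpD; congr (_ * cexp _).
    by rewrite rcN rcM; ring.
  rewrite cintegralZ; last first.
    by apply: (gtransform_integrable _ _ ler01 one1); exact: cmeasurable_cst.
  rewrite -/(gtransform (fun=> 1) _) gtransform1.
  have -> : 2^-1 * ('i%C * (w - x%:C)) ^+ 2 = - 2^-1 * (x%:C - w) ^+ 2.
    by rewrite exprMn (expr2 'i%C) sqr_iC; ring.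
  by rewrite -/(gkernel w x) gkernelE; ring.
have [_ fubE] := fub ('i%C * w).
have igf := gtransform_integrable w mf C0 fC.
have fB y : cabs (fourier f y) <= (Num.sqrt (2 * pi))^-1 * (2 * \int[mu]_x cabs (f x)).
  have si : 0 <= (Num.sqrt (2 * pi))^-1 :> R by rewrite invr_ge0 sqrtr_ge0.
  rewrite /fourier cabsM cabs_real (ger0_norm si).
  exact: (ler_wpM2l si (icx y).2).
have I0 : 0 <= (Num.sqrt (2 * pi))^-1 * (2 * \int[mu]_x cabs (f x)).
  exact: le_trans (cabs_ge0 _) (fB 0).
have igF := gtransform_integrable ('i%C * w) mF I0 (ae_all fB).
have eL : cintegral (fun x => cintegral (k ('i%C * w) x)) =
    gauss_const * (cexp (- 2^-1 * w ^+ 2) * gtransform f w).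
  by rewrite (funext inner) (cintegralZ _ (cintegrableZ _ igf)) (cintegralZ _ igf).
have eR : cintegral (fun y => cintegral (fun x => k ('i%C * w) x y)) =
    (Num.sqrt (2 * pi))%:C * gtransform (fourier f) ('i%C * w).
  by rewrite (funext (fourE _)) (cintegralZ _ igF).
rewrite mulrCA -eR -fubE eL.
rewrite [RHS](_ : _ = (cexp (2^-1 * w ^+ 2) * cexp (- 2^-1 * w ^+ 2)) *
  (gauss_const * gtransform f w)); last ring.
by rewrite -cexpD (_ : _ + _ = 0) ?cexp0 ?mul1r//; ring.
Qed.

End GaussianFourier.

(** * Decay of Hermite expansions *)

Section HermiteExpansion.
Variable R : realType.
Implicit Types (f : R -> R[i]) (x y : R) (n N M : nat).
Local Notation mu := (@lebesgue_measure R).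

Lemma exp_add_neq0 y : expR y + expR (- y) != 0 :> R.
Proof. by rewrite gt_eqF// addr_gt0// expR_gt0. Qed.

Lemma tanh_ge0 y : 0 <= y -> 0 <= tanh y.
Proof.
move=> y0; apply: divr_ge0; last by rewrite addr_ge0// expR_ge0.
by rewrite subr_ge0 ler_expR; lra.
Qed.

Lemma one_sub_tanh y : 1 - tanh y = 2 / (expR (2 * y) + 1).
Proof.
have -> : expR (2 * y) = expR y / expR (- y).
  by rewrite -expRB; congr expR; ring.
by rewrite /tanh; field; rewrite exp_add_neq0 gt_eqF ?expR_gt0.
Qed.

(** The origin of k = exp (- 2 beta): it converts the exponents of the Gaussian transform bounds
    into powers of k. *)
Lemma inv_one_add_tanh y : (1 + tanh (2 * y))^-1 = (1 + expR (- 2 * y) ^+ 2) / 2.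
Proof.
have -> : expR (- 2 * y) ^+ 2 = expR (- (2 * y)) / expR (2 * y).
  by rewrite -expRB -expRM_natl; congr expR; ring.
have t0 : expR (2 * y) != 0 by rewrite gt_eqF ?expR_gt0.
have E : 1 + tanh (2 * y) = 2 * expR (2 * y) / (expR (2 * y) + expR (- (2 * y))).
  by rewrite /tanh; field; rewrite exp_add_neq0.
by rewrite E; field; rewrite t0 exp_add_neq0.
Qed.

Lemma E_ae_bounded f (a : R) : 0 <= a -> E a f -> exists C : R,
  [/\ 0 <= C, cmeasurable f & {ae mu, forall x, cabs (f x) <= C}].
Proof.
move=> a0 [fint [C [fC FC]]].
have C0 : 0 <= C.
  by have := le_trans (cabs_ge0 _) (FC 0); rewrite pmulr_lge0// expR_gt0.
exists C; split=> //; first exact: cintegrable_measurable.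
move: fC; apply: ae_mono => x h; apply: le_trans h _.
rewrite ler_piMr// -[leRHS]expR0 ler_expR mulNr oppr_le0 divr_ge0//.
by rewrite mulr_ge0// sqr_ge0.
Qed.

Lemma gen_transform_bound f (beta : R) : 0 < beta -> E (tanh (2 * beta)) f ->
  exists2 C : R, 0 <= C & forall t, cabs (gen_transform f t)
    <= C * expR (expR (- 2 * beta) * cabs t ^+ 2).
Proof.
move=> b0 fE; have [fint [C0 [fC FC]]] := fE.
set a := tanh (2 * beta) in fE fC FC.
have a0 : 0 <= a by apply: tanh_ge0; rewrite mulr_ge0// ltW.
have mf := cintegrable_measurable fint.
have C00 : 0 <= C0.
  by have := le_trans (cabs_ge0 _) (FC 0); rewrite pmulr_lge0// expR_gt0.
have [C1 [C10 _ fC1]] := E_ae_bounded a0 fE.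
have [mF gF] := fourier_gtransform fint C10 fC1.
have [K1 K10 H1] := gtransform_bound mf C00 a0 fC.
have [K2 K20 H2] := gtransform_bound mF C00 a0 (ae_all FC).
(* The first exponent is Re (w^2 / 2), from the factor that accompanies the transform of
   [fourier f]; the second arises because i w has real part - Im w. *)
have [K3 K30 H3] : exists2 K, 0 <= K & forall w, cabs (gtransform f w) <=
    K * (expR ((Re w ^+ 2 - Im w ^+ 2) / 2) * expR (Im w ^+ 2 / (2 * (1 + a)))).
  have g0 : 0 < cabs (@gauss_const R).
    rewrite lt_neqAle cabs_ge0 andbT eq_sym; apply/eqP => /cabs0_eq0 g0.
    by have := @gauss_const_neq0 R; rewrite g0 eqxx.
  exists ((cabs (@gauss_const R))^-1 * (Num.sqrt (2 * pi) * K2)).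
    by rewrite !mulr_ge0 ?invr_ge0 ?cabs_ge0.
  move=> w; have := congr1 (@cabs R) (gF w).
  rewrite (cabsM (gauss_const R)) (cabsM _%:C) (cabsM (cexp _)) cabs_real cabs_cexp.
  rewrite ger0_norm ?sqrtr_ge0// => E.
  have -> : cabs (gtransform f w) = (cabs (@gauss_const R))^-1 *
     (cabs (@gauss_const R) * cabs (gtransform f w)).
    by rewrite mulrA mulVf ?mul1r// gt_eqF.
  rewrite E -!mulrA ler_wpM2l ?invr_ge0 ?cabs_ge0// ler_wpM2l//.
  have -> : Re (2^-1 * w ^+ 2) = (Re w ^+ 2 - Im w ^+ 2) / 2.
    have -> : 2^-1 = (2^-1)%:C :> R[i] by rewrite rcV rc_nat.
    by rewrite expr2 ReM ReM ImM /=; field.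
  rewrite mulrCA ler_wpM2l ?expR_ge0//.
  have := H2 ('i%C * w); have -> : Re ('i%C * w) = - Im w.
    by rewrite ReM /=; ring.
  by rewrite sqrrN expr2 -mulrA.
pose k := expR (- 2 * beta).
have k01 : 0 < k < 1 by rewrite expR_gt0 expR_lt1; lra.
(* Hence v^2 - u^2 + (2 u)^2 / (2 (1 + a)) = k^2 u^2 + v^2, and likewise u^2 + k^2 v^2 for the bound
   from the Fourier side. *)
have ia : (1 + a)^-1 = (1 + k ^+ 2) / 2 by exact: inv_one_add_tanh.
have sq2 u : (2 * u) ^+ 2 / (2 * (1 + a)) = 2 * u ^+ 2 * (1 + a)^-1.
  by field; rewrite gt_eqF// ltr_wpDr.
have gE u v : cabs (gen_transform f (u +i* v)) =
    expR (v ^+ 2 - u ^+ 2) * cabs (gtransform f (2 * (u +i* v))).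
  rewrite /gen_transform cabsM cabs_cexp; congr (expR _ * _).
  by rewrite ReN expr2 ReM /=; ring.
have Re2 u v : Re (2 * (u +i* v) : R[i]) = 2 * u.
  by rewrite -(rc_nat R) ReM /=; ring.
have Im2 u v : Im (2 * (u +i* v) : R[i]) = 2 * v.
  by rewrite -(rc_nat R) ImM /=; ring.
pose K := K1 + K3.
have K0 : 0 <= K by exact: addr_ge0.
exists (K * expR 2); first by rewrite mulr_ge0// expR_ge0.
apply: entire_bound => //.
- by move=> z; exact: gen_transform_jet2 fC1.
- move=> u v; rewrite gE.
  apply: le_trans (ler_wpM2l (expR_ge0 _) (H1 _)) _.
  rewrite Re2 mulrCA; apply: ler_pM; [exact: K10 | | by rewrite lerDl |].
    exact: mulr_ge0 (expR_ge0 _) (expR_ge0 _).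
  rewrite -expRD ler_expR sq2 ia -/k le_eqVlt; apply/orP; left.
  by apply/eqP; field.
- move=> u v; rewrite gE.
  apply: le_trans (ler_wpM2l (expR_ge0 _) (H3 _)) _.
  rewrite Re2 Im2 mulrCA; apply: ler_pM; [exact: K30 | | by rewrite lerDr |].
    by rewrite !mulr_ge0 ?expR_ge0.
  rewrite -!expRD ler_expR sq2 ia -/k le_eqVlt; apply/orP; left.
  by apply/eqP; field.
Qed.

Lemma gen_coef_bound f (beta : R) : 0 < beta -> E (tanh (2 * beta)) f ->
  exists2 C : R, 0 <= C & forall n (r : R), 0 < r ->
    cabs (gen_coef f n) * r ^+ n <= C * expR (expR (- 2 * beta) * r ^+ 2).
Proof.
move=> b0 fE; have [C C0 H] := gen_transform_bound b0 fE.
exists C => // n r r0.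
have t0 : 0 <= tanh (2 * beta) by apply: tanh_ge0; rewrite mulr_ge0// ltW.
have [C1 [C10 mf fC1]] := E_ae_bounded t0 fE.
have [A HA] := gen_transform_approx mf C10 fC1 (ltW r0).
apply: (cauchy_estimate n r0 HA) => t tr.
by rewrite -tr; exact: H.
Qed.

(** On |t| = r with t = u + i v, the exponent of the generating function is 2 x u - 2 u^2 + r^2.
    With A = exp (2 gamma), 2 x u <= x^2 / (A + 1) + (A + 1) u^2 and u^2 <= r^2 bound it by A r^2 +
    x^2 / (A + 1), and 1 / (A + 1) is half of 1 - tanh gamma. *)
Lemma hermite_coef_gauss_bound (gamma : R) n x (r : R) : 0 < gamma -> 0 < r ->
  `|hermite_coef n x| * r ^+ n * expR (- x ^+ 2 / 2) <=
  expR (expR (2 * gamma) * r ^+ 2) * expR (- (tanh gamma * x ^+ 2) / 2).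
Proof.
move=> g0 r0.
pose A := expR (2 * gamma).
have A1 : 1 <= A by rewrite -[leLHS]expR0 ler_expR; lra.
have [A' [B [B0 ap]]] := @hermite_gen_approx R r (ltW r0).
have := @cauchy_estimate R (fun m => (hermite_coef m x)%:C) (hermite_gen x) r
   (expR (A * r ^+ 2 + (1 - tanh gamma) * x ^+ 2 / 2)) (expR (A' + B * `|x|)) n r0.
rewrite cabs_real => main.
apply: le_trans (ler_wpM2r (expR_ge0 _) (main _ _)) _.
- by move=> N t tr; apply: ap; rewrite tr.
- case=> u v tr; rewrite cabs_cexp ler_expR.
  have -> : Re ((2 * x)%:C * (u +i* v) - (u +i* v) ^+ 2) =
      2 * x * u - 2 * u ^+ 2 + (u ^+ 2 + v ^+ 2).
    by rewrite ReD ReN expr2 !ReM /=; ring.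
  rewrite -cabs_sqrE tr one_sub_tanh -/A.
  have Ap : 0 < A + 1 by lra.
  have ur : u ^+ 2 <= r ^+ 2 by rewrite -tr cabs_sqrE lerDl sqr_ge0.
  have h1 : (A - 1) * u ^+ 2 <= (A - 1) * r ^+ 2 by rewrite ler_wpM2l// subr_ge0.
  have h2 : 0 <= (x - (A + 1) * u) ^+ 2 / (A + 1) by rewrite divr_ge0 ?sqr_ge0// ltW.
  have h3 : (x - (A + 1) * u) ^+ 2 / (A + 1) =
     2 / (A + 1) * x ^+ 2 / 2 - 2 * x * u + (A + 1) * u ^+ 2.
    by field; rewrite gt_eqF.
  lra.
by rewrite -!expRD ler_expR -/A; lra.
Qed.

(** A weak form of Stirling's formula; the induction step is (1 - 1 / (n + 2))^(n + 2) <= 1 / e. *)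
Lemma fact_exp_bound n : n`!%:R * expR 1 ^+ n <= n.+1%:R ^+ n.+1 :> R.
Proof.
elim: n => [|n IH]; first by rewrite fact0 expr0 !expr1 mulr1.
have n2 : 0 < n.+2%:R :> R by rewrite ltr0n.
have step : expR 1 * n.+1%:R ^+ n.+2 <= n.+2%:R ^+ n.+2 :> R.
  have : n.+1%:R / n.+2%:R <= expR (- (n.+2%:R)^-1) :> R.
    apply: le_trans (expR_ge1Dx _); rewrite -[n.+2%:R]natr1.
    have : 0 <= n.+1%:R :> R by [].
    move: (n.+1%:R : R) => m m0; rewrite le_eqVlt; apply/orP; left; apply/eqP.
    by field; rewrite gt_eqF//; lra.
  have q0 : 0 <= n.+1%:R / n.+2%:R :> R by rewrite divr_ge0.
  move=> /(lerXn2r n.+2); rewrite !nnegrE q0 expR_ge0 => /(_ isT isT).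
  rewrite -expRM_natl mulrN mulfV ?gt_eqF// expRN exprMn exprVn.
  rewrite ler_pdivrMr ?exprn_gt0// => h.
  have := ler_wpM2l (expR_ge0 1) h.
  by rewrite [leRHS]mulrA mulfV ?mul1r// gt_eqF// expR_gt0.
apply: le_trans step; rewrite factS natrM exprS [n.+1%:R ^+ n.+2]exprS.
rewrite (_ : n.+1%:R * n`!%:R * (expR 1 * expR 1 ^+ n) =
  (expR 1 * n.+1%:R) * (n`!%:R * expR 1 ^+ n)); last ring.
by rewrite [leRHS]mulrA ler_wpM2l// mulr_ge0// expR_ge0.
Qed.

(** The normalization of [hermite_fun], with a last factor that undoes the division by n! in
    [hermite_coef]. *)
Definition hermite_norm n : R :=
  2 `^ (4^-1) * (2 ^+ n * (n`!)%:R) `^ (- 2^-1) * (n`!)%:R.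

Lemma hermite_funE n x :
  hermite_fun n x = hermite_norm n * (expR (- x ^+ 2 / 2) * hermite_coef n x).
Proof.
rewrite /hermite_fun /hermite_norm /hermite_coef.
by field; rewrite pnatr_eq0 -lt0n fact_gt0.
Qed.

Lemma hermite_norm_sqr n :
  hermite_norm n ^+ 2 = (2 `^ (4^-1)) ^+ 2 * ((n`!)%:R / 2 ^+ n).
Proof.
have f0 : 0 < n`!%:R :> R by rewrite ltr0n fact_gt0.
have p0 : 0 < 2 ^+ n * n`!%:R :> R by rewrite mulr_gt0// exprn_gt0.
rewrite /hermite_norm !exprMn.
have -> : ((2 ^+ n * n`!%:R) `^ (- 2^-1)) ^+ 2 = (2 ^+ n * n`!%:R)^-1 :> R.
  rewrite expr2 -powRD; last by rewrite (gt_eqF p0) implybT.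
  rewrite (_ : - 2^-1 + - 2^-1 = -1); last by field.
  by rewrite powR_inv1// ltW.
have p2 : 2 ^+ n != 0 :> R by rewrite expf_neq0.
move: (lt0r_neq0 f0) p2; move: (2 ^+ n : R) (n`!%:R : R) => u v v0 u0.
by field; rewrite ?u0 ?v0.
Qed.

Lemma inner_hermite f n : cintegrable (fun x => f x * gweight x * (hermite_coef n x)%:C) ->
  inner f (fun y => (hermite_fun n y)%:C) =
  (hermite_norm n * (Num.sqrt (2 * pi))^-1)%:C * gen_coef f n.
Proof.
move=> fint; rewrite /gen_coef -cintegralZ//; congr cintegral; apply/funext => x.
have -> : ((hermite_fun n x)%:C^*)%C = (hermite_fun n x)%:C :> R[i].
  by apply: complex_eq => //=; rewrite oppr0.
by rewrite hermite_funE !rcM /gweight; ring.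
Qed.

(* The radii in the two Cauchy estimates are chosen so that each exponential
   equals [expR (n.+1%:R / 2)]; the factorial then costs only a factor [n.+1]. *)
Lemma hermite_term_bound f (beta gamma : R) : 0 < gamma -> gamma < beta ->
  E (tanh (2 * beta)) f ->
  exists C q : R, [/\ 0 <= C, 0 < q < 1 & forall n x,
    cabs (inner f (fun y => (hermite_fun n y)%:C)) * `|hermite_fun n x|
      <= C * q ^+ n * expR (- (tanh gamma * x ^+ 2) / 2)].
Proof.
move=> g0 gb fE; have b0 : 0 < beta by exact: lt_trans gb.
have [C C0 HC] := gen_coef_bound b0 fE.
have t0 : 0 <= tanh (2 * beta) by apply: tanh_ge0; rewrite mulr_ge0// ltW.
have [C1 [C10 mf fC1]] := E_ae_bounded t0 fE.
(* Half of the gap yields the ratio [q]; the other half absorbs the polynomial loss, since (n + 1)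
   q^n <= 1 + 1 / d. *)
pose d := (beta - gamma) / 2.
have d0 : 0 < d by rewrite divr_gt0// subr_gt0.
pose q := expR (- d).
pose kap := (2 `^ (4^-1)) ^+ 2 * (Num.sqrt (2 * pi))^-1 : R.
have kap0 : 0 <= kap by rewrite mulr_ge0 ?sqr_ge0// invr_ge0 sqrtr_ge0.
exists (kap * C * expR 1 * (1 + d^-1)), q; split.
- by rewrite !mulr_ge0 ?expR_ge0// addr_ge0// invr_ge0 ltW.
- by rewrite expR_gt0 expR_lt1 oppr_lt0 d0.
move=> n x.
set e := expR (- (tanh gamma * x ^+ 2) / 2).
have e0 : 0 <= e by exact: expR_ge0.
pose y : R := Num.sqrt (n.+1%:R / 2).
have y0 : 0 < y by rewrite sqrtr_gt0 divr_gt0.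
have y2 : y ^+ 2 = n.+1%:R / 2 by rewrite sqr_sqrtr// divr_ge0.
pose r := expR beta * y; pose s := expR (- gamma) * y.
have r0 : 0 < r by rewrite mulr_gt0// expR_gt0.
have s0 : 0 < s by rewrite mulr_gt0// expR_gt0.
have er : expR (- 2 * beta) * r ^+ 2 = n.+1%:R / 2.
  by rewrite exprMn mulrA -expRM_natl -expRD y2 (_ : _ + _ = 0) ?expR0 ?mul1r//; ring.
have es : expR (2 * gamma) * s ^+ 2 = n.+1%:R / 2.
  by rewrite exprMn mulrA -expRM_natl -expRD y2 (_ : _ + _ = 0) ?expR0 ?mul1r//; ring.
have rs : r * s = expR (beta - gamma) * (n.+1%:R / 2).
  by rewrite expRD -y2 /r /s; ring.
have h1 := HC n r r0; rewrite er in h1.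
have h2 := hermite_coef_gauss_bound n x g0 s0; rewrite es -/e in h2.
have rs0 : 0 < (r * s) ^+ n by rewrite exprn_gt0// mulr_gt0.
set b := `|hermite_coef n x| * expR (- x ^+ 2 / 2).
have b0' : 0 <= b by rewrite mulr_ge0 ?expR_ge0.
have h3 : cabs (gen_coef f n) * b * (r * s) ^+ n <= C * expR 1 ^+ n.+1 * e.
  have -> : cabs (gen_coef f n) * b * (r * s) ^+ n =
    (cabs (gen_coef f n) * r ^+ n) *
    (`|hermite_coef n x| * s ^+ n * expR (- x ^+ 2 / 2)).
    by rewrite exprMn /b; ring.
  apply: le_trans (ler_pM _ _ h1 h2) _.
  - by rewrite mulr_ge0 ?cabs_ge0// exprn_ge0// ltW.
  - by rewrite !mulr_ge0 ?expR_ge0// exprn_ge0// ltW.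
  rewrite -expRM_natl mulr1 le_eqVlt; apply/orP; left; apply/eqP.
  have -> : expR n.+1%:R = expR (n.+1%:R / 2) * expR (n.+1%:R / 2) :> R.
    by rewrite -expRD; congr expR; field.
  ring.
have -> : cabs (inner f (fun y => (hermite_fun n y)%:C)) * `|hermite_fun n x| =
    kap * (n`!%:R / 2 ^+ n) * (cabs (gen_coef f n) * b).
  rewrite inner_hermite; last exact: gen_coef_integrable fC1.
  have nn : `|hermite_norm n| * `|hermite_norm n| = (2 `^ (4^-1)) ^+ 2 * (n`!%:R / 2 ^+ n).
    by rewrite -expr2 real_normK ?num_real// hermite_norm_sqr.
  rewrite hermite_funE cabsM cabs_real /b.
  move: (hermite_norm n) (hermite_coef n x) nn => u v nn.
  rewrite !normrM (ger0_norm (expR_ge0 _)) (ger0_norm (_ : 0 <= (Num.sqrt _)^-1));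
    last by rewrite invr_ge0 sqrtr_ge0.
  rewrite [LHS](_ : _ = (`|u| * `|u|) * (Num.sqrt (2 * pi))^-1 *
    (cabs (gen_coef f n) * (`|v| * expR (- x ^+ 2 / 2)))); last ring.
  by rewrite nn /kap; ring.
have {}h3 : cabs (gen_coef f n) * b <= C * expR 1 ^+ n.+1 * e / (r * s) ^+ n.
  by rewrite ler_pdivlMr.
have n1 : 0 < n.+1%:R :> R by rewrite ltr0n.
have f0 : 0 <= n`!%:R / 2 ^+ n :> R by rewrite divr_ge0// exprn_ge0.
apply: le_trans (ler_wpM2l (mulr_ge0 kap0 f0) h3) _.
have E2 : (expR (beta - gamma)) ^+ n = (q ^+ n * q ^+ n)^-1.
  rewrite -!expRM_natl -expRD -expRN; congr expR; rewrite /d; by field.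
rewrite rs exprMn E2.
have q0 : 0 < q ^+ n by rewrite exprn_gt0// expR_gt0.
rewrite (_ : kap * (n`!%:R / 2 ^+ n) * (C * expR 1 ^+ n.+1 * e /
   ((q ^+ n * q ^+ n)^-1 * (n.+1%:R / 2) ^+ n)) =
   kap * C * expR 1 * q ^+ n * e * (n`!%:R * expR 1 ^+ n / n.+1%:R ^+ n * q ^+ n)); last first.
  rewrite exprS exprMn exprVn; field.
  by rewrite !expf_neq0 ?gt_eqF ?expR_gt0.
rewrite (_ : kap * C * expR 1 * (1 + d^-1) * q ^+ n * e =
   kap * C * expR 1 * q ^+ n * e * (1 + d^-1)); last ring.
rewrite ler_wpM2l//; first by rewrite !mulr_ge0 ?expR_ge0// ltW.
apply: le_trans (_ : n.+1%:R * q ^+ n <= _).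
  rewrite ler_wpM2r ?(ltW q0)// ler_pdivrMr ?exprn_gt0// -exprS.
  exact: fact_exp_bound.
rewrite /q -expRM_natl mulrN expRN ler_pdivrMr ?expR_gt0//.
apply: le_trans (_ : (1 + d^-1) * (1 + n%:R * d) <= _).
  have -> : (1 + d^-1) * (1 + n%:R * d) = n.+1%:R + d^-1 + n%:R * d.
    by rewrite -natr1; field; rewrite gt_eqF.
  have : 0 <= d^-1 by rewrite invr_ge0 ltW.
  have : 0 <= n%:R * d by rewrite mulr_ge0// ltW.
  lra.
by rewrite ler_wpM2l ?expR_ge1Dx// addr_ge0// invr_ge0 ltW.
Qed.

(* Both sides are Taylor coefficients of the Gaussian transform of a pure
   phase, which is again a Hermite generating function. *)
Lemma fourier_hermite n (xi : R) :
  fourier (fun x => (hermite_fun n x)%:C) xi =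
  ((Num.sqrt (2 * pi))^-1)%:C * gauss_const R * (- 'i%C) ^+ n
   * (hermite_fun n xi)%:C.
Proof.
pose f x := cexpi (- (xi * x)).
have fE x : f x = cexp (- xi%:C * 'i%C * x%:C).
  by rewrite /f cexpi_cexp; congr cexp; rewrite rcN rcM; ring.
have mf : cmeasurable f.
  by rewrite (funext fE); exact: cmeasurable_expline.
have f1 : {ae mu, forall x, cabs (f x) <= 1}.
  by apply: ae_all => x; rewrite cabs_cexpi.
pose c : R[i] := gauss_const R * gweight xi.
have gE t : gen_transform f t = c * hermite_gen xi (- 'i%C * t).
  have -> : gen_transform f t = cexp (- t ^+ 2) *
      gtransform (fun=> 1) (2 * t - xi%:C * 'i%C).
    congr (_ * cintegral _); apply/funext => x.
    rewrite fE mul1r mulrC mulrA -cexpD [LHS]mulrC; congr (_ * cexp _); ring.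
  have gw : gweight xi = cexp (- 2^-1 * xi%:C ^+ 2).
    rewrite -[gweight xi]cexp_real; congr cexp.
    rewrite (_ : - xi ^+ 2 / 2 = - (2^-1 * (xi * xi))); last by field.
    by rewrite rcN !rcM rcV rc_nat; ring.
  rewrite gtransform1 mulrCA -cexpD /c -mulrA gw /hermite_gen -cexpD.
  congr (_ * cexp _).
  rewrite rcM rc_nat.
  have i2 : ('i%C : R[i]) ^+ 2 = -1 by rewrite expr2 sqr_iC.
  rewrite (_ : 2^-1 * (2 * t - xi%:C * 'i%C) ^+ 2 = 2 * t ^+ 2
    - 2 * t * xi%:C * 'i%C + 2^-1 * xi%:C ^+ 2 * 'i%C ^+ 2); last by field.
  by rewrite exprMn sqrrN i2; ring.
have key : gen_coef f n = c * (- 'i%C) ^+ n * (hermite_coef n xi)%:C.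
  apply/eqP; rewrite -subr_eq0; apply/eqP; apply: cabs0_eq0; apply/eqP.
  rewrite eq_le cabs_ge0 andbT.
  have [A HA] := gen_transform_approx mf ler01 f1 ler01.
  have [A' [B [B0 HB]]] := @hermite_gen_approx R 1 ler01.
  (* The two coefficient sequences belong to the same function, so the truncated sums of their
     difference approach 0, and Cauchy's estimate is applied with bound 0. *)
  have := @cauchy_estimate R
    (fun m => gen_coef f m - c * (- 'i%C) ^+ m * (hermite_coef m xi)%:C)
    (fun=> 0) 1 0 (A + cabs c * expR (A' + B * `|xi|)) n ltr01.
  rewrite expr1n mulr1; apply; last by move=> t _; rewrite cabs0.
  move=> N t t1.
  have it : cabs (- 'i%C * t) <= 1 by rewrite cabsM cabsN cabs_i t1 mul1r.
  have := HB N xi _ it; have := HA N t t1.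
  set S1 := \sum_(0 <= m < N.+2) _; set S2 := \sum_(0 <= m < N.+2) _ => h1 h2.
  rewrite (_ : _ - 0 = (S1 - gen_transform f t) -
     c * (S2 - hermite_gen xi (- 'i%C * t))); last first.
    rewrite gE mulrBr opprB addrA subrK subr0 /S1 /S2 big_distrr/=.
    rewrite -sumrB; apply: eq_bigr => m _; rewrite exprMn; ring.
  apply: le_trans (cabsB _ _) _; rewrite cabsM mulrDl lerD//.
  by rewrite -[leRHS]mulrA ler_wpM2l ?cabs_ge0.
rewrite /fourier hermite_funE.
have -> : cintegral (fun x => (hermite_fun n x)%:C * cexpi (- (xi * x))) =
   (hermite_norm n)%:C * gen_coef f n.
  rewrite -cintegralZ; last exact: gen_coef_integrable f1.
  congr cintegral; apply/funext => x.
  by rewrite hermite_funE !rcM /gweight /f; ring.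
by rewrite key /c /gweight !rcM; ring.
Qed.

End HermiteExpansion.

(** * The propagator *)

Section L2Limits.
Variable R : realType.
Local Notation mu := (@lebesgue_measure R).

Lemma Lnorm2_mono (h k : R -> R) : measurable_fun setT h -> measurable_fun setT k ->
  (forall x, 0 <= h x <= k x) ->
  ('N[mu]_(2%:E)[EFin \o h] <= 'N[mu]_(2%:E)[EFin \o k])%E.
Proof.
move=> mh mk hk; rewrite unlock.
have mp (l : R -> R) : measurable_fun setT l ->
    measurable_fun setT (fun x => (`|(EFin \o l) x| `^ 2)%E).
  move=> ml; apply: (@measurableT_comp _ _ _ _ _ _ (fun x => x `^ 2)%E) => //.
    exact: measurable_poweR.
  by apply: measurableT_comp => //; exact/measurable_EFinP.
apply: gt0_ler_poweR; rewrite ?invr_ge0//.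
- by rewrite in_itv/= leey andbT; apply: integral_ge0 => x _; rewrite /= lee_fin powR_ge0.
- by rewrite in_itv/= leey andbT; apply: integral_ge0 => x _; rewrite /= lee_fin powR_ge0.
apply: ge0_le_integral => //.
- by move=> x _; exact: poweR_ge0.
- exact: mp.
- exact: mp.
- move=> x _; apply: gt0_ler_poweR => //.
  + by rewrite in_itv/= leey andbT.
  + by rewrite in_itv/= leey andbT.
  + have /andP[h0 hk'] := hk x; rewrite /= lee_fin !ger0_norm//.
    exact: le_trans hk'.
Qed.

(** The excess of |u - S N| over [g] is pointwise at most |u - S M| for every M >= N. Its L^2 norm
    is thus below a sequence tending to 0, so the excess vanishes almost everywhere. *)
Lemma L2_limit_ae_bound (u : R -> R[i]) (S : nat -> R -> R[i]) (g : R -> R) (N : nat) :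
  cmeasurable u -> (forall M, cmeasurable (S M)) -> measurable_fun setT g ->
  (forall M x, (N <= M)%N -> cabs (S M x - S N x) <= g x) ->
  (fun M => L2norm (fun x => u x - S M x)) @ \oo --> 0%E ->
  {ae mu, forall x, cabs (u x - S N x) <= g x}.
Proof.
move=> mu' mS mg Sg cvg0.
have mB M : cmeasurable (fun x => u x - S M x).
  rewrite (_ : (fun x => _) = (fun x => u x + -1 * S M x)).
    by apply: cmeasurableD => //; apply: cmeasurableM => //; exact: cmeasurable_cst.
  by apply/funext => x; rewrite mulN1r.
pose h x : R := Num.max 0 (cabs (u x - S N x) - g x).
have mh : measurable_fun setT h.
  apply: measurable_maxr => //.
  by apply: measurable_funB => //; exact: measurable_cabs.
have hle M : (N <= M)%N -> ('N[mu]_(2%:E)[EFin \o h] <= L2norm (fun x => (u x - S M x)%R))%E.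
  move=> NM; apply: (@Lnorm2_mono h (fun x => cabs (u x - S M x))) => //.
    exact: measurable_cabs.
  move=> x; rewrite le_max lexx /= ge_max cabs_ge0 /= lerBlDr.
  have := cabsD (u x - S M x) (S M x - S N x).
  rewrite addrA subrK => /le_trans; apply.
  by rewrite lerD2l; exact: Sg.
have h0 : ('N[mu]_(2%:E)[EFin \o h] = 0)%E.
  apply/eqP; rewrite eq_le Lnorm_ge0 andbT; apply/lee_addgt0Pr => e e0; rewrite add0e.
  have nb : nbhs 0%E [set y : \bar R | (y < e%:E)%E].
    apply: open_nbhs_nbhs; split; first exact: open_ereal_lt_ereal.
    by rewrite /= lte_fin.
  have [N0 _ HN0] := cvg0 _ nb.
  apply: le_trans (hle (maxn N N0) (leq_maxl _ _)) _.
  by apply/ltW/HN0; rewrite /= leq_maxr.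
have p2 : (0 < 2%:E :> \bar R)%E by rewrite lte_fin.
have : (EFin \o h) = \0%E %[ae mu].
  by apply: (Lnorm_eq0_eq0 _ p2 h0); exact/measurable_EFinP.
apply: ae_mono => x /(_ I) /=.
move=> [] /eqP; rewrite eq_le => /andP[+ _].
by rewrite ge_max lexx /= subr_le0.
Qed.

Lemma geometric_sum_bound (q : R) (N M : nat) : 0 < q < 1 ->
  \sum_(N <= n < M) q ^+ n <= q ^+ N / (1 - q).
Proof.
move=> /andP[q0 q1]; have q2 : 0 < 1 - q by rewrite subr_gt0.
have [NM|MN] := leqP N M; last first.
  rewrite big_geq ?(ltnW MN)//; apply: divr_ge0; last exact: ltW.
  by rewrite exprn_ge0// ltW.
rewrite ler_pdivlMr//.
suff -> : (\sum_(N <= n < M) q ^+ n) * (1 - q) = q ^+ N - q ^+ M.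
  by rewrite gerBl exprn_ge0// ltW.
rewrite -(subnKC NM); elim: (M - N)%N => [|k IH].
  by rewrite addn0 big_geq// mul0r subrr.
rewrite addnS big_nat_recr ?leq_addr//= mulrDl IH exprS; ring.
Qed.

End L2Limits.

Theorem theorem3p1 (R : realType) (gamma beta : R)
    (gamma_gt0 : 0 < gamma) (gamma_lt_beta : gamma < beta)
    (psi0 : R -> R[i]) (psi0E : E (tanh (2 * beta)) psi0)
    (psi : R -> R -> R[i]) (psiS : schrodinger_solution psi0 psi) :
  (forall t : R, E (tanh gamma) (psi t)) /\
  exists M : R, forall t : R, E_bound (tanh gamma) M (psi t).
Proof.
have [C [q [C0 q01 HC]]] := hermite_term_bound gamma_gt0 gamma_lt_beta psi0E.
have q1 : 0 < 1 - q by rewrite subr_gt0; case/andP: q01.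
have q0 : 0 < q by case/andP: q01.
pose tau := tanh gamma.
have tau0 : 0 < tau.
  apply: divr_gt0; last by rewrite addr_gt0// expR_gt0.
  by rewrite subr_gt0 ltr_expR; lra.
pose g x := expR (- (tau * x ^+ 2) / 2).
have g0 x : 0 <= g x by exact: expR_ge0.
pose eps N := C * (q ^+ N / (1 - q)).
have eps0 N : 0 <= eps N by rewrite mulr_ge0// divr_ge0 ?exprn_ge0 ?ltW.
have [G [G0 HG]] := @gaussian_integral R (tau / 2) ltac:(by rewrite divr_gt0).
have gE : g = (fun x => expR (- (tau / 2 * (x - 0) ^+ 2))).
  by apply/funext => x; rewrite /g subr0; congr expR; field.
have ig : (@lebesgue_measure R).-integrable setT (EFin \o g) by rewrite gE; exact: (HG 0).1.
have Ig : \int[lebesgue_measure]_x g x = G by rewrite gE; exact: (HG 0).2.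
have mg : measurable_fun setT g by apply/measurable_EFinP; exact: measurable_int ig.
pose c t n : R[i] := cexpi ((2 * n + 1)%:R * t) * inner psi0 (fun y => (hermite_fun n y)%:C).
(* Time enters only through phases of modulus 1, which makes all later bounds uniform in [t]. *)
have cn t n : cabs (c t n) = cabs (inner psi0 (fun y => (hermite_fun n y)%:C)).
  by rewrite /c cabsM cabs_cexpi mul1r.
pose S t N x := propagator_partial_sum psi0 t N x.
have SE t N x : S t N x = \sum_(0 <= n < N) c t n * (hermite_fun n x)%:C by [].
have term t n x : cabs (c t n * (hermite_fun n x)%:C) <= C * q ^+ n * g x.
  by rewrite cabsM cabs_real cn; exact: HC.
have Stail t N M x : (N <= M)%N -> cabs (S t M x - S t N x) <= eps N * g x.
  move=> NM; rewrite !SE (big_cat_nat (n := N))//= [X in cabs X]addrAC subrr add0r.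
  apply: le_trans (cabs_sum _ _ _) _.
  apply: le_trans (_ : \sum_(N <= n < M) C * q ^+ n * g x <= _).
    by apply: ler_sum => n _; exact: term.
  rewrite -big_distrl -big_distrr /= ler_wpM2r// ler_wpM2l//.
  exact: geometric_sum_bound.
have one1 : {ae (@lebesgue_measure R), forall x, cabs ((fun=> 1 : R[i]) x) <= 1}.
  by apply: ae_all => x; rewrite cabs1.
have hi n : cintegrable (fun x : R => (hermite_fun n x)%:C).
  rewrite (_ : (fun x => _) = (fun x => (hermite_norm R n)%:C *
    (1 * gweight x * (hermite_coef n x)%:C))).
    apply: cintegrableZ.
    by apply: (gen_coef_integrable n _ ler01 one1); exact: cmeasurable_cst.
  by apply/funext => x; rewrite hermite_funE !rcM mul1r.
have hm n := cintegrable_measurable (hi n).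
have mS t N : cmeasurable (S t N).
  apply: (@cmeasurable_sum _ _ (fun n x => c t n * (hermite_fun n x)%:C)) => n.
  by apply: cmeasurableM => //; exact: cmeasurable_cst.
(* For [N = 0] the partial sum is empty and this is the bound on [psi t] itself; large [N] serves
   the Fourier side. *)
have approx t N : {ae (@lebesgue_measure R), forall x,
    cabs (psi t x - S t N x) <= eps N * g x}.
  have [[mp _] cvg0] := psiS t.
  apply: L2_limit_ae_bound cvg0 => //; first exact: measurable_funM.
  by move=> M x; exact: Stail.
have mphase xi : cmeasurable (fun x : R => cexpi (- (xi * x))).
  rewrite (_ : (fun x => _) = (fun x => cexp ((- (xi * x))%:C * 'i%C))); last first.
    by apply/funext => x; rewrite cexpi_cexp.
  apply: cmeasurable_cexp; apply: cmeasurableM; last exact: cmeasurable_cst.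
  by apply: cmeasurable_real; apply: measurableT_comp => //; exact: measurable_funM.
have ae_psi t : {ae (@lebesgue_measure R), forall x, cabs (psi t x) <= eps 0 * g x}.
  move: (approx t 0%N); apply: ae_mono => x.
  by rewrite SE big_geq// subr0.
have ipsi t : cintegrable (psi t).
  have [[mp _] _] := psiS t.
  apply: (cintegral_dominated mp _ _ (ae_psi t)).1.
    by move=> x; rewrite mulr_ge0.
  exact: (integrableZl measurableT (eps 0) ig).
pose s := (Num.sqrt (2 * pi))^-1 : R.
have s0 : 0 <= s by rewrite invr_ge0 sqrtr_ge0.
pose K := s * cabs (gauss_const R).
have K0 : 0 <= K by rewrite mulr_ge0// cabs_ge0.
(* Each Hermite function is multiplied by a constant of modulus [K], so the termwise bounds apply
   again at [xi]. *)
have fS t N xi : cabs (fourier (S t N) xi) <= K * eps 0 * g xi.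
  have ihp n : cintegrable (fun x => (hermite_fun n x)%:C * cexpi (- (xi * x))).
    have [hr him] := hi n.
    apply: (cintegral_dominated (g := fun x => `|hermite_fun n x|) _ _ _ _).1.
    - exact: cmeasurableM.
    - by [].
    - exact: (integrable_abse hr).
    - by apply: ae_all => x; rewrite cabsM cabs_cexpi mulr1 cabs_real.
  have -> : fourier (S t N) xi = \sum_(0 <= n < N)
      c t n * fourier (fun x => (hermite_fun n x)%:C) xi.
    have [_ e2] := @cintegral_sum R N
      (fun n x => c t n * ((hermite_fun n x)%:C * cexpi (- (xi * x))))
      (fun n => cintegrableZ _ (ihp n)).
    rewrite /fourier.
    have -> : (fun x => S t N x * cexpi (- (xi * x))) = (fun x => \sum_(0 <= n < N)
        c t n * ((hermite_fun n x)%:C * cexpi (- (xi * x)))).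
      apply/funext => x; rewrite SE big_distrl /=.
      by apply: eq_bigr => n _; rewrite mulrA.
    rewrite e2 big_distrr /=; apply: eq_bigr => n _.
    by rewrite (cintegralZ _ (ihp n)) mulrCA.
  apply: le_trans (cabs_sum _ _ _) _.
  apply: le_trans (_ : \sum_(0 <= n < N) (C * q ^+ n) * (K * g xi) <= _).
    apply: ler_sum => n _.
    rewrite fourier_hermite.
    have -> : c t n * (((Num.sqrt (2 * pi))^-1)%:C * gauss_const R *
      (- 'i%C) ^+ n * (hermite_fun n xi)%:C) =
      ((Num.sqrt (2 * pi))^-1)%:C * gauss_const R * (- 'i%C) ^+ n *
       (c t n * (hermite_fun n xi)%:C) by ring.
    rewrite cabsM (_ : cabs (_ * _ ^+ n) = K); last first.
      by rewrite cabsM cabsX cabsN cabs_i expr1n mulr1 cabsM cabs_real ger0_norm.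
    rewrite [leRHS]mulrCA ler_wpM2l//; exact: term.
  rewrite -big_distrl -big_distrr /= (_ : K * eps 0 * g xi = eps 0 * (K * g xi)); last ring.
  apply: ler_wpM2r; first exact: mulr_ge0.
  by apply: ler_wpM2l => //; exact: geometric_sum_bound.
(* The Fourier transform is bounded at every point by the L^1 norm, and [psi t] differs from its
   [N]-th partial sum by at most [eps N * G] in that norm; the bound for partial sums therefore
   passes to the limit. *)
have fpsi t xi : cabs (fourier (psi t) xi) <= K * eps 0 * g xi.
  apply/ler_addgt0Pr => e e0.
  have [N HN] : exists N, s * (2 * (eps N * G)) <= e.
    pose B := s * (2 * (C / (1 - q) * G)).
    have B0 : 0 <= B by rewrite !mulr_ge0// ?invr_ge0 ltW.
    have /cvgrPdist_lt := @cvg_expr R q ltac:(by rewrite ger0_norm ?ltW//; case/andP: q01).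
    move=> /(_ (e / (B + 1))); rewrite divr_gt0// ?ltr_wpDl// => /(_ isT).
    move=> [N _ HN]; exists N.
    have qN0 : 0 <= q ^+ N by rewrite exprn_ge0// ltW.
    have := HN N (leqnn N); rewrite /= sub0r normrN (ger0_norm qN0).
    rewrite ltr_pdivlMr ?ltr_wpDl// => qN.
    have -> : s * (2 * (eps N * G)) = q ^+ N * B by rewrite /eps /B; ring.
    apply: le_trans (ltW qN); rewrite ler_wpM2l ?lerDl// exprn_ge0// ltW.
  have [[mp _] _] := psiS t.
  have mD : cmeasurable (fun x => (psi t x + -1 * S t N x) * cexpi (- (xi * x))).
    apply: cmeasurableM => //; apply: cmeasurableD => //.
    by apply: cmeasurableM => //; exact: cmeasurable_cst.
  have [iD bD] := @cintegral_dominated R _ (fun x => eps N * g x) mD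
    (fun x => mulr_ge0 (eps0 N) (g0 x)) (integrableZl measurableT (eps N) ig)
    ltac:(move: (approx t N); apply: ae_mono => x;
      by rewrite cabsM cabs_cexpi mulr1 mulN1r).
  rewrite RintegralZl// Ig in bD.
  have iS : cintegrable (fun x => S t N x * cexpi (- (xi * x))).
    apply: (cintegral_dominated (g := fun x => eps 0 * g x) _ _ _ _).1.
    - exact: cmeasurableM.
    - by move=> x; rewrite mulr_ge0.
    - exact: (integrableZl measurableT (eps 0) ig).
    - apply: ae_all => x; rewrite cabsM cabs_cexpi mulr1.
      have := Stail t 0%N N x (leq0n N).
      by rewrite [S t 0%N x]SE big_geq// subr0.
  have -> : fourier (psi t) xi = (s%:C * cintegral (fun x =>
      (psi t x + -1 * S t N x) * cexpi (- (xi * x)))) + fourier (S t N) xi.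
    rewrite /fourier -mulrDr -cintegralD//; congr (_ * cintegral _).
    by apply/funext => x; ring.
  apply: le_trans (cabsD _ _) _; rewrite addrC lerD//.
  rewrite cabsM cabs_real ger0_norm//; apply: le_trans HN.
  by rewrite ler_wpM2l.
pose D := Num.max (eps 0) (K * eps 0).
have bound t : E_bound (tanh gamma) D (psi t).
  split.
    move: (ae_psi t); apply: ae_mono => x h; apply: le_trans h _.
    by rewrite ler_wpM2r ?g0// le_max lexx.
  move=> xi; apply: le_trans (fpsi t xi) _.
  by rewrite ler_wpM2r ?g0// le_max lexx orbT.
split; last by exists D.
by move=> t; split; [exact: ipsi | exists D].
Qed.
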